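(* Let $n\ge 1$ and let $u(\underline{x},y)\in\mathcal{D}(\mathbb{R}^{n+1}_+)$ with boundary function $f\in L^2(\mathbb{R}^n)$. Let $F(\underline{x},y)$ be the canonical left-monogenic function in $\mathbb{R}^{n+1}_+$ with scalar part $u(\underline{x},y)$. Then $$\int_{\mathbb{R}^{n+1}_+}|\nabla u(\underline{x},y)|^2\,d\underline{x}\,dy=2\pi\int_{\mathbb{R}^n}|\underline{t}|\,|\hat f(\underline{t})|^2\,d\underline{t}=\int_{\mathbb{R}^{n+1}_+}|\bar D F(\underline{x},y)|^2\,d\underline{x}\,dy=\frac{1}{\omega_n}\int_{\mathbb{R}^n}\int_{\mathbb{R}^n}\frac{|f(\underline{t_1})-f(\underline{t_2})|^2}{|\underline{t_1}-\underline{t_2}|^{n+1}}\,d\underline{t_1}\,d\underline{t_2}.$$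
   Context: $\mathbb{R}^{n+1}_+=\{(\underline{x},y):\underline{x}\in\mathbb{R}^n,\ y>0\}$. $\nabla$ is the full gradient in the $n+1$ variables $(\underline{x},y)$. Harmonic Hardy space: $h^2(\mathbb{R}^{n+1}_+)$ is the set of real-valued harmonic functions $u$ on $\mathbb{R}^{n+1}_+$ with $\sup_{y>0}\int_{\mathbb{R}^n}|u(\underline{x},y)|^2d\underline{x}<\infty$. Each $u\in h^2(\mathbb{R}^{n+1}_+)$ is the Poisson integral of a unique $f\in L^2(\mathbb{R}^n)$, its boundary function: $u(\underline{x},y)=\frac{2}{\omega_n}\int_{\mathbb{R}^n}\frac{y}{(y^2+|\underline{x}-\underline{t}|^2)^{(n+1)/2}}f(\underline{t})\,d\underline{t}$, and $u(\underline{x},y)\to f(\underline{x})$ a.e. as $y\to0^+$. Here $\omega_n=2\pi^{(n+1)/2}/\Gamma(\frac{n+1}{2})$ is the surface area of the unit sphere $S^n\subset\mathbb{R}^{n+1}$. Dirichlet space: $\mathcal{D}(\mathbb{R}^{n+1}_+)=\{u\in h^2(\mathbb{R}^{n+1}_+):\int_{\mathbb{R}^{n+1}_+}|\nabla u|^2d\underline{x}\,dy<\infty\}$. Fourier transform: $\hat f(\underline{t})=\int_{\mathbb{R}^n}e^{2\pi \mathbf{i}\,\underline{x}\cdot\underline{t}}f(\underline{x})\,d\underline{x}$, extended to $L^2(\mathbb{R}^n)$ as usual. Clifford setting: let $\mathcal{CL}_{0,n}$ be the real Clifford algebra generated by $\mathbf{e}_1,\dots,\mathbf{e}_n$ with $\mathbf{e}_j\mathbf{e}_k+\mathbf{e}_k\mathbf{e}_j=-2\delta_{jk}$,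 with the norm $|x|=(\sum_A|x_A|^2)^{1/2}$ for $x=\sum_A x_A\mathbf{e}_A$ in the standard linear basis; the scalar part of $x$ is the coefficient of $1$. A point $\underline{x}\in\mathbb{R}^n$ is identified with $\sum_k x_k\mathbf{e}_k$. With $x_0=y$, put $D=\frac12\big(\frac{\partial}{\partial y}+\sum_{k=1}^n\mathbf{e}_k\frac{\partial}{\partial x_k}\big)$ and $\bar D=\frac12\big(\frac{\partial}{\partial y}-\sum_{k=1}^n\mathbf{e}_k\frac{\partial}{\partial x_k}\big)$, acting from the left. A $C^1$ function $g$ with values in $\mathcal{CL}_{0,n}$ is left-monogenic if $Dg=0$. Canonical left-monogenic function of $u$: $F(\underline{x},y)=u(\underline{x},y)+\sum_{k=1}^n v_k(\underline{x},y)\mathbf{e}_k=\frac{2}{\omega_n}\int_{\mathbb{R}^n}\frac{y+\underline{t}-\underline{x}}{(y^2+|\underline{t}-\underline{x}|^2)^{(n+1)/2}}f(\underline{t})\,d\underline{t}$, i.e. $v_k(\underline{x},y)=\frac{2}{\omega_n}\int_{\mathbb{R}^n}\frac{t_k-x_k}{(y^2+|\underline{t}-\underline{x}|^2)^{(n+1)/2}}f(\underline{t})\,d\underline{t}$. *)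

(* Defs.v *)
From HB Require Import structures.
From mathcomp Require Import all_boot all_order all_algebra.
From mathcomp Require Import all_classical all_reals all_analysis.
From mathcomp Require Import complex.
Import numFieldNormedType.Exports.

Set Implicit Arguments.
Unset Strict Implicit.
Unset Printing Implicit Defensive.

Import Order.TTheory GRing.Theory Num.Theory.

Local Open Scope classical_set_scope.
Local Open Scope ring_scope.

(* The product sigma-algebra on matrices, generated by the entries; on
   'rV[R]_n with R : realType it is the Borel sigma-algebra of R^n. *)
Definition measure_matrix_display : measure_display -> measure_display.
Proof. exact. Qed.

Section measurable_matrix.
Context {d : measure_display} {T : sigmaRingType d} (m n : nat).

Definition matrix_cylinders : set (set 'M[T]_(m, n)) :=
  [set A | exists i j (B : set T),
     measurable B /\ A = (fun M : 'M[T]_(m, n) => M i j) @^-1` B].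

Let matrix_set0 : <<s matrix_cylinders >> set0.
Proof. exact: sigma_algebra0. Qed.

Let matrix_setC A : <<s matrix_cylinders >> A -> <<s matrix_cylinders >> (~` A).
Proof. exact: sigma_algebraC. Qed.

Let matrix_bigcup (F : (set 'M[T]_(m, n))^nat) :
  (forall i, <<s matrix_cylinders >> (F i)) ->
  <<s matrix_cylinders >> (\bigcup_i F i).
Proof. exact: sigma_algebra_bigcup. Qed.

HB.instance Definition _ := @isMeasurable.Build (measure_matrix_display d)
  'M[T]_(m, n) <<s matrix_cylinders >> matrix_set0 matrix_setC matrix_bigcup.

End measurable_matrix.

Lemma measurable_coord d (T : measurableType d) m n i j :
  measurable_fun [set: 'M[T]_(m, n)] (fun M : 'M[T]_(m, n) => M i j).
Proof.
move=> _ B mB; rewrite setTI; apply: sub_sigma_algebra.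
by exists i, j, B.
Qed.

Lemma measurable_fun_matrix d d' (S : measurableType d') (T : measurableType d)
    m n (f : S -> 'M[T]_(m, n)) :
  (forall i j, measurable_fun [set: S] (fun s => f s i j)) ->
  measurable_fun [set: S] f.
Proof.
move=> mf; apply: (measurability (@matrix_cylinders _ T m n)) => //.
move=> _ [_ [i [j [B [mB ->]]]] <-].
exact: mf.
Qed.

(* n-dimensional Lebesgue measure, by recursion on n: the unit mass at the only
   point of R^0, and the image of lambda_1 \x lambda_n under R x R^n = R^(1+n). *)
Section rV_cons.
Context {R : realType} (n : nat).

Definition rV_cons (p : measurableTypeR R * 'rV[R]_n) : 'rV[R]_n.+1 :=
  row_mx (const_mx p.1 : 'rV[R]_1) p.2.

Definition rV_uncons (v : 'rV[R]_n.+1) : measurableTypeR R * 'rV[R]_n :=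
  (v 0 0, @rsubmx R 1 1 n v).

Lemma rV_consK : cancel rV_cons rV_uncons.
Proof.
move=> [a v]; rewrite /rV_uncons /rV_cons /=; congr pair.
  transitivity (row_mx (const_mx a : 'rV_1) v 0 (lshift n 0)).
    by congr (row_mx _ _ _ _); apply/val_inj.
  by rewrite row_mxEl mxE.
by rewrite row_mxKr.
Qed.

Lemma measurable_rV_cons : measurable_fun setT rV_cons.
Proof.
apply: measurable_fun_matrix => i j.
rewrite /rV_cons; case: (@splitP 1 n j) => k jk.
- rewrite (_ : (fun _ => _) = fst)//; apply/funext => -[a v] /=.
  have -> : j = lshift n k by apply/val_inj.
  by apply: etrans (row_mxEl _ _ _ _) _; rewrite mxE.
- rewrite (_ : (fun _ => _) = (fun v : 'rV[R]_n => v i k) \o snd).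
    by apply: measurableT_comp => //; exact: measurable_coord.
  apply/funext => -[a v] /=.
  have -> : j = rshift 1 k by apply/val_inj.
  exact: etrans (row_mxEr _ _ _ _) _.
Qed.

Lemma measurable_rV_uncons : measurable_fun setT rV_uncons.
Proof.
apply: measurable_fun_pair; first exact: measurable_coord.
apply: measurable_fun_matrix => i j.
rewrite (_ : (fun _ => _) = (fun v : 'rV[R]_n.+1 => v i (rshift 1 j))).
  exact: measurable_coord.
by apply/funext => v; rewrite mxE.
Qed.

Variable mu : {sigma_finite_measure set 'rV[R]_n -> \bar R}.

Definition rV_cons_measure : set 'rV[R]_n.+1 -> \bar R :=
  pushforward (@lebesgue_measure R \x mu)%E rV_cons.

Let rV_cons_preimage A : measurable A -> measurable (rV_cons @^-1` A).
Proof. by move=> mA; rewrite -[X in measurable X]setTI; exact: measurable_rV_cons. Qed.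

Let rV_cons_measure0 : rV_cons_measure set0 = 0%E.
Proof. by rewrite /rV_cons_measure /pushforward preimage_set0 measure0. Qed.

Let rV_cons_measure_ge0 A : (0 <= rV_cons_measure A)%E.
Proof. by rewrite /rV_cons_measure /pushforward measure_ge0. Qed.

Let rV_cons_measure_sigma_additive : semi_sigma_additive rV_cons_measure.
Proof.
move=> F mF tF mUF; rewrite /rV_cons_measure /pushforward preimage_bigcup.
apply: measure_semi_sigma_additive.
- by move=> k; exact: rV_cons_preimage.
- apply/trivIsetP => i j _ _ ij; rewrite -preimage_setI.
  by move/trivIsetP : tF => /(_ _ _ _ _ ij) ->//; rewrite preimage_set0.
- by rewrite -preimage_bigcup; exact: rV_cons_preimage.
Qed.

HB.instance Definition _ := isMeasure.Build _ _ _ rV_cons_measure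
  rV_cons_measure0 rV_cons_measure_ge0 rV_cons_measure_sigma_additive.

Let rV_cons_measure_sigma_finite : sigma_finite setT rV_cons_measure.
Proof.
have /sigma_finiteP[F [TF ndF Foo]] := sigma_finiteT (@lebesgue_measure R).
have /sigma_finiteP[G [TG ndG Goo]] := sigma_finiteT mu.
exists (fun k => rV_uncons @^-1` (F k `*` G k)).
  rewrite -preimage_bigcup (_ : \bigcup_k _ = setT) ?preimage_setT//.
  apply/seteqP; split => // -[x v] _.
  have [k _ Fkx] : (\bigcup_k F k) x by rewrite -TF.
  have [l _ Glv] : (\bigcup_k G k) v by rewrite -TG.
  exists (maxn k l) => //; split => /=.
    by move: Fkx; exact/subsetPset/ndF/leq_maxl.
  by move: Glv; exact/subsetPset/ndG/leq_maxr.
move=> k; have [mFk Fkoo] := Foo k; have [mGk Gkoo] := Goo k; split.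
  rewrite -[X in measurable X]setTI.
  by apply: measurable_rV_uncons => //; exact: measurableX.
rewrite /rV_cons_measure /pushforward -comp_preimage.
rewrite (_ : rV_uncons \o rV_cons = id); last first.
  by apply/funext => p /=; rewrite rV_consK.
by rewrite preimage_id product_measure1E// lte_mul_pinfty// ge0_fin_numE.
Qed.

HB.instance Definition _ := Measure_isSigmaFinite.Build _ _ _ rV_cons_measure
  rV_cons_measure_sigma_finite.

End rV_cons.

Fixpoint lebesgue_rV (R : realType) (n : nat) :
    {sigma_finite_measure set 'rV[R]_n -> \bar R} :=
  match n with
  | 0 => dirac (0 : 'rV[R]_0)
  | k.+1 => rV_cons_measure (lebesgue_rV R k)
  end.

Lemma rV_cons0 (R : realType) n (p : measurableTypeR R * 'rV[R]_n) :
  rV_cons p 0 ord0 = p.1.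
Proof. by rewrite -[in RHS](rV_consK p). Qed.

Lemma rV_consS (R : realType) n (p : measurableTypeR R * 'rV[R]_n) j :
  rV_cons p 0 (lift ord0 j) = p.2 0 j.
Proof.
rewrite -[in RHS](rV_consK p) [RHS]mxE.
by congr (rV_cons p 0 _); apply/val_inj.
Qed.

Lemma lebesgue_rV_box (R : realType) n (A : 'I_n -> set R) :
  (forall i, measurable (A i)) ->
  lebesgue_rV R n [set v | forall i, A i (v 0 i)] =
  (\prod_(i < n) lebesgue_measure (A i))%E.
Proof.
elim: n A => [|n IH] A mA.
  by rewrite big_ord0 /= diracE mem_set//= => -[].
rewrite big_ord_recl -IH// /= /rV_cons_measure /pushforward.
set B := [set v : 'rV[R]_n | forall i, A (lift ord0 i) (v 0 i)].
have mB : measurable B.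
  rewrite (_ : B = \bigcap_(i in [set: 'I_n])
      ((fun v : 'rV[R]_n => v 0 i) @^-1` A (lift ord0 i))).
    apply: fin_bigcap_measurable => // i _.
    by rewrite -[X in measurable X]setTI; exact: measurable_coord.
  by apply/seteqP; split => v /= Bv i => [_|]; exact: Bv.
rewrite -(product_measure1E (@lebesgue_measure R) _ (mA ord0) mB).
congr (product_measure1 _ _ _).
apply/seteqP; split => p /=.
  move=> Ap; split => [|i] /=; first by move: (Ap ord0); rewrite rV_cons0.
  by move: (Ap (lift ord0 i)); rewrite rV_consS.
move=> [/= Aa Bv] i; case: (unliftP ord0 i) => [j|] ->.
  by rewrite rV_consS; exact: Bv.
by rewrite rV_cons0.
Qed.

Section euclidean.
Context {R : realType} {n : nat}.

(* The library norm on 'rV[R]_n is the sup norm. *)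
Definition dotp (x t : 'rV[R]_n) : R := \sum_(i < n) x 0 i * t 0 i.

Definition enorm (x : 'rV[R]_n) : R := Num.sqrt (dotp x x).

End euclidean.

Section constants.
Context {R : realType}.

Definition Gamma (s : R) : R :=
  \int[lebesgue_measure]_(x in `]0, +oo[) (x `^ (s - 1) * expR (- x)).

Definition sphere_area (n : nat) : R :=
  2 * pi `^ (n.+1%:R / 2) / Gamma (n.+1%:R / 2).

End constants.

Section half_space.
Context {R : realType} {n : nat}.
Implicit Types (u : 'rV[R]_n * R -> R) (f : 'rV[R]_n -> R).

Definition half_space : set ('rV[R]_n * R) := [set p | 0 < p.2].

Definition lebesgue_half := (lebesgue_rV R n \x @lebesgue_measure R)%E.

HB.instance Definition _ := Measure.on lebesgue_half.

(* Coordinate directions of R^(n+1): None for y = x_0, Some k for x_k. *)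
Definition direction (i : option 'I_n) : 'rV[R]_n * R :=
  if i is Some k then (delta_mx 0 k, 0) else (0, 1).

Definition partial (i : option 'I_n) u (p : 'rV[R]_n * R) : R :=
  'D_(direction i) u p.

(* Real-valued C^2 functions with vanishing Laplacian on the half-space. *)
Definition harmonic_half_space u : Prop :=
  forall p, half_space p ->
  [/\ {for p, continuous u},
      forall i, derivable u p (direction i) /\ {for p, continuous (partial i u)},
      forall i j, derivable (partial i u) p (direction j) /\
                  {for p, continuous (partial j (partial i u))} &
      \sum_i partial i (partial i u) p = 0].

Definition hardy2 u : Prop :=
  harmonic_half_space u /\
  (ereal_sup [set \int[lebesgue_rV R n]_x (`|u (x, y)| ^+ 2)%:E
             | y in [set y : R | (0 < y)%R]] < +oo)%E.

Definition dirichlet_energy u : \bar R :=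
  (\int[lebesgue_half]_(p in half_space)
     (\sum_i partial i u p ^+ 2)%:E)%E.

Definition dirichlet_space u : Prop :=
  hardy2 u /\ (dirichlet_energy u < +oo)%E.

Definition L2 f : Prop := f \in Lfun (lebesgue_rV R n) 2%:E.

Definition poisson_integral f (p : 'rV[R]_n * R) : R :=
  2 / sphere_area n *
  \int[lebesgue_rV R n]_t
    (p.2 / (p.2 ^+ 2 + enorm (p.1 - t) ^+ 2) `^ (n.+1%:R / 2) * f t).

Definition boundary_function u f : Prop :=
  L2 f /\ forall p, half_space p -> u p = poisson_integral f p.

Definition conjugate_poisson_integral f (k : 'I_n) (p : 'rV[R]_n * R) : R :=
  2 / sphere_area n *
  \int[lebesgue_rV R n]_t
    ((t 0 k - p.1 0 k) / (p.2 ^+ 2 + enorm (t - p.1) ^+ 2) `^ (n.+1%:R / 2)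
     * f t).

End half_space.

Section fourier.
Context {R : realType} {n : nat}.
Implicit Types (f : 'rV[R]_n -> R) (g : 'rV[R]_n -> R[i]).

Definition L1 f : Prop := f \in Lfun (lebesgue_rV R n) 1.

Definition fourier f (t : 'rV[R]_n) : R[i] :=
  (\int[lebesgue_rV R n]_x (cos (2 * pi * dotp x t) * f x) +i*
   \int[lebesgue_rV R n]_x (sin (2 * pi * dotp x t) * f x))%C.

Definition complex_L2 g : Prop :=
  L2 (fun t => complex.Re (g t)) /\ L2 (fun t => complex.Im (g t)).

(* g is the extension to L^2 by continuity of the Fourier integral at f. *)
Definition is_fourier_L2 f g : Prop :=
  complex_L2 g /\
  exists F : nat -> 'rV[R]_n -> R,
    [/\ forall k, L1 (F k) /\ L2 (F k),
        ((\int[lebesgue_rV R n]_x (`|F k x - f x| ^+ 2)%:E)%E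
           @[k --> \oo] --> 0%E) &
        ((\int[lebesgue_rV R n]_t (Normc.normc (fourier (F k) t - g t) ^+ 2)%:E)%E
           @[k --> \oo] --> 0%E)].

End fourier.

Section clifford.
Context {R : realType} {n : nat}.

(* Coordinates x_A in the standard basis e_A, where e_A is the product of the
   e_k, k in A, in increasing order. *)
Definition clifford := {ffun {set 'I_n} -> R^o}.

(* e_A e_B = cl_sign A B * e_(A + B), with + the symmetric difference: one sign
   for each transposition, plus one for each e_k ^ 2 = -1. *)
Definition cl_sign (A B : {set 'I_n}) : R :=
  (-1) ^+ #|[set ij : 'I_n * 'I_n |
               [&& ij.1 \in A, ij.2 \in B & (ij.2 <= ij.1)%N]]%SET|.

Definition symdiff (A B : {set 'I_n}) : {set 'I_n} := ((A :\: B) :|: (B :\: A))%SET.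

Definition cl_mul (x y : clifford) : clifford :=
  [ffun C => \sum_A \sum_(B | symdiff A B == C) cl_sign A B * (x A * y B)].

Definition cl_scalar (a : R) : clifford := [ffun A => if A == finset.set0 then a else 0].

Definition cl_gen (k : 'I_n) : clifford := [ffun A => (A == [set k]%SET)%:R].

Lemma cl_mul_gen (j k : 'I_n) :
  cl_mul (cl_gen j) (cl_gen k) + cl_mul (cl_gen k) (cl_gen j)
  = cl_scalar (- 2 * (j == k)%:R).
Proof.
have mulE a b C : cl_mul (cl_gen a) (cl_gen b) C =
    (symdiff [set a] [set b] == C)%:R * (-1) ^+ (b <= a)%N.
  rewrite ffunE (bigD1 [set a]%SET)//= [X in _ + X]big1 ?addr0; last first.
    move=> A nA; apply: big1 => B _.
    by rewrite !ffunE (negbTE nA) mul0r mulr0.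
  rewrite big_mkcond (bigD1 [set b]%SET)//= [X in _ + X]big1 ?addr0; last first.
    move=> B nB; case: ifP => // _.
    by rewrite !ffunE (negbTE nB) !mulr0.
  rewrite !ffunE !eqxx !mulr1; case: ifP => _; rewrite ?mul0r// mul1r.
  rewrite /cl_sign; congr (_ ^+ _).
  rewrite (_ : [set ij | _]%SET = if (b <= a)%N then [set (a, b)]%SET else finset.set0).
    by case: ifP => _; rewrite ?cards1 ?cards0.
  apply/setP => -[x y]; rewrite !inE /=.
  have [->|xa] := eqVneq x a; have [->|yb] := eqVneq y b;
    by case: ifP => //= _; rewrite !inE ?xpair_eqE ?eqxx ?(negbTE xa) ?(negbTE yb).
apply/ffunP => C; rewrite [LHS]ffunE !mulE [RHS]ffunE.
have symC (A B : {set 'I_n}) : symdiff A B = symdiff B A by exact: finset.setUC.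
have [->|jk] := eqVneq j k.
  rewrite leqnn /symdiff finset.setDv finset.setU0 expr1 mulr1 eq_sym.
  by case: eqP => _; rewrite ?mul0r ?addr0// !mul1r -opprD.
rewrite mulr0 if_same (symC [set k]%SET) -mulrDr.
suff -> : (-1) ^+ (k <= j)%N + (-1) ^+ (j <= k)%N = 0 :> R by rewrite mulr0.
by move: jk; rewrite -val_eqE /= neq_ltn; case: ltngtP => //= _ _;
  rewrite ?expr0 ?expr1 ?addNr ?subrr.
Qed.

Definition cl_norm (x : clifford) : R := Num.sqrt (\sum_A `|x A| ^+ 2).

Definition cl_partial (i : option 'I_n) (F : 'rV[R]_n * R -> clifford)
    (p : 'rV[R]_n * R) : clifford :=
  [ffun A => partial i (fun q => F q A : R) p].

Definition cl_Dbar (F : 'rV[R]_n * R -> clifford) (p : 'rV[R]_n * R) : clifford :=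
  (2^-1 : R) *: (cl_partial None F p -
           \sum_(k < n) cl_mul (cl_gen k) (cl_partial (Some k) F p)).

Definition canonical_monogenic (u : 'rV[R]_n * R -> R) (f : 'rV[R]_n -> R)
    (p : 'rV[R]_n * R) : clifford :=
  cl_scalar (u p) +
  \sum_(k < n) conjugate_poisson_integral f k p *: cl_gen k.

End clifford.

(* Main.v *)
(* On the Fourier side everything reduces to the weight |t| |fhat(t)|^2.
   The functions z_j / |z|^(n+1) of z = (y, x), integrated against f, give u and
   the v_k up to the factor 2 / omega_n and a sign; their gradient is a symmetric trace-free
   matrix (d_i k_j), which is why |Dbar F|^2 and |grad u|^2 agree pointwise.
   Gaussian subordination of |z|^-(n+1) gives the transform e^(-2 pi |t| y) of the
   Poisson kernel, hence, differentiating under the integral, that of its partial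
   derivatives; their squared moduli add up to 8 pi^2 |t|^2 e^(-4 pi |t| y),
   whose integral over y > 0 is 2 pi |t|.
   For the double integral, Plancherel applied to f(. + h) - f produces the factor
   2 - 2 cos(2 pi h.t), and its integral against |h|^-(n+1) is the limit as y
   decreases to 0 of integrals against the Poisson kernel, namely a multiple of
   (1 - e^(-2 pi |t| y)) / y, which tends to 2 pi |t|.
   Plancherel itself is obtained from the quadratic form of the Gaussian
   approximate identity, whose transform is again Gaussian. *)

Require Import Defs.
From mathcomp Require Import all_boot all_order all_algebra.
From mathcomp Require Import all_classical all_reals all_analysis.
From mathcomp Require Import measurable_realfun.
From mathcomp Require Import complex ring lra.
Import numFieldNormedType.Exports.
Import Order.TTheory GRing.Theory Num.Theory.

Set Implicit Arguments.
Unset Strict Implicit.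
Unset Printing Implicit Defensive.

Local Open Scope classical_set_scope.
Local Open Scope ring_scope.

(** * Integration and square-integrable functions *)

(** The measure on R^n is a recursive product, so every radial computation is reduced to Gaussians,
    the radial functions that factor over the coordinates. The only constant that this leaves is
    [pow_gauss_integral n], the integral of |x|^n e^(-x^2) over the line; it is the Gamma value in
    [sphere_area], and [normalizationK] cancels the two without computing either. The L2 transform
    is known only through some approximating sequence in L1 and L2. Hence each multiplier identity
    is proved for functions in L1 and L2, where the transform is a pair of cosine and sine
    integrals, and carried to f by boundedness of the operator on L2 ([is_FT_multiplier]). Smooth
    functions never enter Plancherel. What it needs, that the quadratic defect of Gaussian
    mollification tends to 0 on all of L2, follows from a monotone class argument started on
    indicators of sets where a Lipschitz function is positive. The energy identities are equalities
    of extended reals between integrals of nonnegative functions, exchanged by Tonelli; Plancherel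
    is applied slice by slice, at a fixed height y or a fixed translation h. *)

Section integral_tools.
Context d (T : measurableType d) (R : realType) (m : {measure set T -> \bar R}).
Implicit Types (f g : T -> R) (F : T -> \bar R).

(** An integrable extended-real function is finite almost everywhere, so [fine] changes it only on a
    null set. *)
Lemma integrable_fine F : m.-integrable setT F ->
  m.-integrable setT (EFin \o (fine \o F)) /\
  (\int[m]_x (fine (F x))%:E = \int[m]_x F x)%E.
Proof.
move=> iF; have [mF _] := integrableP _ _ _ iF.
have mf : measurable_fun setT (fine \o F).
  by apply: measurableT_comp => //; exact: fine_measurable.
split.
  apply: (le_integrable _ _ _ iF) => //; first exact/measurable_EFinP.
  move=> x _ /=.
  by case: (F x) => [r| |] /=; rewrite ?normr0 ?leey.
apply: ae_eq_integral => //; first exact/measurable_EFinP.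
have := integrable_ae measurableT iF; apply: filterS => x /= h _.
by rewrite fineK ?h.
Qed.

Lemma EFin_Rintegral f : m.-integrable setT (EFin \o f) ->
  (\int[m]_x f x)%:E = (\int[m]_x (f x)%:E)%E.
Proof. by move=> fi; rewrite fineK//; exact: integrable_fin_num fi. Qed.

Lemma integrable_measurable f : m.-integrable setT (EFin \o f) ->
  measurable_fun setT f.
Proof. by case/integrableP => /measurable_EFinP. Qed.

Lemma le_integrableR f g : measurable_fun setT f ->
  (forall x, `|f x| <= g x) -> m.-integrable setT (EFin \o g) ->
  m.-integrable setT (EFin \o f).
Proof.
move=> mf fg; apply: le_integrable => //; first exact/measurable_EFinP.
by move=> x _; rewrite lee_fin (le_trans (fg x))// ler_norm.
Qed.

Lemma integrableDR f g : m.-integrable setT (EFin \o f) ->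
  m.-integrable setT (EFin \o g) -> m.-integrable setT (EFin \o (fun x => f x + g x)).
Proof.
by move=> fi gi; exact: (integrableD measurableT fi gi).
Qed.

Lemma integrableBR f g : m.-integrable setT (EFin \o f) ->
  m.-integrable setT (EFin \o g) -> m.-integrable setT (EFin \o (fun x => f x - g x)).
Proof.
by move=> fi gi; exact: (integrableB measurableT fi gi).
Qed.

Lemma integrableZR (k : R) f : m.-integrable setT (EFin \o f) ->
  m.-integrable setT (EFin \o (fun x => k * f x)).
Proof. by move=> fi; exact: (integrableZl measurableT k fi). Qed.

Lemma integrableMR (C : R) f g : measurable_fun setT g -> (forall x, `|g x| <= C) ->
  m.-integrable setT (EFin \o f) -> m.-integrable setT (EFin \o (fun x => f x * g x)).
Proof.
move=> mg gC fi; apply: (@le_integrableR _ (fun x => C * `|f x|)).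
- by apply: measurable_funM => //; exact: integrable_measurable.
- by move=> x; rewrite normrM mulrC ler_wpM2r.
- by apply: integrableZR; exact: integrable_norm.
Qed.

Lemma ge0_integrable_lty f : measurable_fun setT f -> (forall x, 0 <= f x) ->
  (\int[m]_x (f x)%:E < +oo)%E -> m.-integrable setT (EFin \o f).
Proof.
move=> mf f0 h; apply/integrableP; split; first exact/measurable_EFinP.
by under eq_integral do rewrite /= ger0_norm ?f0//.
Qed.

Lemma integrable_ge0_lty f : m.-integrable setT (EFin \o f) -> (forall x, 0 <= f x) ->
  (\int[m]_x (f x)%:E < +oo)%E.
Proof.
move=> /integrableP[_ h] f0; move: h.
by under eq_integral do rewrite /= ger0_norm ?f0//.
Qed.

End integral_tools.

(** * Fubini's theorem for real-valued integrals *)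

Section fubini_real.
Context d1 d2 (T1 : measurableType d1) (T2 : measurableType d2) (R : realType).
Variables (m1 : {sigma_finite_measure set T1 -> \bar R}).
Variables (m2 : {sigma_finite_measure set T2 -> \bar R}).
Implicit Type h : T1 * T2 -> R.

Lemma RFubini1 h : (m1 \x m2)%E.-integrable setT (EFin \o h) ->
  m1.-integrable setT (EFin \o (fun x => \int[m2]_y h (x, y))) /\
  \int[m1]_x \int[m2]_y h (x, y) = \int[(m1 \x m2)%E]_z h z.
Proof.
move=> hi.
have [h1 h2] := integrable_fine (integrable_fubini_F hi).
split; first exact: h1.
by rewrite /Rintegral; congr fine; rewrite -(integral12_prod_meas1 hi) -h2.
Qed.

Lemma RFubini2 h : (m1 \x m2)%E.-integrable setT (EFin \o h) ->
  m2.-integrable setT (EFin \o (fun y => \int[m1]_x h (x, y))) /\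
  \int[m2]_y \int[m1]_x h (x, y) = \int[(m1 \x m2)%E]_z h z.
Proof.
move=> hi.
have iG : m2.-integrable setT (fubini_G m1 (EFin \o h)).
  have [mh _] := integrableP _ _ _ hi.
  apply/integrableP; split; first exact: (measurable_fubini_G hi).
  apply: le_lt_trans ((integrable21ltyP m1 m2 mh).1 hi).
  apply: ge0_le_integral => //.
  - by apply: measurableT_comp => //; exact: (measurable_fubini_G hi).
  - have mn : measurable_fun setT (abse \o (EFin \o h)) by exact: measurableT_comp.
    exact: (measurable_fun_fubini_tonelli_G _ mn (fun _ => abse_ge0 _)).
  - move=> y _; apply: le_abse_integral => //.
    exact: (measurableT_comp mh (pair2_measurable y)).
have [h1 h2] := integrable_fine iG.
split; first exact: h1.
by rewrite /Rintegral; congr fine; rewrite -(integral21_prod_meas1 hi) -h2.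
Qed.

Lemma RFubini h : (m1 \x m2)%E.-integrable setT (EFin \o h) ->
  \int[m1]_x \int[m2]_y h (x, y) = \int[m2]_y \int[m1]_x h (x, y).
Proof. by move=> hi; rewrite (RFubini1 hi).2 (RFubini2 hi).2. Qed.

(** No integrability is assumed: the integrals of the positive and negative parts are measurable by
    Tonelli, and so is their difference, even where both are infinite and its value is
    conventional. *)
Lemma measurable_Rintegral1 h : measurable_fun setT h ->
  measurable_fun setT (fun x => \int[m2]_y h (x, y)).
Proof.
move=> mh; rewrite /Rintegral; apply: measurableT_comp; first exact: fine_measurable.
under eq_fun do rewrite integralE.
apply: emeasurable_funB.
- have mn : measurable_fun setT ((EFin \o h)^\+)%E.
    by apply: measurable_funepos; exact/measurable_EFinP.
  rewrite [X in measurable_fun _ X](_ : _ = fubini_F m2 ((EFin \o h)^\+)%E).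
    by apply: measurable_fun_fubini_tonelli_F.
  by apply/funext => x; apply: eq_integral => y _; rewrite !funeposE.
- have mn : measurable_fun setT ((EFin \o h)^\-)%E.
    by apply: measurable_funeneg; exact/measurable_EFinP.
  rewrite [X in measurable_fun _ X](_ : _ = fubini_F m2 ((EFin \o h)^\-)%E).
    by apply: measurable_fun_fubini_tonelli_F.
  by apply/funext => x; apply: eq_integral => y _; rewrite !funenegE.
Qed.

Lemma integrable_prod (f : T1 -> R) (g : T2 -> R) :
  m1.-integrable setT (EFin \o f) -> m2.-integrable setT (EFin \o g) ->
  (m1 \x m2)%E.-integrable setT (EFin \o (fun z => f z.1 * g z.2)).
Proof.
move=> fi gi.
have mf := integrable_measurable fi; have mg := integrable_measurable gi.
apply/integrable12ltyP.
  apply/measurable_EFinP; apply: measurable_funM.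
    exact: measurableT_comp.
  exact: measurableT_comp.
have e x : (\int[m2]_y `|(f x * g y)%:E| = `|f x|%:E * \int[m2]_y `|g y|%:E)%E.
  under eq_integral do rewrite /= normrM EFinM.
  by rewrite ge0_integralZl//; apply/measurable_EFinP; exact: measurableT_comp.
under eq_integral do rewrite e.
rewrite ge0_integralZr//; last 2 first.
- by apply/measurable_EFinP; exact: measurableT_comp.
- by apply: integral_ge0.
have /integrableP[_ fo] := fi; have /integrableP[_ go] := gi.
by rewrite lte_mul_pinfty// ?integral_ge0// ge0_fin_numE ?integral_ge0.
Qed.

End fubini_real.

(** * Square-integrable functions and continuity of the squared norm *)

Section square_integrable.
Context d (T : measurableType d) (R : realType) (m : {measure set T -> \bar R}).
Implicit Types f g : T -> R.

(** Measurability is a separate clause because that of the square does not imply it. *)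
Definition sq_integrable f :=
  measurable_fun setT f /\ m.-integrable setT (EFin \o (fun x => f x ^+ 2)).

Lemma sq_integrable_lty f : measurable_fun setT f ->
  (\int[m]_x (f x ^+ 2)%:E < +oo)%E -> sq_integrable f.
Proof.
move=> mf foo; split=> //; apply: ge0_integrable_lty => //.
- exact: measurable_funX.
- by move=> x; exact: sqr_ge0.
Qed.

Lemma Lfun2_sq_integrable f : f \in Lfun m 2%:E -> sq_integrable f.
Proof.
move=> fL; split; last exact: Lfun2_integrable_sqr.
by move: (sub_Lfun_mfun fL); rewrite inE.
Qed.

Lemma le_sq_integrable f g : measurable_fun setT f -> (forall x, `|f x| <= `|g x|) ->
  sq_integrable g -> sq_integrable f.
Proof.
move=> mf fg [mg gi]; split => //; apply: le_integrableR gi.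
- exact: measurable_funX.
- by move=> x; rewrite ger0_norm ?sqr_ge0// -[leLHS]real_normK ?num_real//
    -[leRHS]real_normK ?num_real// lerXn2r ?nnegrE.
Qed.

Lemma sq_integrableM f g : sq_integrable f -> sq_integrable g ->
  m.-integrable setT (EFin \o (fun x => f x * g x)).
Proof.
move=> [mf fi] [mg gi]; apply: le_integrableR (integrableDR fi gi).
- exact: measurable_funM.
- move=> x /=; rewrite ler_norml; apply/andP; split.
    by have := sqr_ge0 (f x + g x); have := sqr_ge0 (f x); have := sqr_ge0 (g x); nra.
  by have := sqr_ge0 (f x - g x); have := sqr_ge0 (f x); have := sqr_ge0 (g x); nra.
Qed.

Lemma sq_integrableZ (c : R) f : sq_integrable f -> sq_integrable (fun x => c * f x).
Proof.
move=> [mf fi]; split; first exact: measurable_funM.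
under [X in EFin \o X]eq_fun do rewrite exprMn.
exact: integrableZR.
Qed.

Lemma sq_integrableD f g : sq_integrable f -> sq_integrable g ->
  sq_integrable (fun x => f x + g x).
Proof.
move=> fi gi; have [mf f2] := fi; have [mg g2] := gi.
split; first exact: measurable_funD.
under [X in EFin \o X]eq_fun do rewrite sqrrD.
apply: integrableDR => //; apply: integrableDR => //.
under [X in EFin \o X]eq_fun do rewrite -mulr_natl.
by apply: integrableZR; exact: sq_integrableM.
Qed.

Lemma sq_integrableB f g : sq_integrable f -> sq_integrable g ->
  sq_integrable (fun x => f x - g x).
Proof.
move=> fi gi; have := sq_integrableD fi (sq_integrableZ (-1) gi).
by under [X in sq_integrable X]eq_fun do rewrite mulN1r.
Qed.

Lemma sq_integrable_bounded (C : R) f : measurable_fun setT f ->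
  (forall x, `|f x| <= C) -> m.-integrable setT (EFin \o f) -> sq_integrable f.
Proof.
move=> mf fC fi; split => //.
under [X in EFin \o X]eq_fun do rewrite expr2.
exact: integrableMR fC fi.
Qed.

Lemma sq_integrable_bounded_mul (C : R) f g : measurable_fun setT f ->
  (forall x, `|f x| <= C) -> sq_integrable g -> sq_integrable (fun x => f x * g x).
Proof.
move=> mf fC gi; apply: (le_sq_integrable _ _ (sq_integrableZ C gi)).
  by apply: measurable_funM => //; case: gi.
move=> x; rewrite !normrM ler_wpM2r//.
by rewrite (le_trans (fC x))// ler_norm.
Qed.

(* Peter-Paul: [2 |g (f - g)| <= e g^2 + e^-1 (f - g)^2]. *)
Lemma sq_integral_close (e : R) f g : 0 < e -> sq_integrable f -> sq_integrable g ->
  `|\int[m]_x (f x ^+ 2) - \int[m]_x (g x ^+ 2)| <=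
  e * (\int[m]_x (g x ^+ 2)) + (1 + e^-1) * \int[m]_x ((f x - g x) ^+ 2).
Proof.
move=> e0 fi gi; have [_ f2] := fi; have [_ g2] := gi.
have [_ d2] := sq_integrableB fi gi.
rewrite -RintegralB// -RintegralZl// -RintegralZl// -RintegralD//; last 2 first.
- exact: integrableZR.
- exact: integrableZR.
apply: le_trans (le_normr_Rintegral _ _) _ => //; first exact: integrableBR.
apply: le_Rintegral => //.
- by apply: integrable_norm; exact: integrableBR.
- by apply: integrableDR; exact: integrableZR.
move=> x _ /=.
set a := f x; set b := g x.
have -> : a ^+ 2 - b ^+ 2 = (a - b) ^+ 2 + 2 * b * (a - b) by ring.
(* [s] is a sign; the instances 1 and -1 bound the cross term from both sides by completing the
   square. *)
have h s : s ^+ 2 = 1 -> s * (2 * b * (a - b)) <= e * b ^+ 2 + e^-1 * (a - b) ^+ 2.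
  move=> s1; rewrite -subr_ge0.
  have -> : e * b ^+ 2 + e^-1 * (a - b) ^+ 2 - s * (2 * b * (a - b)) =
    e^-1 * (e * b - s * (a - b)) ^+ 2 + (1 - s ^+ 2) * (e^-1 * (a - b) ^+ 2).
    by field; rewrite gt_eqF.
  by rewrite s1 subrr mul0r addr0 mulr_ge0 ?invr_ge0 ?sqr_ge0 ?ltW.
have := h 1 (expr1n _ _); have := h (-1) (etrans (sqrrN _) (expr1n _ _)).
rewrite !mulN1r !mul1r => h1 h2.
by have := sqr_ge0 (a - b); rewrite ler_norml mulrDl mul1r => h3; apply/andP; split; lra.
Qed.

Lemma sq_integral_cvg (F : nat -> T -> R) f : (forall k, sq_integrable (F k)) ->
  sq_integrable f ->
  (\int[m]_x ((F k x - f x) ^+ 2)%:E)%E @[k --> \oo] --> 0%E ->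
  \int[m]_x (F k x ^+ 2) @[k --> \oo] --> \int[m]_x (f x ^+ 2).
Proof.
move=> Fi fi cF.
have cR : \int[m]_x ((F k x - f x) ^+ 2) @[k --> \oo] --> (0 : R) by exact: fine_cvg.
apply/cvgrPdist_le => eps eps0.
set N := \int[m]_x (f x ^+ 2).
have N0 : 0 <= N by apply: Rintegral_ge0 => x _; exact: sqr_ge0.
(* This [e] makes the first term of [sq_integral_close] at most eps / 2; N + 1 replaces N to allow N
   = 0. *)
pose e := eps / (2 * (N + 1)).
have N1 : 0 < 2 * (N + 1) by rewrite mulr_gt0// ltr_wpDl.
have e0 : 0 < e by rewrite divr_gt0.
have c0 : 0 < 1 + e^-1 by rewrite ltr_wpDr// invr_ge0 ltW.
have d0 : 0 < eps / 2 / (1 + e^-1) by rewrite !divr_gt0.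
move/cvgrPdist_le : cR => /(_ _ d0); apply: filterS => k /=.
rewrite sub0r normrN => h.
rewrite distrC (le_trans (sq_integral_close e0 (Fi k) fi))//.
rewrite (splitr eps) lerD//.
  rewrite /e -/N mulrAC ler_pdivrMr// [_ / 2 * _]mulrC mulrA.
  have -> : 2 * (N + 1) * eps / 2 = eps * (N + 1) by field.
  by rewrite ler_pM2l// lerDl.
rewrite mulrC -ler_pdivlMr//; apply: le_trans h; exact: ler_norm.
Qed.

End square_integrable.

(** * Lebesgue measure on R^n *)

Section lebesgue_rV_integral.
Context {R : realType}.
Local Open Scope ereal_scope.
Local Notation leb := (@lebesgue_measure R).

(** Reflections are the basic symmetry here: they are what convolution kernels [k (x - t)] call for,
    and two of them compose to a translation. *)
Lemma lebesgue_measure_reflect (a : R) (A : set R) : measurable A ->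
  pushforward leb (fun x => (a - x)%R : measurableTypeR R) A = leb A.
Proof.
move=> mA; apply/esym/lebesgue_measure_unique => //=.
  by apply: measurable_funB => //; exact: measurable_cst.
move=> mf _ [[b c]] _ <-.
rewrite /pushforward (_ : _ @^-1` _ = `[(a - c)%R, (a - b)%R[%classic); last first.
  apply/seteqP; split => x /=; rewrite !in_itv/= => /andP[h1 h2]; apply/andP; split; lra.
rewrite !lebesgue_measure_itv/= !lte_fin.
by rewrite ltrD2l ltrN2; case: ifP => // _; rewrite -!EFinD; congr EFin; lra.
Qed.

Lemma integral_reflect1 (a : R) (g : R -> \bar R) : measurable_fun setT g ->
  (forall x, 0 <= g x) -> \int[leb]_x g (a - x)%R = \int[leb]_x g x.
Proof.
move=> mg g0.
transitivity (\int[pushforward leb (fun x => (a - x)%R : measurableTypeR R)]_x g x).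
  rewrite ge0_integral_pushforward//=.
  by apply: measurable_funB => //; exact: measurable_cst.
apply: eq_measure_integral => //=.
  by apply: measurable_funB => //; exact: measurable_cst.
by move=> mf A mA _; exact: lebesgue_measure_reflect.
Qed.

Lemma ge0_integral_rV_cons n (g : 'rV[R]_n.+1 -> \bar R) : measurable_fun setT g ->
  (forall x, 0 <= g x) ->
  \int[lebesgue_rV R n.+1]_x g x =
  \int[leb]_a \int[lebesgue_rV R n]_v g (rV_cons (a, v)).
Proof.
move=> mg g0.
rewrite -[RHS](@fubini_tonelli1 _ _ _ _ _ leb (lebesgue_rV R n) (g \o (@rV_cons R n)))//.
  have := @ge0_integral_pushforward _ _ _ _ _ _ (@measurable_rV_cons R n)
    (leb \x lebesgue_rV R n) setT g measurableT mg (fun x _ => g0 x).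
  by rewrite preimage_setT => <-.
  by apply: measurableT_comp => //; exact: measurable_rV_cons.
by move=> x; exact: g0.
Qed.

Lemma rV_consB n (a : R) (v : 'rV[R]_n) (x : 'rV[R]_n.+1) :
  (x - rV_cons (a, v) = rV_cons ((rV_uncons x).1 - a, (rV_uncons x).2 - v))%R.
Proof.
apply/rowP => i; case: (unliftP ord0 i) => [j|] ->.
  rewrite [in RHS]rV_consS/= !mxE -!/(fun_of_matrix _ _ _).
  have := rV_consS (a, v) j; rewrite /= => <-.
  by rewrite !mxE; congr (x _ _ - _)%R; apply/val_inj.
by rewrite [in RHS]rV_cons0/= mxE mxE rV_cons0.
Qed.

Lemma measurable_rVB n (x : 'rV[R]_n) :
  measurable_fun setT (fun t : 'rV[R]_n => (x - t)%R).
Proof.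
apply: measurable_fun_matrix => i j; under eq_fun do rewrite !mxE.
by apply: measurable_funB => //; exact: measurable_coord.
Qed.

(** Induction on the dimension: Tonelli splits off the first coordinate, [integral_reflect1]
    reflects it and the induction hypothesis reflects the others. *)
Lemma integral_reflect n (x : 'rV[R]_n) (g : 'rV[R]_n -> \bar R) :
  measurable_fun setT g -> (forall t, 0 <= g t) ->
  \int[lebesgue_rV R n]_t g (x - t)%R = \int[lebesgue_rV R n]_t g t.
Proof.
elim: n => [|n IH] in x g *.
  by move=> _ _; apply: eq_integral => t _; congr g; apply/rowP => -[].
move=> mg g0.
have mgx : measurable_fun setT (fun t : 'rV[R]_n.+1 => g (x - t)%R).
  exact: measurableT_comp mg (measurable_rVB x).
pose h (a : R) := \int[lebesgue_rV R n]_v g (rV_cons (a, v)).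
have mgc : measurable_fun setT (g \o (@rV_cons R n)).
  exact: measurableT_comp mg (@measurable_rV_cons R n).
apply: etrans (ge0_integral_rV_cons mgx (fun _ => g0 _)) _.
apply: etrans _ (esym (ge0_integral_rV_cons mg g0)).
transitivity (\int[leb]_a h ((rV_uncons x).1 - a)%R).
  apply: eq_integral => a _; rewrite /h.
  under eq_integral do rewrite rV_consB.
  apply: (IH (rV_uncons x).2 (fun v => g (rV_cons ((rV_uncons x).1 - a, v))%R)) => //.
  exact: (measurableT_comp mgc (pair1_measurable _)).
apply: integral_reflect1.
  by apply: (measurable_fun_fubini_tonelli_F (g \o (@rV_cons R n))) => // z; exact: g0.
by move=> a; exact: integral_ge0.
Qed.

End lebesgue_rV_integral.

Section lebesgue_rV_invariance.
Context {R : realType} {n : nat}.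
Local Notation mu := (lebesgue_rV R n).
Local Notation rV := 'rV[R]_n.
Implicit Types (f : rV -> R) (x : rV).

Lemma measurable_rVD x : measurable_fun setT (fun t : rV => t + x).
Proof.
apply: measurable_fun_matrix => i j; under eq_fun do rewrite !mxE.
by apply: measurable_funD => //; exact: measurable_coord.
Qed.

(** The reflection in 0 followed by the reflection [t |-> x - t] is the translation by [x]. *)
Lemma integral_translate x (g : rV -> \bar R) : measurable_fun setT g ->
  (forall t, 0 <= g t)%E -> (\int[mu]_t g (t + x)%R = \int[mu]_t g t)%E.
Proof.
move=> mg g0.
have mgx : measurable_fun setT (fun t : rV => g (x - t)).
  exact: measurableT_comp mg (measurable_rVB x).
rewrite -(integral_reflect x mg g0) -(integral_reflect 0 mgx (fun _ => g0 _)).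
by apply: eq_integral => t _; rewrite sub0r opprK addrC.
Qed.

Lemma integral_reflectE x (g : rV -> \bar R) : measurable_fun setT g ->
  (\int[mu]_t g (x - t)%R = \int[mu]_t g t)%E.
Proof.
move=> mg; rewrite integralE [RHS]integralE; congr (_ - _)%E.
- rewrite -(integral_reflect x (measurable_funepos mg) (fun t => funepos_ge0 g t)).
  by apply: eq_integral => t _; rewrite !funeposE.
- rewrite -(integral_reflect x (measurable_funeneg mg) (fun t => funeneg_ge0 g t)).
  by apply: eq_integral => t _; rewrite !funenegE.
Qed.

Lemma Rintegral_reflect x f : measurable_fun setT f ->
  \int[mu]_t f (x - t) = \int[mu]_t f t.
Proof.
move=> mf; rewrite /Rintegral; congr fine.
by apply: (integral_reflectE x (g := EFin \o f)); exact/measurable_EFinP.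
Qed.

Lemma Rintegral_opp f : measurable_fun setT f ->
  \int[mu]_t f (- t) = \int[mu]_t f t.
Proof.
move=> mf; rewrite -[RHS](Rintegral_reflect 0)//.
by apply: eq_Rintegral => t _; rewrite sub0r.
Qed.

Lemma Rintegral_odd f : measurable_fun setT f -> (forall t, f (- t) = - f t) ->
  mu.-integrable setT (EFin \o f) -> \int[mu]_t f t = 0.
Proof.
move=> mf fN fi; have := Rintegral_opp mf.
under eq_Rintegral do rewrite fN -mulN1r.
by rewrite RintegralZl// mulN1r; lra.
Qed.

Lemma Rintegral_translate x f : measurable_fun setT f ->
  \int[mu]_t f (t + x) = \int[mu]_t f t.
Proof.
move=> mf.
have mfx : measurable_fun setT (fun t : rV => f (x - t)).
  exact: measurableT_comp mf (measurable_rVB x).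
rewrite -(Rintegral_reflect x mf) -(Rintegral_opp mfx).
by apply: eq_Rintegral => t _; rewrite opprK addrC.
Qed.

Lemma integrable_reflect x f : mu.-integrable setT (EFin \o f) ->
  mu.-integrable setT (EFin \o (fun t => f (x - t))).
Proof.
move=> fi; have mf := integrable_measurable fi.
apply/integrableP; split.
  by apply/measurable_EFinP; exact: measurableT_comp mf (measurable_rVB x).
have /integrableP[_] := fi; rewrite -(integral_reflect x)//.
by apply/measurable_EFinP; exact: measurableT_comp.
Qed.

Lemma integrable_translate x f : mu.-integrable setT (EFin \o f) ->
  mu.-integrable setT (EFin \o (fun t => f (t + x))).
Proof.
move=> fi; have mf := integrable_measurable fi.
apply/integrableP; split.
  by apply/measurable_EFinP; exact: measurableT_comp mf (measurable_rVD x).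
have /integrableP[_] := fi; rewrite -(integral_translate x)//.
by apply/measurable_EFinP; exact: measurableT_comp.
Qed.

Lemma sq_integrable_reflect x f : sq_integrable mu f ->
  sq_integrable mu (fun t => f (x - t)).
Proof.
move=> [mf fi]; split; first exact: measurableT_comp mf (measurable_rVB x).
exact: (integrable_reflect x fi).
Qed.

Lemma sq_integrable_translate x f : sq_integrable mu f ->
  sq_integrable mu (fun t => f (t + x)).
Proof.
move=> [mf fi]; split; first exact: measurableT_comp mf (measurable_rVD x).
exact: (integrable_translate x fi).
Qed.

Lemma measurable_rV_sub : measurable_fun setT (fun p : rV * rV => p.1 - p.2).
Proof.
apply: measurable_fun_matrix => i j; under eq_fun do rewrite !mxE.
by apply: measurable_funB; exact: (measurableT_comp (measurable_coord i j)).
Qed.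

Lemma measurable_rV_add : measurable_fun setT (fun p : rV * rV => p.1 + p.2).
Proof.
apply: measurable_fun_matrix => i j; under eq_fun do rewrite !mxE.
by apply: measurable_funD; exact: (measurableT_comp (measurable_coord i j)).
Qed.

Lemma measurable_dotp : measurable_fun setT (fun p : rV * rV => dotp p.1 p.2).
Proof.
rewrite /dotp; apply: measurable_sum => i.
by apply: measurable_funM; exact: (measurableT_comp (measurable_coord _ i)).
Qed.

Lemma measurable_dotpl t : measurable_fun setT (fun x : rV => dotp x t).
Proof. exact: (measurableT_comp measurable_dotp (pair2_measurable t)). Qed.

Lemma measurable_dotpp : measurable_fun setT (fun x : rV => dotp x x).
Proof.
rewrite /dotp; apply: measurable_sum => i.
by apply: measurable_funM; exact: measurable_coord.
Qed.

Lemma measurable_enorm : measurable_fun setT (@enorm R n).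
Proof.
apply: (measurableT_comp _ measurable_dotpp).
by apply: continuous_measurable_fun; exact: sqrt_continuous.
Qed.

Lemma dotp_ge0 x : 0 <= dotp x x.
Proof. by apply: sumr_ge0 => i _; rewrite -expr2 sqr_ge0. Qed.

Lemma enorm_sqr x : enorm x ^+ 2 = dotp x x.
Proof. by rewrite sqr_sqrtr// dotp_ge0. Qed.

Lemma enorm_ge0 x : 0 <= enorm x.
Proof. exact: sqrtr_ge0. Qed.

Lemma dotpC x t : dotp x t = dotp t x.
Proof. by apply: eq_bigr => i _; rewrite mulrC. Qed.

Lemma dotpDl x z t : dotp (x + z) t = dotp x t + dotp z t.
Proof. by rewrite -big_split; apply: eq_bigr => i _; rewrite mxE mulrDl. Qed.

Lemma dotpNl x t : dotp (- x) t = - dotp x t.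
Proof. by rewrite /dotp -sumrN; apply: eq_bigr => i _; rewrite mxE mulNr. Qed.

Lemma dotpBl x z t : dotp (x - z) t = dotp x t - dotp z t.
Proof. by rewrite dotpDl dotpNl. Qed.

Lemma dotp_eq0 x : (dotp x x == 0) = (x == 0).
Proof.
apply/eqP/eqP => [h|->]; last by rewrite /dotp big1// => i _; rewrite mxE mul0r.
apply/rowP => i; rewrite mxE; apply/eqP; rewrite -sqrf_eq0 expr2.
have /eqP := h; rewrite psumr_eq0; last by move=> j _; rewrite -expr2 sqr_ge0.
by move=> /allP/(_ i); rewrite mem_index_enum => /(_ isT).
Qed.

Lemma coord_le_enorm x i : `|x 0 i| <= enorm x.
Proof.
rewrite -ler_sqr ?nnegrE ?enorm_ge0// enorm_sqr /dotp (bigD1 i)//=.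
rewrite real_normK ?num_real// expr2 lerDl.
by apply: sumr_ge0 => j _; rewrite -expr2 sqr_ge0.
Qed.

End lebesgue_rV_invariance.

(** * Limits under the integral and measurability of the inverse *)

Section dominated_convergence_real.
Context d (T : measurableType d) (R : realType) (m : {measure set T -> \bar R}).

Lemma dominated_cvgR (F : nat -> T -> R) (f g : T -> R) :
  (forall k, measurable_fun setT (F k)) -> (forall x, F k x @[k --> \oo] --> f x) ->
  m.-integrable setT (EFin \o g) -> (forall k x, `|F k x| <= g x) ->
  m.-integrable setT (EFin \o f) /\
  \int[m]_x F k x @[k --> \oo] --> \int[m]_x f x.
Proof.
move=> mF Ff gi Fg.
have mf : measurable_fun setT f.
  by apply: (measurable_fun_cvg (h := F)) => // x _; exact: Ff.
have fi : m.-integrable setT (EFin \o f).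
  apply: (le_integrableR mf _ gi) => x.
  apply: (@closed_cvg _ _ _ eventually_filter (fun k => `|F k x|) [set y | y <= g x]) => //.
  - by apply: nearW => k; exact: Fg.
  - by apply: cvg_norm; exact: Ff.
split => //.
have h : (\int[m]_x (F k x)%:E @[k --> \oo] --> \int[m]_x (f x)%:E)%E.
  apply: (@dominated_cvg _ _ _ m setT measurableT (fun k x => (F k x)%:E)
    (fun x => (f x)%:E) (fun x => (g x)%:E)) => //.
  - by move=> k; exact/measurable_EFinP.
  - by move=> x _; apply: cvg_EFin; [exact: nearW|exact: Ff].
  - by move=> k x _; rewrite lee_fin.
by rewrite -(EFin_Rintegral fi) in h; exact: fine_cvg h.
Qed.

Lemma ae_Rintegral_eq (f g : T -> R) (N : set T) : measurable N -> m N = 0%E ->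
  measurable_fun setT f -> measurable_fun setT g -> (forall x, ~ N x -> f x = g x) ->
  (\int[m]_x (f x)%:E = \int[m]_x (g x)%:E)%E.
Proof.
move=> mN N0 mf mg fg; apply: ae_eq_integral => //; try exact/measurable_EFinP.
exists N; split => // x /= h; apply: contrapT => nN; apply: h => _; congr EFin.
exact: fg.
Qed.

End dominated_convergence_real.

Section measurable_inverse.
Context {R : realType}.

(** With the convention 0^-1 = 0, the inverse is the limit at every point, 0 included, of the
    continuous functions x / (x^2 + 1/(k+1)). *)
Lemma measurable_invR : measurable_fun setT (@GRing.inv R).
Proof.
apply: (@measurable_fun_cvg _ (measurableTypeR R) R setT (fun (k : nat) (x : R) => x / (x ^+ 2 + k.+1%:R^-1)) (@GRing.inv R)) => [k|x _].
  apply: continuous_measurable_fun => x; apply: cvgM; first exact: cvg_id.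
  apply: cvgV.
    by rewrite gt_eqF// ltr_wpDl ?sqr_ge0// invr_gt0.
  by apply: cvgD; [exact: exprn_continuous|exact: cvg_cst].
have [->|x0] := eqVneq x 0.
  by rewrite invr0; under eq_cvg do rewrite mul0r; exact: cvg_cst.
rewrite [X in _ --> X](_ : _ = x / (x ^+ 2 + 0)); last by field.
apply: cvgM; first exact: cvg_cst.
apply: cvgV; first by rewrite addr0 sqrf_eq0.
by apply: cvgD; [exact: cvg_cst|exact: cvg_harmonic].
Qed.

Lemma measurable_funVR d (T : measurableType d) (f : T -> R) :
  measurable_fun setT f -> measurable_fun setT (fun x => (f x)^-1).
Proof. by move=> mf; exact: measurableT_comp measurable_invR mf. Qed.

End measurable_inverse.

(** * The fundamental theorem of calculus on the whole line *)

Section real_line.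
Context {R : realType}.
Local Notation leb := (@lebesgue_measure R).

Lemma FTC_is_derive (f F : R -> R) (a b : R) : a < b ->
  (forall x, a <= x <= b -> is_derive x 1 F (f x)) ->
  (forall x, a <= x <= b -> {for x, continuous f}) ->
  (\int[leb]_(x in `[a, b]) (f x)%:E = (F b)%:E - (F a)%:E)%E.
Proof.
move=> ab dF cf.
have cF x : a <= x <= b -> {for x, continuous F}.
  move=> xab; apply/differentiable_continuous/derivable1_diffP.
  by have [] := dF _ xab.
apply: continuous_FTC2 => //.
- by apply: continuous_in_subspaceT => x; rewrite inE/= in_itv/=; exact: cf.
- split.
  + move=> x; rewrite in_itv/= => /andP[ax xb].
    by have [] := dF x; rewrite ?(ltW ax) ?(ltW xb).
  + by apply: cvg_at_right_filter; apply: cF; rewrite lexx ltW.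
  + by apply: cvg_at_left_filter; apply: cF; rewrite lexx ltW.
- move=> x; rewrite in_itv/= => /andP[ax xb].
  by rewrite derive1E; apply: derive_val; apply: dF; rewrite !ltW.
Qed.

(** The truncations of [g] to [-(k+1), k+1] are dominated by |g|, and their integrals are increments
    of [G]. The index is shifted so that no interval is reduced to a point. *)
Lemma Rintegral_derive_cvg (g G : R -> R) (l : R) :
  (forall x : R, is_derive x 1 G (g x)) -> continuous g ->
  leb.-integrable setT (EFin \o g) ->
  (G k.+1%:R - G (- k.+1%:R)) @[k --> \oo] --> l ->
  \int[leb]_x g x = l.
Proof.
move=> dG cg ig cl.
pose D (k : nat) : set R := `[- k.+1%:R, k.+1%:R]%classic.
have mg := integrable_measurable ig.
have mD k : measurable (D k) by exact: measurable_itv.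
have [_ h] : leb.-integrable setT (EFin \o g) /\
    \int[leb]_x (g x * \1_(D k) x) @[k --> \oo] --> \int[leb]_x g x.
  apply: (@dominated_cvgR _ _ _ leb (fun k x => g x * \1_(D k) x) g (fun x => `|g x|)) => //.
  - move=> k; apply: measurable_funM => //; exact: (measurable_indic (mD k)).
  - move=> x; apply: cvg_near_cst.
    near=> k; rewrite indicE mem_set ?mulr1// /D/= in_itv/= -ler_norml.
    by rewrite -nat1r -lerBlDl; near: k; exact: nbhs_infty_ger.
  - exact: integrable_norm.
  - move=> k x; rewrite normrM ler_piMr// ger0_norm ?indicE//.
    by case: (_ \in _).
have e k : \int[leb]_x (g x * \1_(D k) x) = G k.+1%:R - G (- k.+1%:R).
  rewrite /Rintegral.
  transitivity (fine (\int[leb]_(x in D k) (g x)%:E)).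
    congr fine; rewrite [RHS]integral_mkcond; apply: eq_integral => x _.
    by rewrite patchE indicE; case: ifP => _; rewrite ?mulr1 ?mulr0.
  have k0 : - k.+1%:R < k.+1%:R :> R by rewrite gtrN.
  by rewrite /D (FTC_is_derive k0 (fun x _ => dG x) (fun x _ => cg x)).
rewrite (eq_cvg _ _ e) in h.
exact: cvg_unique h cl.
Unshelve. all: by end_near. Qed.

End real_line.

(** * The Fourier transform of a Gaussian on the line *)

Section gauss_transform.
Context {R : realType}.
Local Notation leb := (@lebesgue_measure R).

Lemma is_derive_gauss (w x : R) :
  is_derive x 1 (fun x => gauss_fun (w * x)) (- (2 * w ^+ 2 * x) * gauss_fun (w * x)).
Proof.
rewrite /gauss_fun.
have h : is_derive x 1 (fun x => - (w * x) ^+ 2) (- (2 * w ^+ 2 * x)).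
  apply: is_derive_eq; rewrite /GRing.scale/=; ring.
have := is_derive1_comp (f := expR) (is_derive_expR _) h.
by rewrite mulrC.
Qed.

Lemma is_derive_mulr (s x : R) : is_derive x 1 (fun x => s * x) s.
Proof. by apply: is_derive_eq; rewrite /GRing.scale/= mulr1. Qed.

Lemma is_derive_sinM (s x : R) :
  is_derive x 1 (fun x => sin (s * x)) (cos (s * x) * s).
Proof. exact: (is_derive1_comp (f := sin) (is_derive_sin _) (is_derive_mulr s x)). Qed.

Lemma is_derive_cosM (s x : R) :
  is_derive x 1 (fun x => cos (s * x)) (- sin (s * x) * s).
Proof. exact: (is_derive1_comp (f := cos) (is_derive_cos _) (is_derive_mulr s x)). Qed.

Lemma continuous_is_derive (F f : R -> R) : (forall x : R, is_derive x 1 F (f x)) ->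
  continuous F.
Proof.
move=> dF x; apply/differentiable_continuous/derivable1_diffP.
by have [] := dF x.
Qed.

Lemma continuous_gaussM (w : R) : continuous (fun x : R => gauss_fun (w * x)).
Proof. exact: continuous_is_derive (is_derive_gauss w). Qed.

Lemma gauss_integral_scale (w : R) : 0 < w ->
  (\int[leb]_x (gauss_fun (w * x))%:E = (Num.sqrt pi / w)%:E)%E.
Proof.
move=> w0.
have d1 : ((fun x : R => w * x)^`())%classic = cst w.
  by apply/funext => x; rewrite derive1E; apply: derive_val; exact: is_derive_mulr.
have h : (\int[leb]_x (gauss_fun x)%:E =
    \int[leb]_x (gauss_fun (w * x) * w)%:E)%E.
  rewrite (@increasing_ge0_integration_by_substitutionT _ (fun x => w * x)) ?d1//.
  - by move=> x y xy; rewrite ltr_pM2l.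
  - by move=> x; exact: cst_continuous.
  - exact: is_cvg_cst.
  - exact: is_cvg_cst.
  - by apply: gt0_cvgMrNy => //.
  - by apply: gt0_cvgMry.
  - exact: continuous_gauss_fun.
  - by move=> x; exact: gauss_fun_ge0.
have mg : measurable_fun setT (EFin \o (fun x : R => gauss_fun (w * x))).
  by apply/measurable_EFinP; apply: continuous_measurable_fun; exact: continuous_gaussM.
move: h; rewrite integralT_gauss.
under eq_integral do rewrite EFinM.
rewrite ge0_integralZr//; last 2 first.
- by move=> x _; rewrite lee_fin gauss_fun_ge0.
- by rewrite lee_fin ltW.
move=> h; rewrite EFinM h -muleA -EFinM divff ?gt_eqF// mule1//.
Qed.

Lemma integrable_gaussM (w : R) : 0 < w ->
  leb.-integrable setT (EFin \o (fun x => gauss_fun (w * x))).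
Proof.
move=> w0; apply: ge0_integrable_lty.
- by apply: continuous_measurable_fun; exact: continuous_gaussM.
- by move=> x; exact: gauss_fun_ge0.
- by rewrite gauss_integral_scale// ltry.
Qed.

(** Splitting a Gaussian lets one factor absorb a polynomial while the other stays integrable; it is
    used with a = b = sqrt(1/2). *)
Lemma gauss_funD (a b : R) : a ^+ 2 + b ^+ 2 = 1 -> forall x : R,
  gauss_fun x = gauss_fun (a * x) * gauss_fun (b * x).
Proof.
move=> ab x; rewrite /gauss_fun -expRD; congr expR.
by rewrite !exprMn -opprD -mulrDl ab mul1r.
Qed.

Lemma normr_gauss_le (x : R) : `|x| * gauss_fun x <= 2 * gauss_fun (Num.sqrt (2^-1) * x).
Proof.
have s2 : Num.sqrt (2^-1) ^+ 2 = 2^-1 :> R by rewrite sqr_sqrtr// invr_ge0.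
have e : Num.sqrt (2^-1) ^+ 2 + Num.sqrt (2^-1) ^+ 2 = 1 :> R.
  by rewrite s2; lra.
rewrite (gauss_funD e) mulrA ler_wpM2r ?gauss_fun_ge0//.
rewrite /gauss_fun expRN ler_pdivrMr ?expR_gt0// exprMn s2.
have h := expR_ge1Dx (2^-1 * x ^+ 2).
have : `|x| <= 1 + x ^+ 2.
  rewrite -[x ^+ 2]real_normK ?num_real//; have := normr_ge0 x; nra.
nra.
Qed.

Lemma integrable_normr_gaussM (w : R) : 0 < w ->
  leb.-integrable setT (EFin \o (fun x => `|x| * gauss_fun (w * x))).
Proof.
move=> w0.
have sw0 : 0 < Num.sqrt (2^-1) * w by rewrite mulr_gt0// sqrtr_gt0.
apply: le_integrableR (integrableZR (2 / w) (integrable_gaussM sw0)).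
  apply: measurable_funM; first exact: normr_measurable.
  by apply: continuous_measurable_fun; exact: continuous_gaussM.
move=> x; rewrite ger0_norm ?mulr_ge0 ?gauss_fun_ge0//.
have := normr_gauss_le (w * x); rewrite normrM gtr0_norm// mulrA => h.
by rewrite mulrAC ler_pdivlMr// mulrC mulrA.
Qed.

Definition gauss_cos (w s : R) : R := \int[leb]_x (gauss_fun (w * x) * cos (s * x)).

Lemma measurable_cosM (s : R) : measurable_fun setT (fun x : R => cos (s * x)).
Proof.
by apply: continuous_measurable_fun; apply: continuous_is_derive => x; exact: is_derive_cosM.
Qed.

Lemma measurable_sinM (s : R) : measurable_fun setT (fun x : R => sin (s * x)).
Proof.
by apply: continuous_measurable_fun; apply: continuous_is_derive => x; exact: is_derive_sinM.
Qed.

Lemma measurable_gaussM (w : R) : measurable_fun setT (fun x : R => gauss_fun (w * x)).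
Proof. by apply: continuous_measurable_fun; exact: continuous_gaussM. Qed.

Lemma normr_cos_le1 (x : R) : `|cos x| <= 1.
Proof. by rewrite ler_norml cos_geN1 cos_le1. Qed.

Lemma normr_sin_le1 (x : R) : `|sin x| <= 1.
Proof. by rewrite ler_norml sin_geN1 sin_le1. Qed.

Lemma integrable_gauss_cos (w s : R) : 0 < w ->
  leb.-integrable setT (EFin \o (fun x => gauss_fun (w * x) * cos (s * x))).
Proof.
move=> w0; apply: (integrableMR (C := 1) _ _ (integrable_gaussM w0)).
  exact: measurable_cosM.
by move=> x; exact: normr_cos_le1.
Qed.

Lemma integrable_xgauss_sin (w s : R) : 0 < w ->
  leb.-integrable setT (EFin \o (fun x => x * gauss_fun (w * x) * sin (s * x))).
Proof.
move=> w0; apply: (integrableMR (C := 1)) => //.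
- exact: measurable_sinM.
- by move=> x; exact: normr_sin_le1.
apply: le_integrableR (integrable_normr_gaussM w0).
  by apply: measurable_funM => //; exact: measurable_gaussM.
by move=> x; rewrite normrM [`|gauss_fun _|]ger0_norm ?gauss_fun_ge0.
Qed.

(** The function gauss_fun (w x) sin (s x) vanishes at both ends of the line, so its derivative has
    integral 0. *)
Lemma gauss_sin_by_parts (w s : R) : 0 < w ->
  2 * w ^+ 2 * (\int[leb]_x (x * gauss_fun (w * x) * sin (s * x))) = s * gauss_cos w s.
Proof.
move=> w0.
have gc := integrable_gauss_cos s w0; have xs := integrable_xgauss_sin s w0.
pose G (x : R) := gauss_fun (w * x) * sin (s * x).
pose g (x : R) := s * (gauss_fun (w * x) * cos (s * x)) -
  2 * w ^+ 2 * (x * gauss_fun (w * x) * sin (s * x)).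
have cG : continuous (fun x : R => gauss_fun (w * x)) := @continuous_gaussM w.
have cs : continuous (fun x : R => sin (s * x)).
  by apply: continuous_is_derive => x; exact: is_derive_sinM.
have cc : continuous (fun x : R => cos (s * x)).
  by apply: continuous_is_derive => x; exact: is_derive_cosM.
suff : \int[leb]_x g x = 0.
  rewrite /g RintegralB//; last 2 first.
  - exact: integrableZR.
  - exact: integrableZR.
  by rewrite RintegralZl// RintegralZl// => /subr0_eq ->.
apply: (@Rintegral_derive_cvg _ g G).
- move=> x; rewrite /G /g.
  have dg := is_derive_gauss w x; have ds := is_derive_sinM s x.
  by apply: is_derive_eq; rewrite /GRing.scale/=; ring.
- move=> x; apply: cvgB; apply: cvgM; try exact: cvg_cst.
    by apply: cvgM; [exact: cG|exact: cc].
  by apply: cvgM; [apply: cvgM; [exact: cvg_id|exact: cG]|exact: cs].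
- by apply: integrableBR; exact: integrableZR.
have h (u : nat -> R) : u k @[k --> \oo] --> +oo%R -> (forall v : nat -> R, (forall k, `|v k| <= gauss_fun (u k)) ->
    v k @[k --> \oo] --> (0 : R)).
  move=> cu v vu; apply: norm_cvg0.
  apply: (@squeeze_cvgr _ _ _ _ (cst 0) (fun k => gauss_fun (u k))).
  - by apply: nearW => k; rewrite /= normr_ge0 vu.
  - exact: cvg_cst.
  - exact: (cvg_comp _ _ cu (@cvg_gauss_fun R)).
have cS : (k.+1%:R : R) @[k --> \oo] --> +oo%R.
  by rewrite (cvg_shiftS (fun k => k%:R : R)); exact: cvgr_idn.
have cu : w * k.+1%:R @[k --> \oo] --> +oo%R 
  by exact: (cvg_comp _ (fun r => w * r) cS (gt0_cvgMry w0 cvg_id)).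
rewrite -[0]subr0; apply: cvgB.
- apply: (h _ cu) => k; rewrite /G normrM ger0_norm ?gauss_fun_ge0// ler_piMr ?gauss_fun_ge0//.
  exact: normr_sin_le1.
- apply: (h _ cu) => k; rewrite /G normrM ger0_norm ?gauss_fun_ge0//.
  rewrite {1}/gauss_fun mulrN sqrrN ler_piMr ?expR_ge0//.
  exact: normr_sin_le1.
Qed.

(** Differentiation under the integral, dominated by |x| gauss_fun (w x), followed by integration by
    parts: the transform solves a linear differential equation of first order. *)
Lemma is_derive_gauss_cos (w s : R) : 0 < w ->
  is_derive s 1 (gauss_cos w) (- (s / (2 * w ^+ 2)) * gauss_cos w s).
Proof.
move=> w0.
pose f (s x : R) := gauss_fun (w * x) * cos (s * x).
have df (t x : R) : is_derive t 1 (f ^~ x) (- (x * gauss_fun (w * x) * sin (t * x))).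
  rewrite /f.
  have hc : is_derive t 1 (fun t => cos (t * x)) (- sin (t * x) * x).
    have dm : is_derive t 1 (fun t : R => t * x) x.
      by apply: is_derive_eq; rewrite /GRing.scale/=; ring.
    exact: (is_derive1_comp (f := cos) (is_derive_cos _) dm).
  by apply: is_derive_eq; rewrite /GRing.scale/=; ring.
have I1 (t : R) : `](s - 1), (s + 1)[%classic t -> leb.-integrable setT (EFin \o f t).
  by move=> _; exact: integrable_gauss_cos.
have Is : `](s - 1), (s + 1)[%classic s by rewrite /= in_itv/=; apply/andP; split; lra.
have I2 (t x : R) : `](s - 1), (s + 1)[%classic t -> [set: R] x -> derivable (f ^~ x) t 1.
  by move=> _ _; have [] := df t x.
have p1 t x : partial1of2 f t x = - (x * gauss_fun (w * x) * sin (t * x)).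
  by rewrite partial1of2E; apply: derive_val; exact: df.
have I3 (t x : R) : `](s - 1), (s + 1)[%classic t -> [set: R] x ->
    `|partial1of2 f t x| <= `|x| * gauss_fun (w * x).
  move=> _ _; rewrite p1 normrN !normrM [`|gauss_fun _|]ger0_norm ?gauss_fun_ge0//.
  by rewrite ler_piMr ?normr_sin_le1// mulr_ge0// gauss_fun_ge0.
have G0 (x : R) : 0 <= `|x| * gauss_fun (w * x) by rewrite mulr_ge0// gauss_fun_ge0.
apply: DeriveDef.
  exact: (derivable_under_integral measurableT Is I1 I2 G0 (integrable_normr_gaussM w0) I3).
rewrite -derive1E (differentiation_under_integral measurableT Is I1 I2 G0 (integrable_normr_gaussM w0) I3).
under eq_Rintegral do rewrite p1 -mulN1r.
rewrite RintegralZl//; last exact: integrable_xgauss_sin.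
rewrite mulN1r mulNr mulrAC -gauss_sin_by_parts//; field.
by rewrite gt_eqF.
Qed.

(** Multiplied by the inverse of the expected Gaussian, the transform has derivative 0, hence keeps
    its value at 0, which is the total mass. *)
Lemma gauss_cosE (w s : R) : 0 < w ->
  gauss_cos w s = Num.sqrt pi / w * gauss_fun (s / (2 * w)).
Proof.
move=> w0.
pose h (t : R) := gauss_cos w t * expR ((t / (2 * w)) ^+ 2).
have dh (t : R) : is_derive t 1 h 0.
  have d1 := is_derive_gauss_cos t w0.
  have d2 : is_derive t 1 (fun t : R => expR ((t / (2 * w)) ^+ 2))
      (expR ((t / (2 * w)) ^+ 2) * (t / (2 * w ^+ 2))).
    have dm : is_derive t 1 (fun t : R => (t / (2 * w)) ^+ 2) (t / (2 * w ^+ 2)).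
      by apply: is_derive_eq; rewrite /GRing.scale/=; field; rewrite gt_eqF.
    exact: (is_derive1_comp (f := expR) (is_derive_expR _) dm).
  by rewrite /h; apply: is_derive_eq; rewrite /GRing.scale/=; ring.
have e : h s = h 0 by exact: is_derive_0_is_cst.
have h0 : h 0 = Num.sqrt pi / w.
  rewrite /h mul0r expr0n expR0 mulr1 /gauss_cos.
  under eq_Rintegral do rewrite mul0r cos0 mulr1.
  by rewrite /Rintegral gauss_integral_scale.
rewrite -h0 -e /h /gauss_fun -mulrA -expRD subrr expR0 mulr1//.
Qed.

End gauss_transform.

(** * The integral of exp(-y^2 x^2 - b^2/x^2) *)

Section gauss_inverse_square.
Context {R : realType}.
Local Notation leb := (@lebesgue_measure R).

(** An antiderivative of the Gaussian, left unnormalized: it runs from 0 to sqrt pi. It enters the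
    closed form of the antiderivative in [integral_gauss_inv]. *)
Definition gauss_cdf (x : R) : R := \int[leb]_(t in `]-oo, x]) gauss_fun t.

Lemma gauss_cdf_indic (x : R) :
  gauss_cdf x = \int[leb]_t (gauss_fun t * \1_(`]-oo, x]%classic : set R) t).
Proof.
rewrite /gauss_cdf Rintegral_mkcond; apply: eq_Rintegral => t _.
by rewrite patchE indicE; case: ifP => _; rewrite ?mulr1 ?mulr0.
Qed.

(** [l = true] says that [u] tends to +oo and [l = false] that it tends to -oo; one dominated
    convergence serves both ends. *)
Lemma gauss_cdf_cvg (u : nat -> R) (l : bool) :
  (forall t : R, \forall k \near \oo, (t <= u k) = l) ->
  gauss_cdf (u k) @[k --> \oo] --> (if l then Num.sqrt pi else 0 : R).
Proof.
move=> ul.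
have [_ h] : leb.-integrable setT (EFin \o (fun t => gauss_fun t * l%:R)) /\
   \int[leb]_t (gauss_fun t * \1_(`]-oo, u k]%classic : set R) t) @[k --> \oo] -->
   \int[leb]_t (gauss_fun t * l%:R).
  apply: (@dominated_cvgR _ _ _ leb (fun k t => gauss_fun t * \1_(`]-oo, u k]%classic : set R) t)
    (fun t => gauss_fun t * l%:R) gauss_fun).
  - move=> k; apply: measurable_funM; first exact: measurable_gauss_fun.
    exact: (measurable_indic (measurable_itv _)).
  - move=> t; apply: cvg_near_cst; have := ul t; apply: filterS => k.
    by rewrite indicE mem_setE in_itv/= => ->.
  - exact: integrableT_gauss.
  - move=> k t; rewrite normrM ger0_norm ?gauss_fun_ge0// ler_piMr ?gauss_fun_ge0//.
    by rewrite indicE; case: (_ \in _); rewrite ?normr1 ?normr0.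
rewrite (eq_cvg _ _ (fun k => gauss_cdf_indic (u k))).
suff -> : (if l then Num.sqrt pi else 0 : R) = \int[leb]_t (gauss_fun t * l%:R) by [].
case: l {ul h}; rewrite /Rintegral.
  by under eq_integral do rewrite mulr1; rewrite integralT_gauss.
by under eq_integral do rewrite mulr0; rewrite integral0.
Qed.

Lemma is_derive_gauss_cdf (x : R) : is_derive x 1 gauss_cdf (gauss_fun x).
Proof.
have xu : x < x + 1 by rewrite ltrDl.
have ig : leb.-integrable [set` `]-oo, (x + 1)]] (EFin \o gauss_fun).
  by apply: integrableS integrableT_gauss.
have [d1 d2] := continuous_FTC1 xu ig (ltNyr _) (@continuous_gauss_fun R x).
by apply: DeriveDef; [exact: d1|rewrite -derive1E; exact: d2].
Qed.

(** The exponent [e] fits the exhaustion of ]0, +oo[ to the substitution by the square, which maps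
    the intervals for e = 1 onto those for e = 2. *)
Lemma ge0_integral_pos_lim (e : nat) (h : R -> R) : (0 < e)%N ->
  measurable_fun setT h -> (forall x, 0 <= h x) ->
  (\int[leb]_(x in `[(k.+1%:R^-1 ^+ e)%R, (k.+2%:R ^+ e)%R]) (h x)%:E @[k --> \oo] -->
   \int[leb]_(x in `]0%R, +oo[) (h x)%:E)%E.
Proof.
move=> e0 mh h0.
pose F (k : nat) : set R := `[k.+1%:R^-1 ^+ e, k.+2%:R ^+ e]%classic.
have UF : \bigcup_k F k = `]0, +oo[%classic.
  apply/seteqP; split => [x [k _]|x].
    rewrite /F/= !in_itv/= andbT => /andP[h1 _].
    by apply: lt_le_trans h1; rewrite exprn_gt0// invr_gt0.
  rewrite /= in_itv/= andbT => x0.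
  near \oo => k; exists k => //; rewrite /F/= in_itv/=; apply/andP; split.
    apply: (@le_trans _ _ k.+1%:R^-1).
      by rewrite -[leRHS]expr1 ler_wiXn2l// invf_le1// ler1n.
    rewrite -[x]invrK lef_pV2 ?posrE ?invr_gt0// -nat1r -lerBlDl.
    by near: k; exact: nbhs_infty_ger.
  apply: (@le_trans _ _ k.+2%:R); last first.
    by rewrite -[leLHS]expr1 ler_weXn2l// ler1n.
  rewrite -nat1r -lerBlDl -nat1r -lerBlDl.
  by near: k; exact: nbhs_infty_ger.
rewrite -UF; apply: ge0_nondecreasing_set_cvg_integral.
- move=> i j ij; apply/subsetPset; apply: subset_itv; rewrite bnd_simp.
    by rewrite lerXn2r ?nnegrE// lef_pV2 ?posrE// ler_nat ltnS.
  by rewrite lerXn2r ?nnegrE// ler_nat !ltnS.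
- by move=> i; exact: measurable_itv.
- by move=> i; apply/measurable_EFinP; exact: measurable_funTS.
- by move=> i x _; rewrite lee_fin.
Unshelve. all: by end_near. Qed.

Lemma ge0_integral_pos_cvg (h : R -> R) (V : nat -> R) (l : R) :
  measurable_fun setT h -> (forall x, 0 <= h x) ->
  (forall k, \int[leb]_(x in `[(k.+1%:R^-1)%R, (k.+2%:R)%R]) (h x)%:E = (V k)%:E)%E ->
  V k @[k --> \oo] --> l ->
  (\int[leb]_(x in `]0%R, +oo[) (h x)%:E = l%:E)%E.
Proof.
move=> mh h0 hV Vl.
have c := ge0_integral_pos_lim (ltn0Sn 0) mh h0.
have hV1 k : (\int[leb]_(x in `[(k.+1%:R^-1 ^+ 1)%R, (k.+2%:R ^+ 1)%R]) (h x)%:E = (V k)%:E)%E.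
  by rewrite !expr1 hV.
rewrite (eq_cvg _ _ hV1) in c.
by apply: (cvg_unique _ c) => //; apply: cvg_EFin; [exact: nearW|exact: Vl].
Qed.

Lemma ge0_integral_even (h : R -> R) : measurable_fun setT h ->
  (forall x, 0 <= h x) -> (forall x, h (- x) = h x) ->
  (\int[leb]_x (h x)%:E = 2%:E * \int[leb]_(x in `]0%R, +oo[) (h x)%:E)%E.
Proof.
move=> mh h0 hN.
have mE : measurable_fun setT (EFin \o h) by exact/measurable_EFinP.
have -> : [set: R] = `]-oo, 0%R]%classic `|` `]0%R, +oo[%classic.
  by rewrite itv_setU_setT.
rewrite ge0_integral_setU//=; last 3 first.
- by rewrite itv_setU_setT.
- by move=> x _; rewrite lee_fin.
- apply/disj_setPLR => x /=; rewrite !in_itv/= andbT => x0.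
  by apply/negP; rewrite -leNgt.
rewrite mule_natl mule2n; congr (_ + _)%E.
under eq_integral do rewrite -hN.
rewrite -(@ge0_integration_by_substitution0 _ (EFin \o h))//=.
rewrite integral_itv_obnd_cbnd//; exact: measurable_funTS.
Qed.

Lemma is_derive_affine_inv (y b x : R) : x != 0 ->
  is_derive x 1 (fun x => y * x + b / x) (y - b / x ^+ 2).
Proof.
move=> x0.
have dv : is_derive x 1 (fun x : R => x^-1) (- (x ^- 2)).
  have := @is_deriveV R (fun x => x) x 1 1 x0 (is_derive_id _ _).
  by rewrite /GRing.scale/= mulr1.
by apply: is_derive_eq; rewrite /GRing.scale/=; field.
Qed.

Lemma gauss_fun_affine_inv (y b x : R) : x != 0 ->
  gauss_fun (y * x + b / x) = expR (- (2 * (b * y))) * (gauss_fun (y * x) * gauss_fun (b / x)).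
Proof.
by move=> x0; rewrite /gauss_fun -!expRD; congr expR; field.
Qed.

Lemma measurable_gauss_inv (b : R) : measurable_fun setT (fun x : R => gauss_fun (b / x)).
Proof.
apply: measurableT_comp; first exact: measurable_gauss_fun.
apply: measurable_funM; first exact: measurable_cst.
exact: measurable_invR.
Qed.

(** This is where the exponential e^(-2by) of the Poisson semigroup is born from Gaussians:
    [kern_cos] uses it with b = pi |t|. *)
Lemma integral_gauss_inv (y b : R) : 0 < y -> 0 <= b ->
  (\int[leb]_x (gauss_fun (y * x) * gauss_fun (b / x))%:E =
   (Num.sqrt pi / y * expR (- (2 * (b * y))))%:E)%E.
Proof.
(* The case b = 0 is apart: the arguments y x + b/x and y x - b/x below would have no infinite limit
   at 0. *)
move=> y0; rewrite le_eqVlt => /predU1P[<-|b0].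
  rewrite mul0r mulr0 oppr0 expR0 mulr1 -gauss_integral_scale//.
  by apply: eq_integral => x _; rewrite mul0r {2}/gauss_fun expr0n oppr0 expR0 mulr1.
pose h (x : R) := gauss_fun (y * x) * gauss_fun (b / x).
have mh : measurable_fun setT h.
  by apply: measurable_funM; [exact: measurable_gaussM|exact: measurable_gauss_inv].
have h0 x : 0 <= h x by rewrite mulr_ge0 ?gauss_fun_ge0.
rewrite (ge0_integral_even mh)//; last first.
  by move=> x; rewrite /h /gauss_fun mulrN invrN mulrN !sqrrN.
pose z := 2 * (b * y).
(* The squares of y x + b/x and y x - b/x are y^2 x^2 + b^2/x^2 plus or minus z, so the factors e^z
   and e^(-z) make both Gaussians equal to [h x]. The inner derivatives y - b/x^2 and y + b/x^2 then
   add up to 2 y. *)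
pose F (x : R) := (2 * y)^-1 * (expR z * gauss_cdf (y * x + b / x) +
  expR (- z) * gauss_cdf (y * x + (- b) / x)).
have dF (x : R) : 0 < x -> is_derive x 1 F (h x).
  move=> x0; have x0' : x != 0 by rewrite gt_eqF.
  have d1 := is_derive1_comp (is_derive_gauss_cdf _) (is_derive_affine_inv y b x0').
  have d2 := is_derive1_comp (is_derive_gauss_cdf _) (is_derive_affine_inv y (- b) x0').
  apply: is_derive_eq; rewrite /GRing.scale/= !gauss_fun_affine_inv//.
  have -> : gauss_fun (- b / x) = gauss_fun (b / x) by rewrite /gauss_fun mulNr sqrrN.
  rewrite mulNr mulrN opprK -/z -/(h x).
  have ez : expR z * expR (- z) = 1 by rewrite expRN mulfV// gt_eqF// expR_gt0.
  transitivity (expR z * expR (- z) * h x); last by rewrite ez mul1r.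
  by field; rewrite x0' (gt_eqF y0).
have ch (x : R) : 0 < x -> {for x, continuous h}.
  move=> x0; apply: cvgM; first exact: continuous_gaussM.
  have ci : b / t @[t --> x] --> b / x.
    by apply: cvgM; [exact: cvg_cst|apply: cvgV; [rewrite gt_eqF|exact: cvg_id]].
  exact: (cvg_comp _ _ ci (@continuous_gauss_fun R _)).
have -> : Num.sqrt pi / y * expR (- z) = 2 * (Num.sqrt pi / (2 * y) * expR (- z)).
  by field; rewrite gt_eqF.
rewrite EFinM; congr (_ * _)%E.
apply: (ge0_integral_pos_cvg (V := fun k => F k.+2%:R - F k.+1%:R^-1)) => //.
  move=> k.
  have k1 : 0 < k.+1%:R^-1 :> R by rewrite invr_gt0.
  have kk : k.+1%:R^-1 < k.+2%:R :> R.
    by rewrite (@le_lt_trans _ _ 1)// ?invf_le1// ?ltr1n// ler1n.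
  rewrite EFinB; apply: FTC_is_derive kk _ _ => x /andP[kx _].
  + by apply: dF; exact: lt_le_trans kx.
  + by apply: ch; exact: lt_le_trans kx.
have big (f : nat -> R) (c e : R) : 0 < c -> (forall k, f k >= c * k%:R - e) ->
    forall t : R, \forall k \near \oo, (t <= f k) = true.
  move=> c0 fk t; near=> k; apply/idP; apply: le_trans (fk k).
  rewrite lerBrDr -ler_pdivrMl//.
  by near: k; exact: nbhs_infty_ger.
have l2 k : k%:R <= k.+2%:R :> R by rewrite ler_nat; exact/leqW/leqnSn.
have l1 k : k%:R <= k.+1%:R :> R by rewrite ler_nat leqnSn.
(* At infinity both arguments tend to +oo; at 0 the first tends to +oo and the second to -oo. The
   two terms in e^z therefore cancel, and one term in e^(-z) survives. *)
have c1 : gauss_cdf (y * k.+2%:R + b / k.+2%:R) @[k --> \oo] --> (Num.sqrt pi : R).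
  apply: (@gauss_cdf_cvg _ true); apply: (big _ y 0) => // k.
  by rewrite subr0 ler_wpDr ?divr_ge0 ?(ltW b0)// ler_wpM2l ?(ltW y0).
have c2 : gauss_cdf (y * k.+2%:R + - b / k.+2%:R) @[k --> \oo] --> (Num.sqrt pi : R).
  apply: (@gauss_cdf_cvg _ true); apply: (big _ y b) => // k.
  rewrite mulNr lerB//; first by rewrite ler_wpM2l ?(ltW y0).
  by rewrite ler_pdivrMr// ler_peMr ?ltW// ltr1n.
have c3 : gauss_cdf (y * k.+1%:R^-1 + b / k.+1%:R^-1) @[k --> \oo] --> (Num.sqrt pi : R).
  apply: (@gauss_cdf_cvg _ true); apply: (big _ b 0) => // k.
  by rewrite subr0 invrK ler_wpDl ?divr_ge0 ?(ltW y0)// ler_wpM2l ?(ltW b0).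
have c4 : gauss_cdf (y * k.+1%:R^-1 + - b / k.+1%:R^-1) @[k --> \oo] --> (0 : R).
  apply: (@gauss_cdf_cvg _ false) => t.
  near=> k; apply/negbTE; rewrite -ltNge invrK mulNr ltrBlDr.
  rewrite (@le_lt_trans _ _ y)//.
    by rewrite ler_pdivrMr// ler_peMr ?(ltW y0)// ler1n.
  rewrite -ltrBlDl -ltr_pdivrMl// -nat1r -ltrBlDl.
  by near: k; exact: nbhs_infty_gtr.
have : F k.+2%:R - F k.+1%:R^-1 @[k --> \oo] -->
  (2 * y)^-1 * (expR z * Num.sqrt pi + expR (- z) * Num.sqrt pi) -
  (2 * y)^-1 * (expR z * Num.sqrt pi + expR (- z) * 0).
  by apply: cvgB; apply: cvgM; try exact: cvg_cst; apply: cvgD; apply: cvgM; try exact: cvg_cst.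
congr (_ --> _); by field; rewrite gt_eqF.
Unshelve. all: by end_near. Qed.

End gauss_inverse_square.

(** * The Gamma function at multiples of one half *)

Section gamma_gauss.
Context {R : realType}.
Local Notation leb := (@lebesgue_measure R).

Definition pow_gauss (n : nat) (x : R) : R := `|x| ^+ n * gauss_fun x.

Lemma pow_gauss_ge0 n x : 0 <= pow_gauss n x.
Proof. by rewrite mulr_ge0 ?gauss_fun_ge0// exprn_ge0. Qed.

Lemma continuous_pow_gauss n : continuous (pow_gauss n).
Proof.
move=> x; apply: cvgM; last exact: continuous_gauss_fun.
apply: (cvg_comp (fun x : R => `|x|) (fun x => x ^+ n)); last exact: exprn_continuous.
exact: norm_continuous.
Qed.

Lemma measurable_pow_gauss n : measurable_fun setT (pow_gauss n).
Proof. by apply: continuous_measurable_fun; exact: continuous_pow_gauss. Qed.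

Lemma pow_gauss_le n : exists C : R, forall x,
  pow_gauss n x <= C * gauss_fun (Num.sqrt (2^-1) * x).
Proof.
(* The constant combines |x|^n <= 1 + (x^2)^(n+1) with the bound of e^(x^2/2) from below by 1 plus
   one term of its series, (x^2/2)^(n+1) / (n+1)!. *)
exists (1 + 2 ^+ n.+1 * (n.+1)`!%:R) => x.
have s2 : Num.sqrt (2^-1) ^+ 2 = 2^-1 :> R by rewrite sqr_sqrtr// invr_ge0.
have e : Num.sqrt (2^-1) ^+ 2 + Num.sqrt (2^-1) ^+ 2 = 1 :> R.
  by rewrite s2; lra.
rewrite /pow_gauss (gauss_funD e) mulrA ler_wpM2r ?gauss_fun_ge0//.
rewrite /gauss_fun expRN ler_pdivrMr ?expR_gt0// exprMn s2.
have x20 : 0 <= 2^-1 * x ^+ 2 by rewrite mulr_ge0 ?sqr_ge0.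
have h := expR_ge1Dxn n x20.
have f0 : 0 < (n.+1)`!%:R :> R by rewrite ltr0n fact_gt0.
have p0 : 0 < 2 ^+ n.+1 :> R by rewrite exprn_gt0.
have : `|x| ^+ n <= 1 + (x ^+ 2) ^+ n.+1.
  rewrite -[x ^+ 2]real_normK ?num_real// -exprM.
  have [x1|x1] := leP `|x| 1.
    by apply: (@le_trans _ _ 1); rewrite ?exprn_ile1// lerDl exprn_ge0.
  rewrite ler_wpDl// ler_weXn2l//; first exact: ltW.
  by rewrite mul2n -addnn addSn leqW// leq_addr.
move/le_trans; apply; rewrite mulrDl mul1r lerD//.
  by rewrite (le_trans _ h)// lerDl divr_ge0 ?exprn_ge0// ltW.
rewrite (_ : (x ^+ 2) ^+ n.+1 = 2 ^+ n.+1 * (n.+1)`!%:R * ((2^-1 * x ^+ 2) ^+ n.+1 / (n.+1)`!%:R)).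
  rewrite ler_wpM2l ?mulr_ge0 ?(ltW f0) ?(ltW p0)// (le_trans _ h)// lerDr//.
rewrite [(2^-1 * _) ^+ _]exprMn exprVn; field; rewrite !gt_eqF//.
Qed.

Lemma integrable_pow_gauss n : leb.-integrable setT (EFin \o pow_gauss n).
Proof.
have [C hC] := pow_gauss_le n.
have s0 : 0 < Num.sqrt (2^-1) :> R by rewrite sqrtr_gt0.
apply: le_integrableR (integrableZR C (integrable_gaussM s0)).
  exact: measurable_pow_gauss.
by move=> x; rewrite ger0_norm ?pow_gauss_ge0// hC.
Qed.

(** The value of Gamma at (n+1)/2, by [Gamma_half]; an even integrand on the whole line avoids real
    exponents and a boundary at 0. *)
Definition pow_gauss_integral n : R := \int[leb]_x pow_gauss n x.

Lemma pow_gauss_integral_gt0 n : 0 < pow_gauss_integral n.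
Proof.
pose D : set R := `[1, 2]%classic.
have mD : measurable D by exact: measurable_itv.
(* On [1, 2] the integrand is at least e^(-4), and that interval has length 1. *)
apply: (@lt_le_trans _ _ (expR (- 4))); first exact: expR_gt0.
rewrite -lee_fin (EFin_Rintegral (integrable_pow_gauss n)).
have -> : (expR (- 4) : R)%:E = (\int[leb]_x (expR (- 4) * \1_D x)%:E)%E.
  under eq_integral do rewrite EFinM.
  rewrite ge0_integralZl//=.
    2: by apply/measurable_EFinP; exact: (measurable_indic mD).
  have l1 : leb D = 1%E.
    rewrite /D lebesgue_measure_itv/= lte_fin ltr1n.
    by rewrite -EFinD (_ : 2 - 1 = 1 :> R)//; lra.
  by rewrite integral_indic// setIT [X in (_ * X)%E]l1 mule1.
apply: ge0_le_integral => //.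
- apply/measurable_EFinP; apply: measurable_funM; first exact: measurable_cst.
  exact: (measurable_indic mD).
- by apply/measurable_EFinP; exact: measurable_pow_gauss.
move=> x _; rewrite lee_fin indicE mem_setE in_itv/=.
case: (boolP (1 <= x <= 2)%R) => [/andP[x1 x2]|_]; last by rewrite mulr0 pow_gauss_ge0.
rewrite mulr1 /pow_gauss /gauss_fun -[leLHS]mul1r ler_pM ?expR_ge0//.
  by rewrite exprn_ege1// ler_normr x1.
rewrite ler_expR lerN2; nra.
Qed.

(** Scaling the variable by r yields the power r^-(n+1); with r the radius of (y, x) this is the
    subordination formula for the kernel. *)
Lemma pow_gauss_integral_scale n (r : R) : 0 < r ->
  (\int[leb]_w (`|w| ^+ n * gauss_fun (r * w))%:E = (pow_gauss_integral n / r ^+ n.+1)%:E)%E.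
Proof.
move=> r0.
have d1 : ((fun x : R => r * x)^`())%classic = cst r.
  by apply/funext => x; rewrite derive1E; apply: derive_val; exact: is_derive_mulr.
have h : (\int[leb]_x (pow_gauss n x)%:E =
    \int[leb]_x (pow_gauss n (r * x) * r)%:E)%E.
  rewrite (@increasing_ge0_integration_by_substitutionT _ (fun x => r * x)) ?d1//.
  - by move=> x y xy; rewrite ltr_pM2l.
  - by move=> x; exact: cst_continuous.
  - exact: is_cvg_cst.
  - exact: is_cvg_cst.
  - by apply: gt0_cvgMrNy => //.
  - by apply: gt0_cvgMry.
  - exact: continuous_pow_gauss.
  - by move=> x; exact: pow_gauss_ge0.
have e (x : R) : pow_gauss n (r * x) * r = r ^+ n.+1 * (`|x| ^+ n * gauss_fun (r * x)).
  by rewrite /pow_gauss normrM (gtr0_norm r0) exprMn exprS; ring.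
move: h; under [in RHS]eq_integral do rewrite e EFinM.
have mp : measurable_fun setT (fun w : R => (`|w| ^+ n * gauss_fun (r * w))%:E).
  apply/measurable_EFinP; apply: measurable_funM; last exact: measurable_gaussM.
  by apply: measurable_funX; exact: normr_measurable.
rewrite ge0_integralZl//; last 2 first.
- by move=> x _; rewrite lee_fin mulr_ge0 ?gauss_fun_ge0// exprn_ge0.
- by rewrite lee_fin exprn_ge0// ltW.
rewrite -(EFin_Rintegral (integrable_pow_gauss n)) -/(pow_gauss_integral n).
move=> h; rewrite mulrC EFinM h muleA -EFinM mulVf ?mul1e// gt_eqF// exprn_gt0//.
Qed.

Lemma pow_gauss_powR n (x : R) : 0 < x ->
  (x ^+ 2) `^ (n.+1%:R / 2 - 1) * expR (- x ^+ 2) * (2 * x) = 2 * pow_gauss n x.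
Proof.
move=> x0; rewrite /pow_gauss -/(gauss_fun x) gtr0_norm//.
suff -> : x ^+ n = (x ^+ 2) `^ (n.+1%:R / 2 - 1) * x by ring.
have e : x `^ (2%:R * (n.+1%:R / 2 - 1)) * x `^ 1 = x `^ n%:R.
  rewrite -powRD; last by rewrite (gt_eqF x0) implybT.
  by congr (_ `^ _); rewrite -natr1; field.
by rewrite -(powR_mulrn _ (ltW x0)) -e powRrM powR_mulrn ?powRr1 ?ltW.
Qed.

(** The substitution by the square is made on compact intervals away from 0, where the real power is
    smooth; then both sides pass to the limit. The factor 2 of the derivative is used up by
    evenness. *)
Lemma Gamma_half n : Gamma (n.+1%:R / 2) = pow_gauss_integral n.
Proof.
pose s : R := n.+1%:R / 2 - 1.
pose G (x : R) := x `^ s * expR (- x).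
have mG : measurable_fun setT G.
  apply: measurable_funM; first exact: measurable_powR.
  apply: measurableT_comp; first exact: measurable_expR.
  exact: measurable_funN.
have G0 x : 0 <= G x by rewrite mulr_ge0 ?powR_ge0 ?expR_ge0.
have p0 x : 0 <= 2 * pow_gauss n x by rewrite mulr_ge0 ?pow_gauss_ge0.
have mp : measurable_fun setT (fun x : R => 2 * pow_gauss n x).
  by apply: measurable_funM; [exact: measurable_cst|exact: measurable_pow_gauss].
have dF (x : R) : is_derive x 1 (fun x : R => x ^+ 2) (2 * x).
  by apply: is_derive_eq; rewrite /GRing.scale/=; ring.
have d1 : ((fun x : R => x ^+ 2)^`())%classic = (fun x : R => 2 * x).
  by apply/funext => x; rewrite derive1E; apply: derive_val; exact: dF.
have c2 : continuous (fun x : R => 2 * x).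
  by move=> x; apply: cvgM; [exact: cvg_cst|exact: cvg_id].
have csq : continuous (fun x : R => x ^+ 2) by exact: continuous_is_derive dF.
have e k : (\int[leb]_(x in `[(k.+1%:R^-1 ^+ 2)%R, (k.+2%:R ^+ 2)%R]) (G x)%:E =
    \int[leb]_(x in `[(k.+1%:R^-1 ^+ 1)%R, (k.+2%:R ^+ 1)%R]) (2 * pow_gauss n x)%:E)%E.
  have k1 : 0 < k.+1%:R^-1 :> R by rewrite invr_gt0.
  have kk : k.+1%:R^-1 <= k.+2%:R :> R.
    by rewrite (@le_trans _ _ 1)// ?invf_le1// ler1n.
  rewrite (@integration_by_substitution_increasing _ (fun x => x ^+ 2) G _ _ kk).
  - rewrite !expr1; apply: eq_integral => x; rewrite inE/= in_itv/= => /andP[kx _].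
    rewrite d1 /GRing.mul/= -[in LHS]/(G (x ^+ 2) * (2 * x)) /G pow_gauss_powR//.
    exact: lt_le_trans kx.
  - move=> x y; rewrite !in_itv/= => /andP[x1 _] /andP[y1 _] xy.
    have x0 := lt_le_trans k1 x1; have y0 := lt_le_trans k1 y1; nra.
  - by move=> x _; rewrite d1; exact: c2.
  - by rewrite d1; apply/cvg_ex; eexists; apply: cvg_at_right_filter; exact: c2.
  - by rewrite d1; apply/cvg_ex; eexists; apply: cvg_at_left_filter; exact: c2.
  - split.
    + by move=> x _; have [] := dF x.
    + by apply: cvg_at_right_filter; exact: csq.
    + by apply: cvg_at_left_filter; exact: csq.
  - apply: continuous_in_subspaceT => x; rewrite inE/= in_itv/= => /andP[x1 _].
    have x0 : 0 < x by apply: lt_le_trans x1; rewrite exprn_gt0.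
    have cp : {for x, continuous (fun x : R => x `^ s)}.
      apply/differentiable_continuous/derivable1_diffP.
      by have [] := is_derive1_powR s x0.
    apply: cvgM; first exact: cp.
    by apply: (cvg_comp (fun x : R => - x) expR); [apply: cvgN; exact: cvg_id|exact: continuous_expR].
have l1 := ge0_integral_pos_lim (ltn0Sn 1) mG G0.
have l2 := ge0_integral_pos_lim (ltn0Sn 0) mp p0.
rewrite (eq_cvg _ _ e) in l1.
rewrite /Gamma /Rintegral (cvg_unique _ l1 l2)//.
under eq_integral do rewrite EFinM.
rewrite ge0_integralZl//; last 2 first.
- by apply/measurable_EFinP; apply: measurable_funTS; exact: measurable_pow_gauss.
- by move=> x _; rewrite lee_fin pow_gauss_ge0.
rewrite -ge0_integral_even//.
- exact: measurable_pow_gauss.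
- by move=> x; exact: pow_gauss_ge0.
- by move=> x; rewrite /pow_gauss /gauss_fun normrN sqrrN.
Qed.

End gamma_gauss.

(** * Gaussians on R^n and their cosine transform *)

Section gauss_rV.
Context {R : realType}.
Local Notation leb := (@lebesgue_measure R).

Lemma Rintegral_odd1 (f : R -> R) : measurable_fun setT f ->
  (forall x, f (- x) = - f x) -> \int[leb]_x f x = 0.
Proof.
move=> mf fN; have mE : measurable_fun setT (EFin \o f) by exact/measurable_EFinP.
rewrite /Rintegral integralE.
have -> : (\int[leb]_x (EFin \o f)^\- x = \int[leb]_x (EFin \o f)^\+ x)%E.
  rewrite -(integral_reflect1 0 (measurable_funepos mE)) => [|x]; last exact: funepos_ge0.
  apply: eq_integral => x _; rewrite funeposE funenegE /= sub0r fN//.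
by case: (\int[leb]_x _)%E => [r| |] //=; rewrite subrr.
Qed.

(** The phase [q] collects the contribution of the other coordinates in the induction on the
    dimension; the sine term is odd and drops out. *)
Lemma gauss_cos_phase (w s q : R) : 0 < w ->
  \int[leb]_x (gauss_fun (w * x) * cos (s * x + q)) = gauss_cos w s * cos q.
Proof.
move=> w0.
have gi := integrable_gaussM w0.
have ic : leb.-integrable setT (EFin \o (fun x => gauss_fun (w * x) * cos (s * x))).
  exact: integrable_gauss_cos.
have is_ : leb.-integrable setT (EFin \o (fun x => gauss_fun (w * x) * sin (s * x))).
  apply: (integrableMR (C := 1) _ _ gi); first exact: measurable_sinM.
  by move=> x; exact: normr_sin_le1.
under eq_Rintegral do rewrite cosD mulrBr !mulrA ![_ * _ * _ q]mulrC.
rewrite RintegralB//; last 2 first.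
- exact: integrableZR.
- exact: integrableZR.
rewrite !RintegralZl// [X in _ * _ - _ * X]Rintegral_odd1 ?mulr0 ?subr0 1?mulrC//.
- exact: integrable_measurable is_.
- by move=> x; rewrite /gauss_fun !mulrN sqrrN sinN mulrN.
Qed.

Definition gauss_rV {n} (w : R) (x : 'rV[R]_n) : R := expR (- (w ^+ 2 * dotp x x)).

Lemma gauss_rV_ge0 n w (x : 'rV[R]_n) : 0 <= gauss_rV w x.
Proof. exact: expR_ge0. Qed.

Lemma dotp_cons n a (v : 'rV[R]_n) t :
  dotp (rV_cons (a, v)) t = a * t 0 0 + dotp v (rV_uncons t).2.
Proof.
rewrite /dotp big_ord_recl rV_cons0/=; congr (_ + _).
apply: eq_bigr => i _; rewrite rV_consS/= mxE; congr (_ * t _ _).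
exact/val_inj.
Qed.

Lemma gauss_rV_cons n w a (v : 'rV[R]_n) :
  gauss_rV w (rV_cons (a, v)) = gauss_fun (w * a) * gauss_rV w v.
Proof.
rewrite /gauss_rV /gauss_fun -expRD dotp_cons rV_cons0 rV_consK/=.
by congr expR; rewrite exprMn expr2; ring.
Qed.

Lemma measurable_gauss_rV n w : measurable_fun setT (@gauss_rV n w).
Proof.
apply: measurableT_comp; first exact: measurable_expR.
apply: measurable_funN; apply: measurable_funM; first exact: measurable_cst.
exact: measurable_dotpp.
Qed.

Lemma integral_rV0 (g : 'rV[R]_0 -> \bar R) : measurable_fun setT g ->
  (\int[lebesgue_rV R 0]_x g x = g 0%R)%E.
Proof.
by move=> mg; rewrite /= integral_dirac//= diracT mul1e.
Qed.

Lemma integral_gauss_rV n (w : R) : 0 < w ->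
  (\int[lebesgue_rV R n]_x (gauss_rV w x)%:E = ((Num.sqrt pi / w) ^+ n)%:E)%E.
Proof.
move=> w0; elim: n => [|n IH].
  rewrite integral_rV0; last by apply/measurable_EFinP; exact: measurable_gauss_rV.
  rewrite expr0 /gauss_rV /dotp big_ord0.
  by rewrite mulr0 oppr0 expR0.
rewrite ge0_integral_rV_cons; last 2 first.
- by apply/measurable_EFinP; exact: measurable_gauss_rV.
- by move=> x; rewrite lee_fin gauss_rV_ge0.
have e a : (\int[lebesgue_rV R n]_v (gauss_rV w (rV_cons (a, v)))%:E =
    (gauss_fun (w * a))%:E * ((Num.sqrt pi / w) ^+ n)%:E)%E.
  under eq_integral do rewrite gauss_rV_cons EFinM.
  rewrite ge0_integralZl ?IH//.
  - by apply/measurable_EFinP; exact: measurable_gauss_rV.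
  - by move=> v _; rewrite lee_fin gauss_rV_ge0.
  - by rewrite lee_fin gauss_fun_ge0.
under eq_integral do rewrite e.
rewrite ge0_integralZr//; last 3 first.
- by apply/measurable_EFinP; exact: measurable_gaussM.
- by move=> x _; rewrite lee_fin gauss_fun_ge0.
- by rewrite lee_fin exprn_ge0// divr_ge0 ?sqrtr_ge0// ltW.
by rewrite gauss_integral_scale// exprS EFinM.
Qed.

Lemma integrable_gauss_rV n (w : R) : 0 < w ->
  (lebesgue_rV R n).-integrable setT (EFin \o gauss_rV w).
Proof.
move=> w0; apply: ge0_integrable_lty.
- exact: measurable_gauss_rV.
- by move=> x; exact: gauss_rV_ge0.
- by rewrite integral_gauss_rV// ltry.
Qed.

Lemma Rintegral_rV_cons n (f : 'rV[R]_n.+1 -> R) :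
  (lebesgue_rV R n.+1).-integrable setT (EFin \o f) ->
  \int[lebesgue_rV R n.+1]_x f x = \int[leb]_a \int[lebesgue_rV R n]_v f (rV_cons (a, v)).
Proof.
move=> fi; have mf := integrable_measurable fi.
have mfc : measurable_fun setT (f \o @rV_cons R n).
  exact: measurableT_comp mf (@measurable_rV_cons R n).
have fci : (leb \x lebesgue_rV R n)%E.-integrable setT (EFin \o (f \o @rV_cons R n)).
  apply/integrableP; split; first exact/measurable_EFinP.
  have /integrableP[_] := fi.
  apply: le_lt_trans; rewrite le_eqVlt; apply/orP; left; apply/eqP.
  rewrite ge0_integral_rV_cons//; last by apply/measurable_EFinP; exact: measurableT_comp.
  rewrite fubini_tonelli1//.
  by apply/measurable_EFinP; apply: measurableT_comp.
rewrite (RFubini1 fci).2 /Rintegral; congr fine.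
have mE : measurable_fun setT (EFin \o f) by exact/measurable_EFinP.
have := @integral_pushforward _ _ _ _ _ _ (@measurable_rV_cons R n)
  (leb \x lebesgue_rV R n)%E setT _ mE.
by rewrite preimage_setT => /(_ fci measurableT).
Qed.

Lemma integrable_gauss_rV_cos n (w s q : R) (t : 'rV[R]_n) : 0 < w ->
  (lebesgue_rV R n).-integrable setT
    (EFin \o (fun x => gauss_rV w x * cos (s * dotp x t + q))).
Proof.
move=> w0; apply: (integrableMR (C := 1) _ _ (integrable_gauss_rV n w0)).
  apply: measurableT_comp; first by apply: continuous_measurable_fun; exact: continuous_cos.
  apply: measurable_funD; last exact: measurable_cst.
  by apply: measurable_funM; [exact: measurable_cst|exact: measurable_dotpl].
by move=> x; exact: normr_cos_le1.
Qed.

Lemma rV_unconsK n (t : 'rV[R]_n.+1) : rV_cons (rV_uncons t) = t.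
Proof.
apply/rowP => i; case: (unliftP ord0 i) => [j|] ->; last by rewrite rV_cons0.
by rewrite rV_consS/= mxE; congr (t _ _); apply/val_inj.
Qed.

Lemma gauss_rV_cos n (w s q : R) (t : 'rV[R]_n) : 0 < w ->
  \int[lebesgue_rV R n]_x (gauss_rV w x * cos (s * dotp x t + q)) =
  (Num.sqrt pi / w) ^+ n * gauss_rV (s / (2 * w)) t * cos q.
Proof.
move=> w0; elim: n => [|n IH] in q t *.
  rewrite /Rintegral integral_rV0; last first.
    apply/measurable_EFinP.
    exact: integrable_measurable (integrable_gauss_rV_cos s q t w0).
  rewrite /= expr0 /gauss_rV /dotp !big_ord0.
  by rewrite !mulr0 oppr0 expR0 add0r !mul1r.
rewrite Rintegral_rV_cons; last exact: integrable_gauss_rV_cos.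
have e a : \int[lebesgue_rV R n]_v (gauss_rV w (rV_cons (a, v)) *
      cos (s * dotp (rV_cons (a, v)) t + q)) =
    (Num.sqrt pi / w) ^+ n * gauss_rV (s / (2 * w)) (rV_uncons t).2 *
      (gauss_fun (w * a) * cos (s * t 0 0 * a + q)).
  (* For fixed first coordinate [a], the product s t_0 a joins the phase, so the induction
     hypothesis applies with a new phase. *)
  transitivity (gauss_fun (w * a) * \int[lebesgue_rV R n]_v (gauss_rV w v *
      cos (s * dotp v (rV_uncons t).2 + (s * t 0 0 * a + q)))).
    rewrite -RintegralZl//; last exact: integrable_gauss_rV_cos.
    apply: eq_Rintegral => v _; rewrite gauss_rV_cons dotp_cons -mulrA.
    by congr (_ * (_ * cos _)); ring.
  by rewrite IH; ring.
under eq_Rintegral do rewrite e.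
rewrite RintegralZl//; last first.
  apply: (integrableMR (C := 1) _ _ (integrable_gaussM w0)) => [|x].
    apply: measurableT_comp; first by apply: continuous_measurable_fun; exact: continuous_cos.
    by apply: measurable_funD => //; exact: measurable_funM.
  exact: normr_cos_le1.
rewrite gauss_cos_phase// gauss_cosE//.
rewrite -[in RHS](rV_unconsK t) gauss_rV_cons exprS.
by rewrite (_ : s / (2 * w) * t 0 0 = s * t 0 0 / (2 * w)); [ring|rewrite mulrAC].
Qed.

End gauss_rV.

(** * The Fourier transform of the Poisson kernel *)

Section poisson_transform.
Context {R : realType} {n : nat}.
Hypothesis n0 : (0 < n)%N.
Local Notation leb := (@lebesgue_measure R).
Local Notation mu := (lebesgue_rV R n).
Local Notation rV := 'rV[R]_n.

Definition radius (y : R) (x : rV) : R := Num.sqrt (y ^+ 2 + dotp x x).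

(** The Poisson kernel stripped of its numerator [y] and of its constant; unlike the Poisson kernel
    it grows as [y] decreases. *)
Definition kern (y : R) (x : rV) : R := radius y x ^- n.+1.

Lemma radius_sqr y x : radius y x ^+ 2 = y ^+ 2 + dotp x x.
Proof. by rewrite sqr_sqrtr// addr_ge0 ?sqr_ge0 ?dotp_ge0. Qed.

Lemma radius_gt0 y x : 0 < y -> 0 < radius y x.
Proof. by move=> y0; rewrite sqrtr_gt0 ltr_wpDr ?dotp_ge0// exprn_gt0. Qed.

Lemma measurable_kern y : measurable_fun setT (kern y).
Proof.
apply: measurable_funVR; apply: measurable_funX.
apply: measurableT_comp; first by apply: continuous_measurable_fun; exact: sqrt_continuous.
by apply: measurable_funD; [exact: measurable_cst|exact: measurable_dotpp].
Qed.

Lemma kern_ge0 y x : 0 <= kern y x.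
Proof. by rewrite invr_ge0 exprn_ge0// sqrtr_ge0. Qed.

(* Gaussian subordination of the kernel, integrated over the whole line. *)
Definition subord (y : R) (z : rV * R) : R :=
  `|z.2| ^+ n * gauss_fun (y * z.2) * gauss_rV z.2 z.1.

Lemma subord_ge0 y z : 0 <= subord y z.
Proof.
apply: mulr_ge0; last exact: gauss_rV_ge0.
by apply: mulr_ge0; [exact: exprn_ge0|exact: gauss_fun_ge0].
Qed.

Lemma measurable_subord y : measurable_fun setT (subord y : rV * R -> R).
Proof.
apply: measurable_funM.
  apply: measurable_funM.
    by apply: measurable_funX; apply: measurableT_comp => //; exact: normr_measurable.
  exact: (measurableT_comp (measurable_gaussM y) measurable_snd).
apply: measurableT_comp; first exact: measurable_expR.
apply: measurable_funN; apply: measurable_funM.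
  by apply: measurable_funX; exact: measurable_snd.
exact: (measurableT_comp measurable_dotpp measurable_fst).
Qed.

Lemma subordE y x w : subord y (x, w) = `|w| ^+ n * gauss_fun (radius y x * w).
Proof.
rewrite /subord/= -mulrA; congr (_ * _).
by rewrite /gauss_fun /gauss_rV -expRD; congr expR; rewrite !exprMn radius_sqr; ring.
Qed.

Lemma integral_subord y x : 0 < y ->
  (\int[leb]_w (subord y (x, w))%:E = (pow_gauss_integral n * kern y x)%:E)%E.
Proof.
move=> y0; under eq_integral do rewrite subordE.
by rewrite pow_gauss_integral_scale// radius_gt0.
Qed.

Lemma gauss_rV_norm w (x : rV) : gauss_rV `|w| x = gauss_rV w x.
Proof. by rewrite /gauss_rV real_normK ?num_real. Qed.

Lemma pow_sqrt_pi (w : R) : w != 0 -> `|w| ^+ n * (Num.sqrt pi / `|w|) ^+ n = Num.sqrt pi ^+ n.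
Proof. by move=> w0; rewrite -exprMn; congr (_ ^+ _); field; rewrite normr_eq0. Qed.

(** For w != 0 this is an equality. At w = 0 the Gaussian is constant, and only the factor |w|^n,
    with n > 0, keeps the integral finite. *)
Lemma integral_subord_le y w :
  (\int[mu]_x (subord y (x, w))%:E <= (Num.sqrt pi ^+ n * gauss_fun (y * w))%:E)%E.
Proof.
have [->|w0] := eqVneq w 0.
  rewrite integral0_eq => [|x _]; last by rewrite /subord/= normr0 expr0n gtn_eqF//= !mul0r.
  by rewrite lee_fin mulr_ge0 ?gauss_fun_ge0// exprn_ge0// sqrtr_ge0.
under eq_integral do rewrite /subord/= -gauss_rV_norm EFinM.
rewrite ge0_integralZl//.
2: by apply/measurable_EFinP; exact: measurable_gauss_rV.
2: by move=> x _; rewrite lee_fin gauss_rV_ge0.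
2: by rewrite lee_fin mulr_ge0 ?gauss_fun_ge0// exprn_ge0.
by rewrite integral_gauss_rV ?normr_gt0// -EFinM mulrAC pow_sqrt_pi.
Qed.

(** Integrating in [x] first leaves a one-dimensional Gaussian in [w], because |w|^n cancels the
    mass of the Gaussian on R^n. *)
Lemma integrable_subord y : 0 < y -> (mu \x leb)%E.-integrable setT (EFin \o subord y).
Proof.
move=> y0; apply/integrable21ltyP.
  by apply/measurable_EFinP; exact: measurable_subord.
apply: (@le_lt_trans _ _ (\int[leb]_w (Num.sqrt pi ^+ n * gauss_fun (y * w))%:E)%E).
  apply: ge0_le_integral => //.
  - by move=> w _; exact: integral_ge0.
  - have m1 : measurable_fun setT (fun z : rV * R => `|(subord y z)%:E|%E).
      by apply: measurableT_comp => //; apply/measurable_EFinP; exact: measurable_subord.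
    by apply: (measurable_fun_fubini_tonelli_G _ m1).
  - by apply/measurable_EFinP; apply: measurable_funM; [exact: measurable_cst|exact: measurable_gaussM].
  - move=> w _; rewrite (le_trans _ (integral_subord_le y w))//.
    by rewrite le_eqVlt; apply/orP; left; apply/eqP; apply: eq_integral => x _;
      rewrite /= ger0_norm ?subord_ge0.
apply: (@integrable_ge0_lty _ (measurableTypeR R) _ leb (fun w : R => Num.sqrt pi ^+ n * gauss_fun (y * w))).
  by apply: integrableZR; exact: integrable_gaussM.
by move=> w; rewrite mulr_ge0 ?gauss_fun_ge0// exprn_ge0// sqrtr_ge0.
Qed.

Lemma Rintegral_subord y x : 0 < y ->
  \int[leb]_w subord y (x, w) = pow_gauss_integral n * kern y x.
Proof. by move=> y0; rewrite /Rintegral integral_subord. Qed.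

(** No polar coordinates: up to a positive constant the kernel is a section integral of [subord y],
    which is integrable on the product. *)
Lemma integrable_kern y : 0 < y -> mu.-integrable setT (EFin \o kern y).
Proof.
move=> y0; have [h _] := RFubini1 (integrable_subord y0).
have I0 := @pow_gauss_integral_gt0 R n.
have := integrableZR (pow_gauss_integral n)^-1 h.
under [X in EFin \o X]eq_fun => x do rewrite Rintegral_subord// mulrA mulVf ?gt_eqF// mul1r.
by [].
Qed.

(** Fubini on the subordinated kernel: the transform in [x] of the Gaussian of parameter [w] is a
    Gaussian in b/w, and the integral left over [w] is [integral_gauss_inv]. *)
Lemma kern_cos y (t : rV) : 0 < y ->
  \int[mu]_x (kern y x * cos (2 * pi * dotp x t)) =
  Num.sqrt pi ^+ n.+1 / (pow_gauss_integral n * y) * expR (- (2 * pi * enorm t * y)).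
Proof.
move=> y0; have I0 := @pow_gauss_integral_gt0 R n.
pose h (z : rV * R) := subord y z * cos (2 * pi * dotp z.1 t).
have mc : measurable_fun setT (fun z : rV * R => cos (2 * pi * dotp z.1 t)).
  apply: measurableT_comp; first by apply: continuous_measurable_fun; exact: continuous_cos.
  apply: measurable_funM; first exact: measurable_cst.
  exact: (measurableT_comp (measurable_dotpl t) measurable_fst).
have hi : (mu \x leb)%E.-integrable setT (EFin \o h).
  exact: (@integrableMR _ _ _ (mu \x leb)%E 1 (subord y) _ mc (fun z => normr_cos_le1 _) (integrable_subord y0)).
have e1 x : \int[leb]_w h (x, w) = pow_gauss_integral n * (kern y x * cos (2 * pi * dotp x t)).
  rewrite /h /= mulrA -Rintegral_subord// RintegralZr//.
  apply: ge0_integrable_lty; first exact: (measurableT_comp (measurable_subord y) (pair1_measurable x)).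
    by move=> w; exact: subord_ge0.
  by rewrite integral_subord// ltry.
have ik : mu.-integrable setT (EFin \o (fun x => kern y x * cos (2 * pi * dotp x t))).
  have mcx : measurable_fun setT (fun x : rV => cos (2 * pi * dotp x t)).
    apply: measurableT_comp; first by apply: continuous_measurable_fun; exact: continuous_cos.
    by apply: measurable_funM; [exact: measurable_cst|exact: measurable_dotpl].
  by apply: (integrableMR (C := 1) mcx _ (integrable_kern y0)) => x; exact: normr_cos_le1.
have := RFubini hi; under eq_Rintegral do rewrite e1.
rewrite RintegralZl// => E.
apply: (@mulfI _ (pow_gauss_integral n)); first by rewrite gt_eqF.
rewrite E.
pose b := pi * enorm t.
have b0 : 0 <= b by rewrite mulr_ge0 ?pi_ge0 ?enorm_ge0.
have e2 w : w != 0 -> \int[mu]_x h (x, w) =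
    Num.sqrt pi ^+ n * (gauss_fun (y * w) * gauss_fun (b / w)).
  move=> w0; have w0' : 0 < `|w| by rewrite normr_gt0.
  transitivity (\int[mu]_x (`|w| ^+ n * gauss_fun (y * w) *
      (gauss_rV `|w| x * cos (2 * pi * dotp x t + 0)))).
    by apply: eq_Rintegral => x _; rewrite /h /subord/= gauss_rV_norm addr0 !mulrA.
  rewrite RintegralZl//; last exact: integrable_gauss_rV_cos.
  rewrite gauss_rV_cos// cos0 mulr1 -(pow_sqrt_pi w0).
  suff -> : gauss_rV (2 * pi / (2 * `|w|)) t = gauss_fun (b / w) by ring.
  rewrite /gauss_rV /gauss_fun -enorm_sqr; congr (expR (- _)).
  rewrite /b !exprMn !exprVn exprMn (_ : `|w| ^+ 2 = w ^+ 2) ?real_normK ?num_real//.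
  by field; rewrite w0.
have mI : measurable_fun setT (fun w : R => Num.sqrt pi ^+ n * (gauss_fun (y * w) * gauss_fun (b / w))).
  apply: measurable_funM; first exact: measurable_cst.
  by apply: measurable_funM; [exact: measurable_gaussM|exact: measurable_gauss_inv].
have mh := integrable_measurable (RFubini2 hi).1.
(* [e2] breaks down at w = 0, where the left side is 0 and the right side is not; that point is a
   null set. *)
have E3 := @ae_Rintegral_eq _ _ _ leb _ _ [set 0] (measurable_set1 0)
  (lebesgue_measure_set1 0) mh mI (fun w w0 => e2 w (introN eqP w0)).
rewrite [in LHS]/Rintegral E3.
have mG : measurable_fun setT (fun w : R => (gauss_fun (y * w) * gauss_fun (b / w))%:E).
  apply/measurable_EFinP; apply: measurable_funM; [exact: measurable_gaussM|exact: measurable_gauss_inv].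
under eq_integral do rewrite EFinM.
rewrite ge0_integralZl//.
2: by move=> w _; rewrite lee_fin mulr_ge0 ?gauss_fun_ge0.
rewrite integral_gauss_inv// -EFinM/= -/b.
have -> : 2 * (b * y) = 2 * pi * enorm t * y by rewrite /b; ring.
by rewrite exprS; field; rewrite !gt_eqF.
Qed.

End poisson_transform.

(** * A functional monotone class theorem for square-integrable functions *)

Section L2_monotone_class.
Context d (T : measurableType d) (R : realType) (m : {measure set T -> \bar R}).
Variables (N : (T -> R) -> Prop) (G : set (set T)) (Om : nat -> set T).
Hypothesis ND : forall f g, N f -> N g -> N (fun x => f x + g x).
Hypothesis NZ : forall (c : R) f, N f -> N (fun x => c * f x).
Hypothesis NL : forall (F : nat -> T -> R) (f g : T -> R),
  (forall k, N (F k)) -> (forall k, measurable_fun setT (F k)) ->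
  (forall x, F k x @[k --> \oo] --> f x) -> (forall k x, `|F k x| <= g x) ->
  sq_integrable m g -> N f.
Hypothesis GI : setI_closed G.
Hypothesis GT : forall A, measurable A -> <<s G >> A.
Hypothesis Gm : forall A, G A -> measurable A.
Hypothesis GOm : forall k, G (Om k).
Hypothesis mOm : forall k, (m (Om k) < +oo)%E.
Hypothesis ndOm : {homo Om : i j / (i <= j)%N >-> (i <= j)%O}.
Hypothesis UOm : \bigcup_k Om k = setT.
Hypothesis NG : forall A, G A -> (m A < +oo)%E -> N \1_A.

Lemma sq_integrable_indic A : measurable A -> (m A < +oo)%E -> sq_integrable m \1_A.
Proof.
move=> mA Aoo; have mi : measurable_fun setT (\1_A : T -> R) by exact: measurable_indic.
apply: sq_integrable_lty => //.
rewrite (_ : \int[m]_x _ = m A)%E// -[A in RHS]setIT -integral_indic//.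
by apply: eq_integral => x _; rewrite indicE; case: (_ \in _); rewrite ?expr1n ?expr0n.
Qed.

Lemma normr_indic_le (A B : set T) x : A `<=` B -> `|\1_A x| <= \1_B x :> R.
Proof.
move=> AB; rewrite !indicE ger0_norm//.
have [/set_mem Ax|_] := boolP (x \in A); last by case: (_ \in _).
by rewrite mem_set//; exact: AB.
Qed.

Lemma indic_bigcup_cvg (F : nat -> set T) x :
  {homo F : i j / (i <= j)%N >-> (i <= j)%O} ->
  (\1_(F k) x : R) @[k --> \oo] --> (\1_(\bigcup_k F k) x : R).
Proof.
move=> ndF; apply: cvg_near_cst; rewrite indicE.
have [/set_mem[i _ Fi]|nU] := boolP (x \in \bigcup_k F k).
  exists i => // k /= ik; rewrite indicE mem_set//.
  by move: Fi; apply/subsetPset; exact: ndF.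
apply: nearW => k; rewrite indicE; case: (boolP (x \in F k)) => // /set_mem Fk.
by move/negP : nU; case; apply/mem_set; exists k.
Qed.

(** Cutting by [Om k], of finite measure, keeps complements square integrable, so that the sets with
    the property form a lambda-system to which Dynkin's theorem applies. *)
Let N_indicI k A : measurable A -> N \1_(A `&` Om k).
Proof.
move=> mA; have sOm := sq_integrable_indic (Gm (GOm k)) (mOm k).
pose H : set (set T) := [set A | measurable A /\ N \1_(A `&` Om k)].
suff : <<s setT, G >> `<=` H by move=> /(_ A (GT mA)) [].
apply: lambda_system_subset => //.
- split => //.
  + by split => //; rewrite setTI; exact: NG.
  + move=> A1 B1 BA [mA1 NA] [mB1 NB]; split; first exact: measurableD.
    rewrite (_ : \1_ _ = (fun x => \1_(A1 `&` Om k) x + (-1) * \1_(B1 `&` Om k) x)).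
      by apply: ND => //; exact: NZ.
    apply/funext => x; rewrite !indicE !in_setI in_setC mulN1r.
    case: (boolP (x \in B1)) => [/set_mem/BA xA|_].
      by rewrite (mem_set xA)/= subrr.
    by rewrite andbT subr0.
  + move=> F ndF HF; split; first by apply: bigcupT_measurable => i; case: (HF i).
    rewrite setI_bigcupl.
    apply: (NL (F := fun i => \1_(F i `&` Om k)) (g := \1_(Om k))) => //.
    * by move=> i; case: (HF i).
    * by move=> i; apply: measurable_indic; apply: measurableI; [case: (HF i)|exact: Gm].
    * move=> x; apply: (indic_bigcup_cvg (F := fun i => F i `&` Om k)) => i j ij.
      by apply/subsetPset; apply: setSI; apply/subsetPset; exact: ndF.
    * by move=> i x; apply: normr_indic_le; exact: subIsetr.
- move=> B GB; split; first exact: Gm.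
  apply: NG; first exact: GI.
  apply: le_lt_trans (mOm k); apply: le_measure; rewrite ?inE; first by apply: measurableI; exact: Gm.
    exact: Gm.
  exact: subIsetr.
Qed.

Let N_indic A : measurable A -> (m A < +oo)%E -> N \1_A.
Proof.
move=> mA Aoo; rewrite -[A]setIT -UOm setI_bigcupr.
apply: (NL (F := fun i => \1_(A `&` Om i)) (g := \1_A)).
- by move=> k; exact: N_indicI.
- by move=> k; apply: measurable_indic; apply: measurableI => //; exact: Gm.
- move=> x; apply: (indic_bigcup_cvg (F := fun i => A `&` Om i)) => i j ij.
  by apply/subsetPset; apply: setIS; apply/subsetPset; exact: ndOm.
- by move=> i x; apply: normr_indic_le; exact: subIsetl.
- exact: sq_integrable_indic.
Qed.

Let N0 : N (fun=> 0).
Proof.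
have := NZ 0 (NG (GOm 0%N) (mOm 0%N)).
by rewrite (_ : (fun _ => 0 * _) = (fun=> 0))//; apply/funext => x; rewrite mul0r.
Qed.

Import HBNNSimple.

Let N_nnsfun (h : {nnsfun T >-> R}) : sq_integrable m h -> N h.
Proof.
move=> [mh hi].
pose r : seq R := finmap.enum_fset (fset_set (range h)).
rewrite (_ : (h : T -> R) = fun x => \sum_(y <- r) y * \1_(h @^-1` [set y]) x); last first.
  by apply/funext => x; rewrite fimfunE fsbig_finite.
elim: r => [|y s IH].
  by rewrite (_ : (fun x => _) = (fun=> 0))//; apply/funext => x; rewrite big_nil.
rewrite (_ : (fun x => _) = (fun x => y * \1_(h @^-1` [set y]) x +
    \sum_(y <- s) y * \1_(h @^-1` [set y]) x)); last first.
  by apply/funext => x; rewrite big_cons.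
apply: ND => //.
have [->|y0] := eqVneq y 0.
  by rewrite (_ : (fun x => _) = (fun=> 0))//; apply/funext => x; rewrite mul0r.
have mhy : measurable (h @^-1` [set y]) by exact: measurable_sfunP.
apply: NZ; apply: N_indic => //.
(* Chebyshev: on the level set of y != 0 the indicator equals y^-2 h^2, so that level set has finite
   measure. *)
have i1 : m.-integrable setT (EFin \o (\1_(h @^-1` [set y]) : T -> R)).
  apply: le_integrableR (integrableZR (y ^- 2) hi); first exact: measurable_indic.
  move=> x; rewrite indicE ger0_norm//.
  have [/set_mem/= hx|_] := boolP (x \in _).
    by rewrite hx mulVf// sqrf_eq0.
  by rewrite mulr_ge0 ?invr_ge0 ?sqr_ge0.
have := integrable_ge0_lty i1; rewrite integral_indic// setIT; apply => x.
by rewrite indicE.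
Qed.

Let N_ge0 f : (forall x, 0 <= f x) -> sq_integrable m f -> N f.
Proof.
move=> f0 fi; have [mf _] := fi.
have mE : measurable_fun setT (EFin \o f) by exact/measurable_EFinP.
pose a := nnsfun_approx measurableT mE.
have f0' x : setT x -> (0 <= (EFin \o f) x)%E by rewrite lee_fin.
have ca x : a k x @[k --> \oo] --> f x.
  by have /fine_cvg := cvg_nnsfun_approx measurableT mE f0' (I : setT x).
have af k x : `|a k x| <= f x.
  rewrite ger0_norm//.
  rewrite -(cvg_lim _ (ca x))//; apply: nondecreasing_cvgn_le; last first.
    by apply/cvg_ex; exists (f x); exact: ca.
  by move=> i j ij; exact/lefP/nd_nnsfun_approx.
apply: (NL (F := fun k => a k) (g := f)) => //.
move=> k; apply: N_nnsfun; apply: le_sq_integrable fi => // x.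
by rewrite (ger0_norm (f0 x)).
Qed.

(** Each of the positive and negative parts is the limit of simple functions that it dominates, and
    a square-integrable simple function is a combination of indicators of sets of finite measure. *)
Lemma sq_integrable_monotone_class f : sq_integrable m f -> N f.
Proof.
move=> fi; have [mf _] := fi.
have mn : measurable_fun setT (fun x => `|f x|).
  by apply: measurableT_comp => //; exact: normr_measurable.
have nf (x : T) : - f x <= `|f x| by rewrite -normrN ler_norm.
have pf (x : T) : f x <= `|f x| by rewrite ler_norm.
have -> : f = fun x => 2^-1 * (`|f x| + f x) + (-1) * (2^-1 * (`|f x| - f x)).
  by apply/funext => x; field.
apply: ND; last apply: NZ; apply: N_ge0.
- by move=> x; have := nf x; lra.
- apply: (le_sq_integrable _ _ fi) => [|x].
    by apply: measurable_funM => //; exact: measurable_funD.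
  by rewrite ler_norml; have := nf x; have := pf x => h1 h2; apply/andP; split; lra.
- by move=> x; have := pf x; lra.
- apply: (le_sq_integrable _ _ fi) => [|x].
    by apply: measurable_funM => //; exact: measurable_funB.
  by rewrite ler_norml; have := nf x; have := pf x => h1 h2; apply/andP; split; lra.
Qed.

End L2_monotone_class.

(** * Gaussian mollification and its quadratic defect *)

Section gauss_mollifier.
Context {R : realType} {n : nat}.
Local Notation mu := (lebesgue_rV R n).
Local Notation rV := 'rV[R]_n.
Implicit Types (F G : rV -> R).

Lemma measurable_diff (k : rV -> R) : measurable_fun setT k ->
  measurable_fun setT (fun p : rV * rV => k (p.1 - p.2)).
Proof. by move=> mk; exact: measurableT_comp mk measurable_rV_sub. Qed.

Lemma conv_mass1 (a k : rV -> R) : measurable_fun setT a -> measurable_fun setT k ->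
  (forall x, 0 <= a x) -> (forall x, 0 <= k x) ->
  (\int[mu]_x \int[mu]_t (a x * k (x - t))%:E =
   \int[mu]_x (a x)%:E * \int[mu]_x (k x)%:E)%E.
Proof.
move=> ma mk a0 k0.
have e x : (\int[mu]_t (a x * k (x - t))%:E = (a x)%:E * \int[mu]_t (k t)%:E)%E.
  under eq_integral do rewrite EFinM.
  rewrite ge0_integralZl//.
  - rewrite (integral_reflect x (g := EFin \o k))//; exact/measurable_EFinP.
  - by apply/measurable_EFinP; exact: measurableT_comp mk (measurable_rVB x).
  - by move=> t _; rewrite lee_fin.
  - by rewrite lee_fin.
under eq_integral do rewrite e.
rewrite ge0_integralZr//.
- exact/measurable_EFinP.
- by move=> t _; rewrite lee_fin.
- by apply: integral_ge0 => t _; rewrite lee_fin.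
Qed.

Lemma conv_mass2 (a k : rV -> R) : measurable_fun setT a -> measurable_fun setT k ->
  (forall x, 0 <= a x) -> (forall x, 0 <= k x) ->
  (\int[mu]_x \int[mu]_t (a t * k (x - t))%:E =
   \int[mu]_x (a x)%:E * \int[mu]_x (k x)%:E)%E.
Proof.
move=> ma mk a0 k0.
have mf : measurable_fun setT (fun p : rV * rV => (a p.2 * k (p.1 - p.2))%:E).
  apply/measurable_EFinP; apply: measurable_funM; last exact: measurable_diff.
  exact: measurableT_comp ma measurable_snd.
have f0 (p : rV * rV) : (0 <= (a p.2 * k (p.1 - p.2))%:E)%E by rewrite lee_fin mulr_ge0.
rewrite (fubini_tonelli _ mf f0)/=.
have mkN : measurable_fun setT (fun x : rV => k (- x)).
  have := measurableT_comp mk (measurable_rVB 0).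
  by rewrite (_ : _ \o _ = (fun x : rV => k (- x)))//; apply/funext => x /=; rewrite sub0r.
transitivity (\int[mu]_t \int[mu]_x (a t * (fun x : rV => k (- x)) (t - x)%R)%:E)%E.
  by apply: eq_integral => t _; apply: eq_integral => x _; rewrite opprB.
rewrite (conv_mass1 ma mkN)//; congr (_ * _)%E.
rewrite -(integral_reflect 0 (g := EFin \o k))//.
  by apply: eq_integral => x _; rewrite /= sub0r.
exact/measurable_EFinP.
Qed.

(** The Gaussian of total mass 1; it concentrates at 0 as [w] tends to +oo. *)
Definition gauss_kernel (w : R) (h : rV) : R := (Num.sqrt pi / w) ^- n * gauss_rV w h.

Lemma gauss_kernel_ge0 w h : 0 <= w -> 0 <= gauss_kernel w h.
Proof.
by move=> w0; rewrite mulr_ge0 ?gauss_rV_ge0// invr_ge0 exprn_ge0// divr_ge0.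
Qed.

Lemma measurable_gauss_kernel w : measurable_fun setT (gauss_kernel w).
Proof. by apply: measurable_funM; [exact: measurable_cst|exact: measurable_gauss_rV]. Qed.

Lemma integral_gauss_rVZ (c v : R) : 0 < v -> 0 <= c ->
  (\int[mu]_h (c * gauss_rV v h)%:E = (c * (Num.sqrt pi / v) ^+ n)%:E)%E.
Proof.
move=> v0 c0; under eq_integral do rewrite EFinM.
rewrite ge0_integralZl//.
- by rewrite integral_gauss_rV.
- by apply/measurable_EFinP; exact: measurable_gauss_rV.
- by move=> h _; rewrite lee_fin gauss_rV_ge0.
Qed.

Lemma sqrt_pi_gt0 : 0 < Num.sqrt pi :> R.
Proof. by rewrite sqrtr_gt0 pi_gt0. Qed.

Lemma integral_gauss_kernel w : 0 < w -> (\int[mu]_h (gauss_kernel w h)%:E = 1)%E.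
Proof.
move=> w0; have p0 : 0 < Num.sqrt pi / w by rewrite divr_gt0// sqrt_pi_gt0.
rewrite integral_gauss_rVZ//.
  by rewrite mulVf// gt_eqF// exprn_gt0.
by rewrite invr_ge0 exprn_ge0// ltW.
Qed.

(** The inequality t <= 2 e^(t/2), for t = w^2 |h|^2, spends half of the exponent on the factor
    |h|^2. The remaining wider Gaussian has a mass larger by sqrt(2)^n. *)
Lemma gauss_kernel_moment w : 0 < w ->
  (\int[mu]_h (dotp h h * gauss_kernel w h)%:E <= (2 * Num.sqrt 2 ^+ n / w ^+ 2)%:E)%E.
Proof.
move=> w0; have p0 := sqrt_pi_gt0.
have s2 : 0 < Num.sqrt 2 :> R by rewrite sqrtr_gt0.
have v0 : 0 < w / Num.sqrt 2 by rewrite divr_gt0.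
pose c := (Num.sqrt pi / w) ^- n * (2 / w ^+ 2).
have q0 : 0 < Num.sqrt pi / w by rewrite divr_gt0.
have c0 : 0 <= c by rewrite mulr_ge0// ?invr_ge0 ?exprn_ge0 ?ltW// divr_gt0// exprn_gt0.
have -> : 2 * Num.sqrt 2 ^+ n / w ^+ 2 = c * (Num.sqrt pi / (w / Num.sqrt 2)) ^+ n.
  rewrite (_ : Num.sqrt pi / (w / Num.sqrt 2) = Num.sqrt pi / w * Num.sqrt 2); last first.
    by field; rewrite !gt_eqF.
  by rewrite exprMn /c; field; rewrite !gt_eqF// ?exprn_gt0.
rewrite -integral_gauss_rVZ//.
apply: ge0_le_integral => //.
- by move=> h _; rewrite lee_fin mulr_ge0 ?dotp_ge0 ?gauss_kernel_ge0// ltW.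
- apply/measurable_EFinP; apply: measurable_funM; first exact: measurable_dotpp.
  exact: measurable_gauss_kernel.
- by apply/measurable_EFinP; apply: measurable_funM; [exact: measurable_cst|exact: measurable_gauss_rV].
move=> h _; rewrite lee_fin /gauss_kernel /c mulrCA -mulrA ler_wpM2l//.
  by rewrite invr_ge0 exprn_ge0// ltW.
rewrite /gauss_rV (_ : (w / Num.sqrt 2) ^+ 2 * dotp h h = w ^+ 2 * dotp h h / 2); last first.
  by rewrite exprMn exprVn sqr_sqrtr//; field.
set t := w ^+ 2 * dotp h h.
have -> : dotp h h = t / w ^+ 2 by rewrite /t mulrC mulKf// gt_eqF// exprn_gt0.
rewrite (_ : - t = - (t / 2) + - (t / 2)); last by lra.
rewrite expRD mulrA ler_wpM2r ?expR_ge0// mulrAC ler_wpM2r ?invr_ge0 ?sqr_ge0//.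
rewrite expRN ler_pdivrMr ?expR_gt0//.
have := expR_ge1Dx (t / 2); lra.
Qed.

(** For F in L1 and L2 this is twice the difference between the squared norm of F and the pairing of
    F with its mollification. As an integral of a nonnegative function it makes sense for every
    measurable F and is handled by Tonelli. *)
Definition mollify_defect (w : R) F : \bar R :=
  (\int[mu]_x \int[mu]_t ((F x - F t) ^+ 2 * gauss_kernel w (x - t))%:E)%E.

Lemma measurable_defect w F : measurable_fun setT F ->
  measurable_fun setT (fun p : rV * rV => (F p.1 - F p.2) ^+ 2 * gauss_kernel w (p.1 - p.2)).
Proof.
move=> mF; apply: measurable_funM.
  apply: measurable_funX; apply: measurable_funB.
    exact: measurableT_comp mF measurable_fst.
  exact: measurableT_comp mF measurable_snd.
exact: measurable_diff (measurable_gauss_kernel w).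
Qed.

Lemma le_double_integral (f g : rV * rV -> R) :
  measurable_fun setT f -> measurable_fun setT g ->
  (forall p, 0 <= f p) -> (forall p, f p <= g p) ->
  (\int[mu]_x \int[mu]_t (f (x, t))%:E <= \int[mu]_x \int[mu]_t (g (x, t))%:E)%E.
Proof.
move=> mf mg f0 fg.
have g0 p : 0 <= g p by exact: le_trans (fg p).
have mfE : measurable_fun setT (EFin \o f) by exact/measurable_EFinP.
have mgE : measurable_fun setT (EFin \o g) by exact/measurable_EFinP.
apply: ge0_le_integral => //.
- by move=> x _; apply: integral_ge0 => t _; rewrite lee_fin.
- by apply: (measurable_fun_fubini_tonelli_F _ mfE) => p; rewrite lee_fin.
- by apply: (measurable_fun_fubini_tonelli_F _ mgE) => p; rewrite lee_fin.
move=> x _; apply: ge0_le_integral => //.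
- by move=> t _; rewrite lee_fin.
- exact: (measurableT_comp mfE (pair1_measurable x)).
- exact: (measurableT_comp mgE (pair1_measurable x)).
- by move=> t _; rewrite lee_fin.
Qed.

Lemma double_integralD (f g : rV * rV -> R) :
  measurable_fun setT f -> measurable_fun setT g ->
  (forall p, 0 <= f p) -> (forall p, 0 <= g p) ->
  (\int[mu]_x \int[mu]_t (f (x, t) + g (x, t))%:E =
   \int[mu]_x \int[mu]_t (f (x, t))%:E + \int[mu]_x \int[mu]_t (g (x, t))%:E)%E.
Proof.
move=> mf mg f0 g0.
have mfE : measurable_fun setT (EFin \o f) by exact/measurable_EFinP.
have mgE : measurable_fun setT (EFin \o g) by exact/measurable_EFinP.
rewrite -ge0_integralD//.
- apply: eq_integral => x _; under eq_integral do rewrite EFinD.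
  rewrite ge0_integralD//.
  + by move=> t _; rewrite lee_fin.
  + exact: (measurableT_comp mfE (pair1_measurable x)).
  + by move=> t _; rewrite lee_fin.
  + exact: (measurableT_comp mgE (pair1_measurable x)).
- by move=> x _; apply: integral_ge0 => t _; rewrite lee_fin.
- by apply: (measurable_fun_fubini_tonelli_F _ mfE) => p; rewrite lee_fin.
- by move=> x _; apply: integral_ge0 => t _; rewrite lee_fin.
- by apply: (measurable_fun_fubini_tonelli_F _ mgE) => p; rewrite lee_fin.
Qed.

Lemma double_integralZ (c : R) (f : rV * rV -> R) : 0 <= c ->
  measurable_fun setT f -> (forall p, 0 <= f p) ->
  (\int[mu]_x \int[mu]_t (c * f (x, t))%:E = c%:E * \int[mu]_x \int[mu]_t (f (x, t))%:E)%E.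
Proof.
move=> c0 mf f0.
have mfE : measurable_fun setT (EFin \o f) by exact/measurable_EFinP.
rewrite -ge0_integralZl//.
- apply: eq_integral => x _; under eq_integral do rewrite EFinM.
  rewrite ge0_integralZl//.
  + exact: (measurableT_comp mfE (pair1_measurable x)).
  + by move=> t _; rewrite lee_fin.
- by apply: (measurable_fun_fubini_tonelli_F _ mfE) => p; rewrite lee_fin.
- by move=> x _; apply: integral_ge0 => t _; rewrite lee_fin.
Qed.

Lemma mollify_defect_ge0 w F : 0 <= w -> (0 <= mollify_defect w F)%E.
Proof.
move=> w0; apply: integral_ge0 => x _; apply: integral_ge0 => t _.
by rewrite lee_fin mulr_ge0 ?sqr_ge0// gauss_kernel_ge0.
Qed.

(** Used twice: with [k = 1] for a bound by the squared norm, uniform in [w], and with a quadratic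
    [k] for truncated Lipschitz functions, where the second moment gives the decay. *)
Lemma mollify_defect_dominated w F (a k : rV -> R) : 0 < w ->
  measurable_fun setT F -> measurable_fun setT a -> measurable_fun setT k ->
  (forall x, 0 <= a x) -> (forall x, 0 <= k x) ->
  (forall x t, (F x - F t) ^+ 2 <= (a x + a t) * k (x - t)) ->
  (mollify_defect w F <=
    2%:E * (\int[mu]_x (a x)%:E * \int[mu]_h (k h * gauss_kernel w h)%:E))%E.
Proof.
move=> w0 mF ma mk a0 k0 le.
have w0' := ltW w0.
pose kw h := k h * gauss_kernel w h.
have mkw : measurable_fun setT kw by apply: measurable_funM => //; exact: measurable_gauss_kernel.
have kw0 h : 0 <= kw h by rewrite mulr_ge0 ?gauss_kernel_ge0.
have m1 : measurable_fun setT (fun p : rV * rV => a p.1 * kw (p.1 - p.2)).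
  apply: measurable_funM; last exact: measurable_diff.
  exact: measurableT_comp ma measurable_fst.
have m2 : measurable_fun setT (fun p : rV * rV => a p.2 * kw (p.1 - p.2)).
  apply: measurable_funM; last exact: measurable_diff.
  exact: measurableT_comp ma measurable_snd.
apply: (@le_trans _ _ (\int[mu]_x \int[mu]_t (a x * kw (x - t) + a t * kw (x - t))%:E)%E).
  apply: (le_double_integral
    (f := fun p => (F p.1 - F p.2) ^+ 2 * gauss_kernel w (p.1 - p.2))
    (g := fun p => a p.1 * kw (p.1 - p.2) + a p.2 * kw (p.1 - p.2))).
  - exact: measurable_defect.
  - exact: measurable_funD.
  - by move=> p; rewrite mulr_ge0 ?sqr_ge0 ?gauss_kernel_ge0.
  - by move=> p; rewrite -mulrDl /kw mulrA ler_wpM2r ?gauss_kernel_ge0.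
rewrite (double_integralD (f := fun p => a p.1 * kw (p.1 - p.2))
  (g := fun p => a p.2 * kw (p.1 - p.2)))//; last 2 first.
- by move=> p; rewrite mulr_ge0.
- by move=> p; rewrite mulr_ge0.
by rewrite /= conv_mass1// conv_mass2// mule_natl mule2n.
Qed.

Lemma mollify_defect_le w F : 0 < w -> measurable_fun setT F ->
  (mollify_defect w F <= 4%:E * \int[mu]_x (F x ^+ 2)%:E)%E.
Proof.
move=> w0 mF.
have := @mollify_defect_dominated w F (fun x => 2 * F x ^+ 2) (fun=> 1) w0 mF.
have mF2 : measurable_fun setT (fun x => F x ^+ 2) by exact: measurable_funX.
move=> /(_ (measurable_funM (measurable_cst _) mF2) (measurable_cst _)).
move=> /(_ (fun x => mulr_ge0 (ler0n _ _) (sqr_ge0 _)) (fun=> ler01)) h.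
apply: le_trans (h _) _ => [x t|].
  by rewrite mulr1; have := sqr_ge0 (F x + F t); nra.
under [X in (_ * (_ * X))%E]eq_integral do rewrite mul1r.
rewrite integral_gauss_kernel// mule1.
under eq_integral do rewrite EFinM.
rewrite ge0_integralZl//.
- by rewrite muleA -EFinM (_ : 2 * 2 = 4 :> R)//; lra.
- exact/measurable_EFinP.
- by move=> x _; rewrite lee_fin sqr_ge0.
Qed.

Lemma mollify_defectD w F G : 0 < w -> measurable_fun setT F -> measurable_fun setT G ->
  (mollify_defect w (fun x => F x + G x)%R <=
    2%:E * mollify_defect w F + 2%:E * mollify_defect w G)%E.
Proof.
move=> w0 mF mG; have w0' := ltW w0.
have [mFE mGE] := (measurable_defect w mF, measurable_defect w mG).
have F0 (H : rV -> R) (p : rV * rV) : 0 <= (H p.1 - H p.2) ^+ 2 * gauss_kernel w (p.1 - p.2).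
  by rewrite mulr_ge0 ?sqr_ge0 ?gauss_kernel_ge0.
pose dF (p : rV * rV) := (F p.1 - F p.2) ^+ 2 * gauss_kernel w (p.1 - p.2).
pose dG (p : rV * rV) := (G p.1 - G p.2) ^+ 2 * gauss_kernel w (p.1 - p.2).
have dF0 p : 0 <= dF p by exact: F0.
have dG0 p : 0 <= dG p by exact: F0.
have m2F : measurable_fun setT (fun p => 2 * dF p) by exact: measurable_funM.
have m2G : measurable_fun setT (fun p => 2 * dG p) by exact: measurable_funM.
apply: (@le_trans _ _ (\int[mu]_x \int[mu]_t (2 * dF (x, t) + 2 * dG (x, t))%:E)%E).
  apply: (le_double_integral
    (f := fun p => (F p.1 + G p.1 - (F p.2 + G p.2)) ^+ 2 * gauss_kernel w (p.1 - p.2))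
    (g := fun p => 2 * dF p + 2 * dG p)).
  - by apply: (@measurable_defect w (fun x => F x + G x)); exact: measurable_funD.
  - exact: measurable_funD.
  - by move=> p; exact: (F0 (fun x => F x + G x)).
  have h (a b c d : R) : (a + b - (c + d)) ^+ 2 <= 2 * (a - c) ^+ 2 + 2 * (b - d) ^+ 2.
    rewrite -subr_ge0 (_ : _ - _ = ((a - c) - (b - d)) ^+ 2) ?sqr_ge0//; ring.
  move=> p; apply: le_trans (ler_wpM2r (gauss_kernel_ge0 _ w0') (h _ _ _ _)) _.
  by rewrite le_eqVlt; apply/orP; left; apply/eqP; rewrite /dF /dG; ring.
rewrite (double_integralD (f := fun p => 2 * dF p) (g := fun p => 2 * dG p))//.
- by rewrite !double_integralZ.
- by move=> p; rewrite mulr_ge0.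
- by move=> p; rewrite mulr_ge0.
Qed.

Lemma mollify_defectZ w (c : R) F : 0 < w -> measurable_fun setT F ->
  (mollify_defect w (fun x => c * F x)%R = (c ^+ 2)%:E * mollify_defect w F)%E.
Proof.
move=> w0 mF; have mFE := measurable_defect w mF.
transitivity (\int[mu]_x \int[mu]_t (c ^+ 2 * ((F x - F t) ^+ 2 * gauss_kernel w (x - t)%R)%R)%:E)%E.
  by apply: eq_integral => x _; apply: eq_integral => t _ /=; congr EFin; ring.
apply: (double_integralZ (sqr_ge0 c) mFE) => p.
by rewrite mulr_ge0 ?sqr_ge0 ?gauss_kernel_ge0// ltW.
Qed.

End gauss_mollifier.

Section cvge0.
Context {R : realType}.

Lemma cvge0P (u : nat -> \bar R) : (forall k, 0 <= u k)%E ->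
  (u k @[k --> \oo] --> 0%E) <->
  (forall e : R, 0 < e -> \forall k \near \oo, (u k <= e%:E)%E).
Proof.
move=> u0; split=> [cu e e0|h].
  move/fine_cvgP : cu => [fu cf].
  move/cvgrPdist_le : cf => /(_ e e0) cf.
  near=> k.
  have fk : u k \is a fin_num by near: k.
  rewrite -(fineK fk) lee_fin.
  have : `|0 - (fine \o u) k| <= e by near: k.
  by rewrite sub0r normrN /= => /(le_trans (ler_norm _)).
apply/fine_cvgP; split.
  have := h 1 ltr01; apply: filterS => k uk.
  by rewrite ge0_fin_numE// (le_lt_trans uk)// ltry.
apply/cvgrPdist_le => e e0; have := h e e0; apply: filterS => k uk.
have fk : u k \is a fin_num by rewrite ge0_fin_numE// (le_lt_trans uk)// ltry.
by rewrite sub0r normrN /= ger0_norm ?fine_ge0// -lee_fin fineK.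
Unshelve. all: by end_near. Qed.

End cvge0.

(** * The defect tends to 0 for every square-integrable function *)

Section mollify_density.
Context {R : realType} {n : nat}.
Local Notation mu := (lebesgue_rV R n).
Local Notation rV := 'rV[R]_n.

Let N (F : rV -> R) := measurable_fun setT F /\
  mollify_defect k.+1%:R F @[k --> \oo] --> 0%E.

Let k0 k : 0 < k.+1%:R :> R. Proof. exact: ltr0Sn. Qed.

Let two0 : (0 <= 2%:E :> \bar R)%E. Proof. by rewrite lee_fin. Qed.

Let four0 : (0 <= 4%:E :> \bar R)%E. Proof. by rewrite lee_fin. Qed.

Let D0 (F : rV -> R) k : (0 <= mollify_defect (k.+1%:R : R) F)%E.
Proof. by apply: mollify_defect_ge0. Qed.

Let ND (F G : rV -> R) : N F -> N G -> N (fun x => F x + G x).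
Proof.
move=> [mF /cvge0P cF] [mG /cvge0P cG]; split; first exact: measurable_funD.
apply/cvge0P => // e e0; have e4 : 0 < e / 4 by rewrite divr_gt0.
have hF := cF (D0 F) _ e4; have hG := cG (D0 G) _ e4.
case: hF => i _ hi; case: hG => j _ hj.
exists (maxn i j) => // k /=; rewrite geq_max => /andP[/hi h1 /hj h2].
apply: le_trans (mollify_defectD (k0 k) mF mG) _.
have -> : e%:E = (2%:E * (e / 4)%:E + 2%:E * (e / 4)%:E)%E.
  by rewrite -!EFinM -EFinD; congr EFin; field.
by apply: leeD; [exact: (lee_wpmul2l two0 h1)|exact: (lee_wpmul2l two0 h2)].
Qed.

Let NZ (c : R) (F : rV -> R) : N F -> N (fun x => c * F x).
Proof.
move=> [mF /cvge0P cF]; split; first exact: measurable_funM.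
apply/cvge0P => // e e0.
have c0 : 0 < c ^+ 2 + 1 by rewrite ltr_wpDl// sqr_ge0.
have e4 : 0 < e / (c ^+ 2 + 1) by rewrite divr_gt0.
have hF := cF (D0 F) _ e4.
case: hF => i _ hi; exists i => // k /= /hi hk; rewrite (mollify_defectZ c (k0 k) mF).
apply: (@le_trans _ _ ((c ^+ 2)%:E * (e / (c ^+ 2 + 1))%:E)%E).
  by apply: lee_wpmul2l; rewrite ?lee_fin ?sqr_ge0.
rewrite -EFinM lee_fin mulrA ler_pdivrMr// mulrC ler_pM2l//.
by rewrite lerDl.
Qed.

Lemma sq_dominated_cvg d (T : measurableType d) (m : {measure set T -> \bar R})
    (F : nat -> T -> R) (f g : T -> R) :
  (forall k, measurable_fun setT (F k)) -> (forall x, F k x @[k --> \oo] --> f x) ->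
  (forall k x, `|F k x| <= g x) -> sq_integrable m g ->
  (forall k, sq_integrable m (F k)) /\ sq_integrable m f /\
  \int[m]_x ((F k x - f x) ^+ 2) @[k --> \oo] --> (0 : R).
Proof.
move=> mF Ff Fg gi; have [mg g2] := gi.
have g0 x : 0 <= g x by exact: le_trans (Fg 0%N x).
have mf : measurable_fun setT f.
  by apply: (measurable_fun_cvg (h := F)) => // x _; exact: Ff.
have fg x : `|f x| <= g x.
  apply: (@closed_cvg _ _ _ eventually_filter (fun k => `|F k x|) [set y | y <= g x]) => //.
  - by apply: nearW => k; exact: Fg.
  - by apply: cvg_norm; exact: Ff.
split; first by move=> k; apply: (le_sq_integrable _ _ gi) => // x; rewrite (ger0_norm (g0 x)).
split; first by apply: (le_sq_integrable _ _ gi) => // x; rewrite (ger0_norm (g0 x)).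
have z : \int[m]_(x in setT) (0 : R) = 0 :> R by rewrite /Rintegral integral0.
rewrite -z.
apply: (@dominated_cvgR _ _ _ m (fun k x => (F k x - f x) ^+ 2) (fun=> 0)
  (fun x => 4 * g x ^+ 2) _ _ _ _).2.
- by move=> k; apply: measurable_funX; exact: measurable_funB.
- move=> x; rewrite (_ : 0 = (f x - f x) ^+ 2); last by rewrite subrr expr0n.
  apply: (cvg_comp _ (fun y : R => y ^+ 2)); last exact: exprn_continuous.
  by apply: cvgB; [exact: Ff|exact: cvg_cst].
- exact: integrableZR.
- move=> k x; rewrite ger0_norm ?sqr_ge0//.
  have := Fg k x; have := fg x; rewrite !ler_norml => /andP[h1 h2] /andP[h3 h4].
  have : 0 <= (2 * g x - (F k x - f x)) * (2 * g x + (F k x - f x)).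
    by apply: mulr_ge0; lra.
  nra.
Qed.

(** Write f as [F j] minus the error [F j - f]. The defect of the error is at most four times its
    squared norm at every scale, so [j] is chosen first and the scale after it. *)
Let NL (F : nat -> rV -> R) (f g : rV -> R) :
  (forall k, N (F k)) -> (forall k, measurable_fun setT (F k)) ->
  (forall x, F k x @[k --> \oo] --> f x) -> (forall k x, `|F k x| <= g x) ->
  sq_integrable mu g -> N f.
Proof.
move=> NF mF Ff Fg gi.
have [Fi [fi cF]] := sq_dominated_cvg mF Ff Fg gi.
have [mf _] := fi; split => //.
apply/cvge0P => // e e0.
have e16 : 0 < e / 16 by rewrite divr_gt0.
move/cvgrPdist_le : cF => /(_ _ e16)[j _ /(_ j (leqnn j))]; rewrite sub0r normrN => hj.
have [_ /cvge0P cj] := NF j.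
have e4 : 0 < e / 4 by rewrite divr_gt0.
have hF := cj (D0 (F j)) _ e4.
case: hF => i _ hi; exists i => // k /= /hi hk.
have fE : f = fun x => F j x + (-1) * (F j x - f x) by apply/funext => x; ring.
have mB : measurable_fun setT (fun x => F j x - f x) by exact: measurable_funB.
rewrite fE; apply: le_trans (mollify_defectD (k0 k) (mF j) (measurable_funM (measurable_cst _) mB)) _.
rewrite (mollify_defectZ _ (k0 k) mB) sqrrN expr1n mul1e.
have -> : e%:E = (2%:E * (e / 4)%:E + 2%:E * (4%:E * (e / 16)%:E))%E.
  by rewrite -!EFinM -EFinD; congr EFin; field.
apply: leeD; first exact: (lee_wpmul2l two0 hk).
apply: (lee_wpmul2l two0); apply: le_trans (mollify_defect_le (k0 k) mB) _.
apply: (lee_wpmul2l four0).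
have [_ Bi] := sq_integrableB (Fi j) fi.
by rewrite -(EFin_Rintegral Bi) lee_fin (le_trans (ler_norm _)).
Qed.

Definition lipschitz_rV (m : rV -> R) :=
  exists2 L : R, 0 <= L & forall x t, `|m x - m t| <= L * enorm (x - t).

(** Minima make this class stable under intersection, coordinate half-spaces make it generate the
    sigma-algebra, and its indicators are limits of Lipschitz functions supported in the set. *)
Let G : set (set rV) :=
  [set A | exists m : rV -> R, [/\ measurable_fun setT m, lipschitz_rV m &
    A = [set x | 0 < m x]]].

Let Gm A : G A -> measurable A.
Proof.
move=> [m [mm _ ->]].
rewrite (_ : [set x | _] = m @^-1` `]0, +oo[%classic).
  by rewrite -[X in measurable X]setTI; apply: mm => //; exact: measurable_itv.
by apply/seteqP; split => x /=; rewrite in_itv/= andbT.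
Qed.

Let GI : setI_closed G.
Proof.
move=> _ _ [m [mm [L L0 Lm] ->]] [m' [mm' [L' L0' Lm'] ->]].
exists (fun x => Num.min (m x) (m' x)); split.
- exact: measurable_minr.
- exists (L + L'); first exact: addr_ge0.
  move=> x t; have E0 := enorm_ge0 (x - t).
  have := Lm x t; have := Lm' x t; rewrite mulrDl.
  have := mulr_ge0 L0 E0; have := mulr_ge0 L0' E0.
  rewrite !ler_norml !minElt => h1 h2 /andP[h3 h4] /andP[h5 h6].
  by apply/andP; split; case: ifPn => c1; case: ifPn => c2; rewrite -?leNgt in c1 c2; lra.
- by apply/seteqP; split => x /=; rewrite lt_min => /andP.
Qed.

Let GT (A : set rV) : measurable A -> <<s G >> A.
Proof.
move=> mA; have := smallest_sub (smallest_sigma_algebra setT G) _ mA.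
apply => _ [i [j [B [mB ->]]]].
have mc : measurable_fun setT ((fun M : rV => M i j) : g_sigma_algebraType G -> R).
  apply: (measurability _ (RGenOInfty.measurableE R)) => _ [_ [x ->] <-].
  rewrite setTI; apply: sub_sigma_algebra.
  exists (fun M : rV => M i j - x); split.
  - by apply: measurable_funB; [exact: measurable_coord|exact: measurable_cst].
  - exists 1 => // u v; rewrite mul1r.
    have := coord_le_enorm (u - v) j; rewrite !mxE (ord1 i).
    by rewrite (_ : u 0 j - x - (v 0 j - x) = u 0 j - v 0 j)//; ring.
  - by apply/seteqP; split => M /=; rewrite in_itv/= andbT subr_gt0.
by rewrite -[X in <<s _ >> X]setTI; exact: mc.
Qed.

Let l1 (x : rV) : R := \sum_(i < n) `|x 0 i|.

Let Om (k : nat) : set rV := [set x | 0 < k.+1%:R - l1 x].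

Let ml1 : measurable_fun setT l1.
Proof.
by apply: measurable_sum => i; apply: measurableT_comp => //; exact: measurable_coord.
Qed.

Let GOm k : G (Om k).
Proof.
exists (fun x => k.+1%:R - l1 x); split => //.
  by apply: measurable_funB; [exact: measurable_cst|exact: ml1].
exists n%:R => // x t.
rewrite (_ : _ - _ = l1 t - l1 x); last by ring.
rewrite /l1 -sumrB (le_trans (ler_norm_sum _ _ _))//.
have -> : n%:R * enorm (x - t) = \sum_(i < n) enorm (x - t).
  by rewrite sumr_const card_ord mulr_natl.
apply: ler_sum => i _; rewrite (le_trans (ler_dist_dist _ _))//.
have := coord_le_enorm (x - t) i; rewrite !mxE.
by rewrite distrC.
Qed.

(** On this l1-ball |x|^2 <= (k+1)^2, so its indicator is at most e^((k+1)^2) times the Gaussian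
    e^(-|x|^2). *)
Let mOm k : (mu (Om k) < +oo)%E.
Proof.
have mA : measurable (Om k) by exact: Gm.
pose c : R := expR (k.+1%:R ^+ 2).
have ci : mu.-integrable setT (EFin \o (fun x => c * gauss_rV 1 x)).
  by apply: integrableZR; exact: integrable_gauss_rV.
have i1 : mu.-integrable setT (EFin \o (\1_(Om k) : rV -> R)).
  apply: le_integrableR ci; first exact: measurable_indic.
  move=> x; rewrite indicE ger0_norm//.
  have [/set_mem/= hx|_] := boolP (x \in _); last by rewrite mulr_ge0 ?expR_ge0 ?gauss_rV_ge0.
  rewrite /c /gauss_rV -expRD expr1n mul1r (le_trans _ (expR_ge1Dx _))//= lerDl subr_ge0.
  move: hx; rewrite /Om/= subr_gt0 => /ltW hx.
  have l0 : 0 <= l1 x by apply: sumr_ge0.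
  apply: (@le_trans _ _ (l1 x ^+ 2)); last by rewrite lerXn2r ?nnegrE.
  rewrite /dotp expr2 {1}/l1 mulr_suml; apply: ler_sum => i _.
  rewrite -expr2 -real_normK ?num_real// expr2 ler_wpM2l//.
  by rewrite /l1 (bigD1 i)//= lerDl; apply: sumr_ge0.
have := integrable_ge0_lty i1; rewrite integral_indic// setIT; apply => x.
by rewrite indicE.
Qed.

Let ndOm : {homo Om : i j / (i <= j)%N >-> (i <= j)%O}.
Proof.
move=> i j ij; apply/subsetPset => x; rewrite /Om/= !subr_gt0 => /lt_le_trans; apply.
by rewrite ler_nat.
Qed.

Let UOm : \bigcup_k Om k = setT.
Proof.
apply/seteqP; split => // x _.
have l0 : 0 <= l1 x by apply: sumr_ge0.
exists (Num.truncn (l1 x)) => //; rewrite /Om/= subr_gt0.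
by have /andP[] := truncn_itv l0.
Qed.

(** The truncations [f k] increase to the indicator of A. Each is Lipschitz and vanishes off A, a
    set of finite measure, so the second moment of the kernel bounds its defect by a constant over
    the squared scale. *)
Let NG A : G A -> (mu A < +oo)%E -> N \1_A.
Proof.
move=> GA Aoo; have mA := Gm GA.
have sA := sq_integrable_indic mA Aoo.
have [m [mm [L L0 Lm] AE]] := GA.
pose f (k : nat) (x : rV) : R := Num.min 1 (k%:R * Num.max 0 (m x)).
have f01 k x : 0 <= f k x <= \1_A x.
  rewrite indicE AE; have [/set_mem/= mx|/negP nm] := boolP (x \in _).
    have m0 : 0 <= Num.max 0 (m x) by rewrite le_max lexx.
    by rewrite /f; apply/andP; split; [rewrite le_min ler01 mulr_ge0|rewrite ge_min lexx].
  have mx : m x <= 0 by rewrite leNgt; apply/negP => h; apply: nm; exact/mem_set.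
  by rewrite /f max_l// mulr0 min_r ?lexx.
have mf k : measurable_fun setT (f k).
  apply: measurable_minr; first exact: measurable_cst.
  apply: measurable_funM; first exact: measurable_cst.
  by apply: measurable_maxr; [exact: measurable_cst|].
apply: (NL (F := f) (g := \1_A)) => //.
- move=> k; split => //.
  (* When both points are outside A both values are 0; otherwise the sum of the two indicators is at
     least 1 and the Lipschitz bound is enough. *)
  have Lf x t : (f k x - f k t) ^+ 2 <= (\1_A x + \1_A t) * ((k%:R * L) ^+ 2 * dotp (x - t) (x - t)).
    rewrite -enorm_sqr -exprMn.
    have fL : `|f k x - f k t| <= k%:R * L * enorm (x - t).
      rewrite -mulrA; apply: (@le_trans _ _ (k%:R * `|m x - m t|)); last by rewrite ler_wpM2l.
      rewrite /f; have k00 : 0 <= k%:R :> R by [].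
      have : `|Num.max 0 (m x) - Num.max 0 (m t)| <= `|m x - m t|.
        have h1 := ler_norm (m x - m t); have h2 := ler_norm (m t - m x); rewrite distrC in h2.
        rewrite ler_norml !maxElt.
        by apply/andP; split; case: ifPn => c1; case: ifPn => c2; rewrite -?leNgt in c1 c2; lra.
      set a := Num.max 0 (m x); set b := Num.max 0 (m t) => ab.
      have : `|k%:R * a - k%:R * b| <= k%:R * `|m x - m t|.
        by rewrite -mulrBr normrM ger0_norm// ler_wpM2l.
      rewrite !ler_norml !minElt => /andP[h1 h2].
      by apply/andP; split; case: ifPn => c1; case: ifPn => c2; rewrite -?leNgt in c1 c2; lra.
    have s0 : (f k x - f k t) ^+ 2 <= (k%:R * L * enorm (x - t)) ^+ 2.
      rewrite -[leLHS]real_normK ?num_real// lerXn2r ?nnegrE//.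
      by rewrite !mulr_ge0 ?enorm_ge0.
    have /andP[x0 x1] := f01 k x; have /andP[t0 t1] := f01 k t.
    move: x1 t1; rewrite !indicE.
    case: (x \in A); case: (t \in A) => /= x1 t1; rewrite ?mulr1n ?mulr0n ?addr0 ?add0r ?mul1r//.
      by rewrite mulrDl mul1r (le_trans s0)// lerDl sqr_ge0.
    have -> : f k x = 0 by apply/le_anti/andP.
    have -> : f k t = 0 by apply/le_anti/andP.
    by rewrite subr0 expr0n mul0r.
  apply/cvge0P => // e e0.
  have [MA MAE] : exists MA : R, mu A = MA%:E.
    by exists (fine (mu A)); rewrite fineK// ge0_fin_numE.
  have MA0 : 0 <= MA by rewrite -lee_fin -MAE.
  pose C : R := 2 * (MA * ((k%:R * L) ^+ 2 * (2 * Num.sqrt 2 ^+ n))).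
  have C0 : 0 <= C by rewrite !mulr_ge0 ?sqr_ge0 ?exprn_ge0 ?sqrtr_ge0.
  have bound j : (mollify_defect j.+1%:R (f k) <= (C / j.+1%:R ^+ 2)%:E)%E.
    have md : measurable_fun setT (fun h : rV => (k%:R * L) ^+ 2 * dotp h h).
      by apply: measurable_funM; [exact: measurable_cst|exact: measurable_dotpp].
    have mi : measurable_fun setT (\1_A : rV -> R) by exact: measurable_indic.
    have a0 x : 0 <= (\1_A : rV -> R) x by rewrite indicE.
    have d0 (h : rV) : 0 <= (k%:R * L) ^+ 2 * dotp h h by rewrite mulr_ge0 ?sqr_ge0 ?dotp_ge0.
    apply: le_trans (mollify_defect_dominated (k0 j) (mf k) mi md a0 d0 Lf) _.
    rewrite integral_indic// setIT [X in (_ * (X * _))%E]MAE.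
    under eq_integral do rewrite -mulrA EFinM.
    rewrite ge0_integralZl//; last 3 first.
    + apply/measurable_EFinP; apply: measurable_funM; first exact: measurable_dotpp.
      exact: measurable_gauss_kernel.
    + by move=> h _; rewrite lee_fin mulr_ge0 ?dotp_ge0 ?gauss_kernel_ge0.
    + by rewrite lee_fin sqr_ge0.
    have MA0' : (0 <= MA%:E)%E by rewrite lee_fin.
    have kL0 : (0 <= ((k%:R * L) ^+ 2)%:E)%E by rewrite lee_fin sqr_ge0.
    have E := lee_wpmul2l two0 (lee_wpmul2l MA0' (lee_wpmul2l kL0 (gauss_kernel_moment (k0 j)))).
    by apply: le_trans (E n) _; rewrite -!EFinM /C !mulrA.
  (* From this rank on, (j+1)^2 >= j+1 > C/e. *)
  exists (Num.truncn (C / e)) => // j /= jC.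
  apply: le_trans (bound j) _; rewrite lee_fin ler_pdivrMr ?exprn_gt0//.
  rewrite -ler_pdivrMl// mulrC.
  have ce0 : 0 <= C / e by rewrite divr_ge0// ltW.
  have /andP[_ h] := truncn_itv ce0.
  apply: (@le_trans _ _ j.+1%:R); first by rewrite (le_trans (ltW h))// ler_nat ltnS.
  by rewrite -[leLHS]expr1 ler_weXn2l// ler1n.
- move=> x; apply: cvg_near_cst; rewrite indicE AE.
  have [/set_mem/= mx|/negP nm] := boolP (x \in _).
    near=> k; rewrite /f max_r ?(ltW mx)// min_l// -ler_pdivrMr//.
    by near: k; exact: nbhs_infty_ger.
  have mx : m x <= 0 by rewrite leNgt; apply/negP => h; apply: nm; exact/mem_set.
  by apply: nearW => k; rewrite /f max_l// mulr0 min_r.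
- by move=> k x; have /andP[h1 h2] := f01 k x; rewrite ger0_norm.
Unshelve. all: by end_near. Qed.

Lemma mollify_defect_cvg0 (F : rV -> R) : sq_integrable mu F ->
  mollify_defect k.+1%:R F @[k --> \oo] --> 0%E.
Proof.
move=> Fi.
suff [] : N F by [].
exact: (sq_integrable_monotone_class ND NZ NL GI GT Gm GOm mOm ndOm UOm NG).
Qed.

End mollify_density.

(** * Plancherel and Fourier multipliers *)

Section fourier_L1.
Context {R : realType} {n : nat}.
Local Notation mu := (lebesgue_rV R n).
Local Notation rV := 'rV[R]_n.
Implicit Types F : rV -> R.

Definition fourier_cos F (t : rV) : R := \int[mu]_x (cos (2 * pi * dotp x t) * F x).
Definition fourier_sin F (t : rV) : R := \int[mu]_x (sin (2 * pi * dotp x t) * F x).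

Lemma measurable_phase : measurable_fun setT (fun p : rV * rV => 2 * pi * dotp p.1 p.2).
Proof. by apply: measurable_funM; [exact: measurable_cst|exact: measurable_dotp]. Qed.

Lemma measurable_cos_phase : measurable_fun setT (fun p : rV * rV => cos (2 * pi * dotp p.1 p.2)).
Proof.
apply: measurableT_comp measurable_phase.
by apply: continuous_measurable_fun; exact: continuous_cos.
Qed.

Lemma measurable_sin_phase : measurable_fun setT (fun p : rV * rV => sin (2 * pi * dotp p.1 p.2)).
Proof.
apply: measurableT_comp measurable_phase.
by apply: continuous_measurable_fun; exact: continuous_sin.
Qed.

Lemma measurable_cos_phase1 t : measurable_fun setT (fun x : rV => cos (2 * pi * dotp x t)).
Proof. exact: (measurableT_comp measurable_cos_phase (pair2_measurable t)). Qed.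

Lemma measurable_sin_phase1 t : measurable_fun setT (fun x : rV => sin (2 * pi * dotp x t)).
Proof. exact: (measurableT_comp measurable_sin_phase (pair2_measurable t)). Qed.

Lemma integrable_cosM F t : mu.-integrable setT (EFin \o F) ->
  mu.-integrable setT (EFin \o (fun x => cos (2 * pi * dotp x t) * F x)).
Proof.
move=> Fi; have := integrableMR (measurable_cos_phase1 t) (fun x => normr_cos_le1 _) Fi.
by under [X in EFin \o X]eq_fun do rewrite mulrC.
Qed.

Lemma integrable_sinM F t : mu.-integrable setT (EFin \o F) ->
  mu.-integrable setT (EFin \o (fun x => sin (2 * pi * dotp x t) * F x)).
Proof.
move=> Fi; have := integrableMR (measurable_sin_phase1 t) (fun x => normr_sin_le1 _) Fi.
by under [X in EFin \o X]eq_fun do rewrite mulrC.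
Qed.

Lemma measurable_fourier_cos F : measurable_fun setT F -> measurable_fun setT (fourier_cos F).
Proof.
move=> mF; apply: (@measurable_Rintegral1 _ _ _ _ _ mu (fun p : rV * rV => cos (2 * pi * dotp p.2 p.1) * F p.2)) => /=.
apply: measurable_funM; last exact: measurableT_comp mF measurable_snd.
by under eq_fun do rewrite dotpC; exact: measurable_cos_phase.
Qed.

Lemma measurable_fourier_sin F : measurable_fun setT F -> measurable_fun setT (fourier_sin F).
Proof.
move=> mF; apply: (@measurable_Rintegral1 _ _ _ _ _ mu (fun p : rV * rV => sin (2 * pi * dotp p.2 p.1) * F p.2)) => /=.
apply: measurable_funM; last exact: measurableT_comp mF measurable_snd.
by under eq_fun do rewrite dotpC; exact: measurable_sin_phase.
Qed.

Lemma fourier_cos_le F t : mu.-integrable setT (EFin \o F) ->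
  `|fourier_cos F t| <= \int[mu]_x `|F x|.
Proof.
move=> Fi; apply: le_trans (le_normr_Rintegral measurableT (integrable_cosM t Fi)) _.
apply: le_Rintegral => //.
- exact/integrable_norm/integrable_cosM.
- exact: integrable_norm.
- by move=> x _; rewrite normrM ler_piMl// normr_cos_le1.
Qed.

Lemma fourier_sin_le F t : mu.-integrable setT (EFin \o F) ->
  `|fourier_sin F t| <= \int[mu]_x `|F x|.
Proof.
move=> Fi; apply: le_trans (le_normr_Rintegral measurableT (integrable_sinM t Fi)) _.
apply: le_Rintegral => //.
- exact/integrable_norm/integrable_sinM.
- exact: integrable_norm.
- by move=> x _; rewrite normrM ler_piMl// normr_sin_le1.
Qed.

(** With 2 pi in the phase, the Gaussian of parameter pi / w is the one whose transform is the
    kernel normalized to mass 1. *)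
Lemma gauss_kernel_fourier (w : R) (h : rV) : 0 < w ->
  \int[mu]_t (gauss_rV (pi / w) t * cos (2 * pi * dotp t h)) = gauss_kernel w h.
Proof.
move=> w0; have p0 := @pi_gt0 R; have pw : 0 < pi / w :> R by rewrite divr_gt0.
transitivity (\int[mu]_t (gauss_rV (pi / w) t * cos (2 * pi * dotp t h + 0))).
  by apply: eq_Rintegral => t _; rewrite addr0.
rewrite gauss_rV_cos// cos0 mulr1 /gauss_kernel -exprVn.
have -> : Num.sqrt pi / (pi / w) = (Num.sqrt pi / w)^-1 :> R.
  have s2 : Num.sqrt pi ^+ 2 = pi :> R by rewrite sqr_sqrtr// ltW.
  by rewrite -{2}s2; field; rewrite !gt_eqF// sqrt_pi_gt0.
have -> : 2 * pi / (2 * (pi / w)) = w; last by [].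
by move: (pi : R) p0 => P P0; field; rewrite !lt0r_neq0.
Qed.

Definition fourier_sq F t : R := fourier_cos F t ^+ 2 + fourier_sin F t ^+ 2.

Lemma gauss_kernel_le (w : R) (h : rV) : 0 <= w ->
  `|gauss_kernel w h| <= (Num.sqrt pi / w) ^- n.
Proof.
move=> w0; rewrite ger0_norm ?gauss_kernel_ge0// /gauss_kernel.
rewrite ler_piMr ?invr_ge0 ?exprn_ge0 ?divr_ge0 ?sqrtr_ge0//.
by rewrite /gauss_rV -[leRHS]expR0 ler_expR oppr_le0 mulr_ge0 ?dotp_ge0 ?sqr_ge0.
Qed.

Lemma integrable_conv_gauss F (w : R) : mu.-integrable setT (EFin \o F) -> 0 < w ->
  (mu \x mu)%E.-integrable setT
    (EFin \o (fun p => F p.1 * F p.2 * gauss_kernel w (p.1 - p.2))).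
Proof.
move=> Fi w0.
apply: (integrableMR (C := (Num.sqrt pi / w) ^- n) _ _ (integrable_prod Fi Fi)).
  exact: measurable_diff (measurable_gauss_kernel w).
by move=> p; apply: gauss_kernel_le; exact: ltW.
Qed.

(** Writing the kernel as a Gaussian superposition of cos(2 pi (x - y).t) and expanding this cosine
    of a difference separates the two variables, which diagonalizes the quadratic form. *)
Lemma gauss_form_fourier F (w : R) : mu.-integrable setT (EFin \o F) -> 0 < w ->
  \int[(mu \x mu)%E]_p (F p.1 * F p.2 * gauss_kernel w (p.1 - p.2)) =
  \int[mu]_t (gauss_rV (pi / w) t * fourier_sq F t).
Proof.
move=> Fi w0; have pw : 0 < pi / w :> R by rewrite divr_gt0// pi_gt0.
have gi := @integrable_gauss_rV R n _ pw.
pose G := gauss_rV (pi / w) : rV -> R.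
(* [A x t] is the real part of e^(-2 pi i x.t) times the transform of F at t, the integrand of
   Fourier inversion. *)
pose A (x t : rV) := cos (2 * pi * dotp x t) * fourier_cos F t + sin (2 * pi * dotp x t) * fourier_sin F t.
have mF := integrable_measurable Fi.
have mA : measurable_fun setT (fun z : rV * rV => A z.1 z.2).
  apply: measurable_funD; apply: measurable_funM.
  - exact: measurable_cos_phase.
  - exact: measurableT_comp (measurable_fourier_cos mF) measurable_snd.
  - exact: measurable_sin_phase.
  - exact: measurableT_comp (measurable_fourier_sin mF) measurable_snd.
pose M := \int[mu]_x `|F x|.
have AM x t : `|A x t| <= M + M.
  apply: le_trans (ler_normD _ _) _; rewrite !normrM; apply: lerD.
    by rewrite -[leRHS]mul1r ler_pM ?normr_cos_le1 ?fourier_cos_le.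
  by rewrite -[leRHS]mul1r ler_pM ?normr_sin_le1 ?fourier_sin_le.
have inner x : \int[mu]_y (F y * gauss_kernel w (x - y)) = \int[mu]_t (G t * A x t).
  pose h (z : rV * rV) := F z.1 * G z.2 * cos (2 * pi * dotp (x - z.1) z.2).
  have hi : (mu \x mu)%E.-integrable setT (EFin \o h).
    have mc : measurable_fun setT (fun z : rV * rV => cos (2 * pi * dotp (x - z.1) z.2)).
      have m1 : measurable_fun setT (fun z : rV * rV => (x - z.1, z.2)).
        apply: measurable_fun_pair; last exact: measurable_snd.
        exact: measurableT_comp (measurable_rVB x) measurable_fst.
      exact: measurableT_comp measurable_cos_phase m1.
    exact: (integrableMR mc (fun z => normr_cos_le1 _) (integrable_prod Fi gi)).
  transitivity (\int[mu]_y \int[mu]_t h (y, t)).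
    apply: eq_Rintegral => y _; rewrite -gauss_kernel_fourier// -RintegralZl//.
      by apply: eq_Rintegral => t _; rewrite /h/= -!mulrA [dotp t _]dotpC.
    have := integrable_cosM (x - y) gi.
    by under [X in EFin \o X]eq_fun do rewrite mulrC.
  rewrite RFubini//; apply: eq_Rintegral => t _.
  have e y : h (y, t) = G t * (cos (2 * pi * dotp x t) * (cos (2 * pi * dotp y t) * F y) +
      sin (2 * pi * dotp x t) * (sin (2 * pi * dotp y t) * F y)).
    by rewrite /h/= dotpBl mulrBr cosB; ring.
  have Ci := integrable_cosM t Fi; have Si := integrable_sinM t Fi.
  have Ci' := integrableZR (cos (2 * pi * dotp x t)) Ci.
  have Si' := integrableZR (sin (2 * pi * dotp x t)) Si.
  under eq_Rintegral do rewrite e.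
  by rewrite RintegralZl// ?RintegralD// ?RintegralZl//; exact: integrableDR.
rewrite -(RFubini1 (integrable_conv_gauss Fi w0)).2/=.
pose h (z : rV * rV) := F z.1 * G z.2 * A z.1 z.2.
have hi : (mu \x mu)%E.-integrable setT (EFin \o h).
  exact: (integrableMR mA (fun z => AM z.1 z.2) (integrable_prod Fi gi)).
transitivity (\int[mu]_x \int[mu]_t h (x, t)).
  apply: eq_Rintegral => x _.
  transitivity (\int[mu]_y (F x * (F y * gauss_kernel w (x - y)))).
    by apply: eq_Rintegral => y _; rewrite mulrA.
  have mk : measurable_fun setT (fun y : rV => gauss_kernel w (x - y)).
    exact: measurableT_comp (measurable_gauss_kernel w) (measurable_rVB x).
  rewrite RintegralZl//.
    rewrite inner -RintegralZl//; first by apply: eq_Rintegral => t _; rewrite /h/= mulrA.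
    have mAx : measurable_fun setT (A x) by exact: measurableT_comp mA (pair1_measurable x).
    exact: (integrableMR mAx (AM x) gi).
  exact: (integrableMR mk (fun y => gauss_kernel_le (x - y) (ltW w0)) Fi).
rewrite RFubini//; apply: eq_Rintegral => t _.
have e x : h (x, t) = G t * (fourier_cos F t * (cos (2 * pi * dotp x t) * F x) +
    fourier_sin F t * (sin (2 * pi * dotp x t) * F x)) by rewrite /h/= /A; ring.
have Ci := integrable_cosM t Fi; have Si := integrable_sinM t Fi.
have Ci' := integrableZR (fourier_cos F t) Ci.
have Si' := integrableZR (fourier_sin F t) Si.
under eq_Rintegral do rewrite e.
rewrite RintegralZl// ?RintegralD// ?RintegralZl//; last exact: integrableDR.
Qed.

End fourier_L1.

(** * Plancherel for functions in L1 and L2 *)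

Section plancherel.
Context {R : realType} {n : nat}.
Local Notation mu := (lebesgue_rV R n).
Local Notation rV := 'rV[R]_n.
Implicit Types (a F : rV -> R).

Lemma integrable_conv1 a (k : rV -> R) : mu.-integrable setT (EFin \o a) ->
  mu.-integrable setT (EFin \o k) ->
  (mu \x mu)%E.-integrable setT (EFin \o (fun p => a p.1 * k (p.1 - p.2))).
Proof.
move=> ai ki; have ma := integrable_measurable ai; have mk := integrable_measurable ki.
apply/integrable12ltyP.
  apply/measurable_EFinP; apply: measurable_funM; last exact: measurable_diff.
  exact: measurableT_comp.
have nai : mu.-integrable setT (EFin \o (fun x => `|a x|)) by exact: integrable_norm.
have nki : mu.-integrable setT (EFin \o (fun x => `|k x|)) by exact: integrable_norm.
have := conv_mass1 (integrable_measurable nai) (integrable_measurable nki) (fun x => normr_ge0 _) (fun x => normr_ge0 _).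
under eq_integral do under eq_integral do rewrite -normrM.
move=> ->; apply: lte_mul_pinfty.
- by apply: integral_ge0 => x _; rewrite lee_fin.
- exact: integrable_fin_num nai.
- exact: integrable_ge0_lty nki _.
Qed.

Lemma integrable_conv2 a (k : rV -> R) : mu.-integrable setT (EFin \o a) ->
  mu.-integrable setT (EFin \o k) ->
  (mu \x mu)%E.-integrable setT (EFin \o (fun p => a p.2 * k (p.1 - p.2))).
Proof.
move=> ai ki; have ma := integrable_measurable ai; have mk := integrable_measurable ki.
apply/integrable12ltyP.
  apply/measurable_EFinP; apply: measurable_funM; last exact: measurable_diff.
  exact: measurableT_comp.
have nai : mu.-integrable setT (EFin \o (fun x => `|a x|)) by exact: integrable_norm.
have nki : mu.-integrable setT (EFin \o (fun x => `|k x|)) by exact: integrable_norm.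
have := conv_mass2 (integrable_measurable nai) (integrable_measurable nki) (fun x => normr_ge0 _) (fun x => normr_ge0 _).
under eq_integral do under eq_integral do rewrite -normrM.
move=> ->; apply: lte_mul_pinfty.
- by apply: integral_ge0 => x _; rewrite lee_fin.
- exact: integrable_fin_num nai.
- exact: integrable_ge0_lty nki _.
Qed.

Lemma integrable_gauss_kernel (w : R) : 0 < w -> mu.-integrable setT (EFin \o gauss_kernel w).
Proof.
move=> w0; apply: (ge0_integrable_lty (measurable_gauss_kernel w)).
  by move=> x; rewrite gauss_kernel_ge0// ltW.
by rewrite integral_gauss_kernel// ltry.
Qed.

Lemma Rintegral_gauss_kernel (w : R) : 0 < w -> \int[mu]_x gauss_kernel w x = 1.
Proof. by move=> w0; rewrite /Rintegral integral_gauss_kernel. Qed.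

Lemma gauss_kernelN (w : R) (h : rV) : gauss_kernel w (- h) = gauss_kernel w h.
Proof. by rewrite /gauss_kernel /gauss_rV dotpNl dotpC dotpNl opprK. Qed.

(** Expanding the square gives the squared norm twice, by the unit mass of the kernel, and minus
    twice the quadratic form of [gauss_form_fourier]. *)
Lemma mollify_defect_fourier F (w : R) : 0 < w -> mu.-integrable setT (EFin \o F) ->
  sq_integrable mu F ->
  mollify_defect w F =
    (2 * (\int[mu]_x F x ^+ 2 - \int[mu]_t (gauss_rV (pi / w) t * fourier_sq F t)))%:E.
Proof.
move=> w0 Fi [mF F2i]; have ki := integrable_gauss_kernel w0.
have i1 := integrable_conv1 F2i ki; have i2 := integrable_conv2 F2i ki.
have i3 := integrable_conv_gauss Fi w0.
pose q (p : rV * rV) := (F p.1 - F p.2) ^+ 2 * gauss_kernel w (p.1 - p.2).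
have qE p : q p = F p.1 ^+ 2 * gauss_kernel w (p.1 - p.2) +
    F p.2 ^+ 2 * gauss_kernel w (p.1 - p.2) +
    - 2 * (F p.1 * F p.2 * gauss_kernel w (p.1 - p.2)) by rewrite /q; ring.
have i12 := integrableDR i1 i2.
have i3' := integrableZR (- 2) i3.
have qi : (mu \x mu)%E.-integrable setT (EFin \o q).
  by rewrite (funext qE); exact: integrableDR.
have J1 : \int[(mu \x mu)%E]_p (F p.1 ^+ 2 * gauss_kernel w (p.1 - p.2)) = \int[mu]_x F x ^+ 2.
  rewrite -(RFubini1 i1).2/=; apply: eq_Rintegral => x _.
  have kx := integrable_reflect x ki.
  rewrite RintegralZl//= Rintegral_reflect; last exact: integrable_measurable ki.
  by rewrite Rintegral_gauss_kernel// mulr1.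
have J2 : \int[(mu \x mu)%E]_p (F p.2 ^+ 2 * gauss_kernel w (p.1 - p.2)) = \int[mu]_x F x ^+ 2.
  rewrite -(RFubini2 i2).2/=; apply: eq_Rintegral => x _.
  have kx := integrable_reflect x ki.
  transitivity (\int[mu]_t (F x ^+ 2 * gauss_kernel w (x - t))).
    by apply: eq_Rintegral => t _; rewrite -gauss_kernelN opprB.
  rewrite RintegralZl//= Rintegral_reflect; last exact: integrable_measurable ki.
  by rewrite Rintegral_gauss_kernel// mulr1.
transitivity (\int[(mu \x mu)%E]_p (q p)%:E)%E.
  exact: (integral12_prod_meas1 qi).
rewrite -EFin_Rintegral//; congr EFin.
under eq_Rintegral do rewrite qE.
by rewrite RintegralD// RintegralD// RintegralZl// J1 J2 gauss_form_fourier//; ring.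
Qed.

Lemma measurable_fourier_sq F : measurable_fun setT F -> measurable_fun setT (fourier_sq F).
Proof.
move=> mF; apply: measurable_funD; apply: measurable_funX.
  exact: measurable_fourier_cos.
exact: measurable_fourier_sin.
Qed.

Lemma fourier_sq_ge0 F t : 0 <= fourier_sq F t.
Proof. by rewrite addr_ge0 ?sqr_ge0. Qed.

Lemma fourier_sq_le F t : mu.-integrable setT (EFin \o F) ->
  `|fourier_sq F t| <= 2 * (\int[mu]_x `|F x|) ^+ 2.
Proof.
move=> Fi; have M0 : 0 <= \int[mu]_x `|F x| by exact: Rintegral_ge0.
rewrite ger0_norm ?fourier_sq_ge0// mulr_natl mulr2n.
apply: lerD; rewrite -[leLHS]ger0_norm ?sqr_ge0// normrX lerXn2r ?nnegrE//.
  exact: fourier_cos_le.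
exact: fourier_sin_le.
Qed.

(** Since the defect vanishes in the limit, the Gaussian-weighted integrals of the squared transform
    tend to the squared norm. Their weights increase to 1, as pi / (k+1) decreases to 0, and
    monotone convergence removes them. *)
Lemma plancherel_L1 F : mu.-integrable setT (EFin \o F) -> sq_integrable mu F ->
  (\int[mu]_t (fourier_sq F t)%:E = (\int[mu]_x F x ^+ 2)%:E)%E.
Proof.
move=> Fi F2; have mF := F2.1; have mf := measurable_fourier_sq mF.
have fsM t := fourier_sq_le t Fi.
pose G (k : nat) t := gauss_rV (pi / k.+1%:R) t * fourier_sq F t.
have pk (k : nat) : 0 < pi / k.+1%:R :> R by rewrite divr_gt0 ?pi_gt0.
have mG (k : nat) : measurable_fun setT (G k).
  by apply: measurable_funM mf; exact: measurable_gauss_rV.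
have Gi (k : nat) : mu.-integrable setT (EFin \o G k).
  have gi := @integrable_gauss_rV R n _ (pk k).
  exact: (integrableMR mf fsM gi).
have lim1 : (\int[mu]_t (G k t)%:E)%E @[k --> \oo] --> (\int[mu]_x F x ^+ 2)%:E.
  have h := mollify_defect_cvg0 F2.
  have E (k : nat) : mollify_defect k.+1%:R F = (2 * (\int[mu]_x F x ^+ 2 - \int[mu]_t G k t))%:E.
    exact: mollify_defect_fourier.
  have h1 : 2 * (\int[mu]_x F x ^+ 2 - \int[mu]_t G k t) @[k --> \oo] --> (0 : R).
    move: h; rewrite (funext E); exact: fine_cvg.
  have h2 : \int[mu]_t G k t @[k --> \oo] --> \int[mu]_x F x ^+ 2.
    rewrite (_ : (fun k => _) = (fun k => \int[mu]_x F x ^+ 2 -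
        2^-1 * (2 * (\int[mu]_x F x ^+ 2 - \int[mu]_t G k t)))); last first.
      by apply/funext => k; rewrite mulKf// opprB addrC subrK.
    rewrite -[X in _ --> X]subr0 -[X in _ - X](mulr0 2^-1).
    by apply: cvgB; [exact: cvg_cst|apply: cvgM => //; exact: cvg_cst].
  by under eq_fun do rewrite -EFin_Rintegral//; apply: cvg_EFin => //; exact: nearW.
apply: cvg_unique lim1; first exact: ereal_hausdorff.
have Gcvg t : (G k t)%:E @[k --> \oo] --> (fourier_sq F t)%:E.
  apply: cvg_EFin; first exact: nearW.
  rewrite -[X in _ --> X]mul1r -expR0; apply: cvgM; last exact: cvg_cst.
  apply: continuous_cvg; first exact: continuous_expR.
  have pk0 : pi / k.+1%:R @[k --> \oo] --> (0 : R).
    by rewrite -(mulr0 pi); apply: cvgM; [exact: cvg_cst|exact: cvg_harmonic].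
  rewrite -[X in _ --> X]oppr0 -(mul0r (dotp t t)) -(mulr0 0).
  by apply: cvgN; apply: cvgM; [exact: cvgM|exact: cvg_cst].
have := @cvg_monotone_convergence _ _ _ mu setT measurableT (fun k t => (G k t)%:E).
rewrite (_ : (fun x => limn _) = (fun t => (fourier_sq F t)%:E)); last first.
  by apply/funext => t; apply/cvg_lim => //; exact: Gcvg.
apply.
- by move=> k; exact/measurable_EFinP.
- by move=> k t _; rewrite lee_fin mulr_ge0 ?fourier_sq_ge0 ?gauss_rV_ge0.
move=> t _ i j ij; rewrite lee_fin ler_wpM2r ?fourier_sq_ge0// /gauss_rV ler_expR lerN2.
rewrite ler_wpM2r ?dotp_ge0// lerXn2r ?nnegrE ?(ltW (pk _))//.
by rewrite ler_wpM2l ?(ltW (pi_gt0 R))// lef_pV2 ?posrE// ler_nat ltnS.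
Qed.

End plancherel.

Lemma sq_cvg0_le d (T : measurableType d) (R : realType) (m : {measure set T -> \bar R})
    (C : R) (u v w : nat -> T -> R) : 0 <= C ->
  (forall k, measurable_fun setT (u k)) -> (forall k, measurable_fun setT (v k)) ->
  (forall k, measurable_fun setT (w k)) ->
  (forall k x, w k x ^+ 2 <= C * (u k x ^+ 2 + v k x ^+ 2)) ->
  (\int[m]_x (u k x ^+ 2)%:E)%E @[k --> \oo] --> 0%E ->
  (\int[m]_x (v k x ^+ 2)%:E)%E @[k --> \oo] --> 0%E ->
  (\int[m]_x (w k x ^+ 2)%:E)%E @[k --> \oo] --> 0%E.
Proof.
move=> C0 mu mv mw wuv u0 v0.
have ad : ((0 : \bar R) +? 0)%E by [].
have := cvgeZl (y := C%:E) isT (cvgeD ad u0 v0); rewrite adde0 mule0 => h.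
apply: (squeeze_cvge _ (@cvg_cst _ 0%E _ _ _) (h _)); apply: nearW => k.
have q (f : nat -> T -> R) : (forall k, measurable_fun setT (f k)) ->
    measurable_fun setT (fun x => (f k x ^+ 2)%:E).
  by move=> mf; apply/measurable_EFinP; exact: measurable_funX.
apply/andP; split; first by apply: integral_ge0 => x _; rewrite lee_fin sqr_ge0.
rewrite -ge0_integralD//; last 4 first.
- by move=> x _; rewrite lee_fin sqr_ge0.
- exact: q.
- by move=> x _; rewrite lee_fin sqr_ge0.
- exact: q.
rewrite -ge0_integralZl//.
2: by apply: emeasurable_funD; exact: q.
2: by move=> x _; rewrite adde_ge0// lee_fin sqr_ge0.
apply: ge0_le_integral => //.
- by move=> x _; rewrite lee_fin sqr_ge0.
- exact: q.
- by apply/measurable_EFinP; apply: measurable_funM => //; apply: measurable_funD; exact: measurable_funX.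
- by move=> x _; rewrite lee_fin wuv.
Qed.

(** * The transform on L2 and bounded multipliers *)

Section fourier_L2.
Context {R : realType} {n : nat}.
Local Notation mu := (lebesgue_rV R n).
Local Notation rV := 'rV[R]_n.
Implicit Types (f g F a b : rV -> R).

Definition L1L2 F := mu.-integrable setT (EFin \o F) /\ sq_integrable mu F.

Lemma sq_integrable_fourier F : L1L2 F ->
  sq_integrable mu (fourier_cos F) /\ sq_integrable mu (fourier_sin F).
Proof.
move=> [Fi F2].
have fs : mu.-integrable setT (EFin \o fourier_sq F).
  apply: ge0_integrable_lty; first exact: measurable_fourier_sq F2.1.
    exact: fourier_sq_ge0.
  by rewrite plancherel_L1// ltry.
have mc := measurable_fourier_cos F2.1; have ms := measurable_fourier_sin F2.1.
by split; split=> //; apply: le_integrableR fs;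
  rewrite ?/fourier_sq; do ?[exact: measurable_funX];
  move=> t; rewrite ger0_norm ?sqr_ge0// ?lerDl ?lerDr ?sqr_ge0.
Qed.

(* [g_cos] and [g_sin] are the real and imaginary parts of the L2 transform. *)
Definition is_FT f g_cos g_sin :=
  [/\ sq_integrable mu f, sq_integrable mu g_cos, sq_integrable mu g_sin &
   exists F : nat -> rV -> R,
   [/\ forall k, L1L2 (F k),
     (\int[mu]_x ((F k x - f x) ^+ 2)%:E)%E @[k --> \oo] --> 0%E,
     (\int[mu]_x ((fourier_cos (F k) x - g_cos x) ^+ 2)%:E)%E @[k --> \oo] --> 0%E &
     (\int[mu]_x ((fourier_sin (F k) x - g_sin x) ^+ 2)%:E)%E @[k --> \oo] --> 0%E]].

Lemma is_fourier_L2_FT f (g : rV -> R[i]) : L2 f -> is_fourier_L2 f g ->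
  is_FT f (fun t => complex.Re (g t)) (fun t => complex.Im (g t)).
Proof.
move=> fL2 [[grL giL] [F [FL Ff Fg]]].
have fi := Lfun2_sq_integrable fL2.
have gr := Lfun2_sq_integrable grL; have gi := Lfun2_sq_integrable giL.
have FL' k : L1L2 (F k).
  have [h1 h2] := FL k; split; last exact: Lfun2_sq_integrable.
  exact/Lfun1_integrable.
have nE k t : Normc.normc (fourier (F k) t - g t) ^+ 2 =
    (fourier_cos (F k) t - complex.Re (g t)) ^+ 2 + (fourier_sin (F k) t - complex.Im (g t)) ^+ 2.
  by rewrite /fourier; case: (g t) => x y; rewrite /= sqr_sqrtr// addr_ge0 ?sqr_ge0.
split=> //; exists F; split => //.
- by under eq_fun do under eq_integral do rewrite -[(F _ _ - _) ^+ 2]real_normK ?num_real//.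
- apply: (squeeze_cvge _ (@cvg_cst _ 0%E _ _ _) Fg); apply: nearW => k.
  have [[mc _] [ms _]] := sq_integrable_fourier (FL' k).
  apply/andP; split; first by apply: integral_ge0 => x _; rewrite lee_fin sqr_ge0.
  apply: ge0_le_integral => //.
  + by move=> x _; rewrite lee_fin sqr_ge0.
  + by apply/measurable_EFinP/measurable_funX/measurable_funB => //; exact: gr.1.
  + under eq_fun do rewrite nE; apply/measurable_EFinP/measurable_funD;
      apply/measurable_funX/measurable_funB => //; [exact: gr.1|exact: gi.1].
  + by move=> x _; rewrite lee_fin nE lerDl sqr_ge0.
- apply: (squeeze_cvge _ (@cvg_cst _ 0%E _ _ _) Fg); apply: nearW => k.
  have [[mc _] [ms _]] := sq_integrable_fourier (FL' k).
  apply/andP; split; first by apply: integral_ge0 => x _; rewrite lee_fin sqr_ge0.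
  apply: ge0_le_integral => //.
  + by move=> x _; rewrite lee_fin sqr_ge0.
  + by apply/measurable_EFinP/measurable_funX/measurable_funB => //; exact: gi.1.
  + under eq_fun do rewrite nE; apply/measurable_EFinP/measurable_funD;
      apply/measurable_funX/measurable_funB => //; [exact: gr.1|exact: gi.1].
  + by move=> x _; rewrite lee_fin nE lerDr sqr_ge0.
Qed.

Lemma plancherel f g_cos g_sin : is_FT f g_cos g_sin ->
  \int[mu]_x f x ^+ 2 = \int[mu]_t (g_cos t ^+ 2 + g_sin t ^+ 2).
Proof.
move=> [fi gr gi [F [FL Ff Fr Fi]]].
have FC k := (sq_integrable_fourier (FL k)).1; have FS k := (sq_integrable_fourier (FL k)).2.
rewrite RintegralD//; [|exact: gr.2|exact: gi.2].
have h1 := sq_integral_cvg (fun k => (FL k).2) fi Ff.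
have h2 := cvgD (sq_integral_cvg FC gr Fr) (sq_integral_cvg FS gi Fi).
apply: cvg_unique h1 _; first exact: Rhausdorff.
rewrite (_ : (fun k => _) = (fun k => \int[mu]_x fourier_cos (F k) x ^+ 2 +
    \int[mu]_x fourier_sin (F k) x ^+ 2)); first exact: h2.
apply/funext => k; rewrite -RintegralD//; [|exact: (FC k).2|exact: (FS k).2].
by rewrite /Rintegral plancherel_L1 ?(FL k).1 ?(FL k).2//; case: (FL k).
Qed.

(** The operator [T] multiplies transforms by the bounded complex function a + i b. Since it is
    bounded on L2, it maps an approximating sequence of f to one of [T f], and the transforms
    follow. *)
Lemma is_FT_multiplier (T : (rV -> R) -> rV -> R) (C M : R) a b f g_cos g_sin :
  0 <= C ->
  measurable_fun setT a -> measurable_fun setT b ->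
  (forall t, `|a t| <= M) -> (forall t, `|b t| <= M) ->
  (forall F, L1L2 F -> L1L2 (T F)) -> sq_integrable mu (T f) ->
  (forall F, L1L2 F ->
    \int[mu]_x ((T F x - T f x) ^+ 2)%:E <= C%:E * \int[mu]_x ((F x - f x) ^+ 2)%:E)%E ->
  (forall F t, L1L2 F -> fourier_cos (T F) t = a t * fourier_cos F t - b t * fourier_sin F t) ->
  (forall F t, L1L2 F -> fourier_sin (T F) t = b t * fourier_cos F t + a t * fourier_sin F t) ->
  is_FT f g_cos g_sin ->
  is_FT (T f) (fun t => a t * g_cos t - b t * g_sin t) (fun t => b t * g_cos t + a t * g_sin t).
Proof.
move=> C0 ma mb aM bM TL Tf TC TCF TSF [fi gr gi [F [FL Ff Fr Fi]]].
have FC k := (sq_integrable_fourier (FL k)).1; have FS k := (sq_integrable_fourier (FL k)).2.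
have bd (c h : rV -> R) : measurable_fun setT c -> (forall t, `|c t| <= M) -> sq_integrable mu h ->
    sq_integrable mu (fun t => c t * h t).
  by move=> mc cM hi; exact: sq_integrable_bounded_mul cM hi.
have sq2 (x y : R) : (x + y) ^+ 2 <= 2 * (x ^+ 2 + y ^+ 2).
  by have := sqr_ge0 (x - y); nra.
have sqM (c x : R) : `|c| <= M -> (c * x) ^+ 2 <= M ^+ 2 * x ^+ 2.
  move=> cM; rewrite exprMn ler_wpM2r ?sqr_ge0// -[leLHS]real_normK ?num_real//.
  by rewrite lerXn2r ?nnegrE// (le_trans _ cM).
have sqb (c e x y : R) : `|c| <= M -> `|e| <= M ->
    (c * x + e * y) ^+ 2 <= 2 * M ^+ 2 * (x ^+ 2 + y ^+ 2).
  move=> cM eM; apply: le_trans (sq2 _ _) _; rewrite -mulrA ler_wpM2l// mulrDr.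
  by apply: lerD; exact: sqM.
have CM : 0 <= 2 * M ^+ 2 by rewrite mulr_ge0// sqr_ge0.
split=> //.
- by apply: sq_integrableB; apply: bd.
- by apply: sq_integrableD; apply: bd.
exists (fun k => T (F k)); split.
- by move=> k; exact: TL.
- have := cvgeZl (y := C%:E) isT Ff; rewrite mule0 => h.
  apply: (squeeze_cvge _ (@cvg_cst _ 0%E _ _ _) h); apply: nearW => k.
  by rewrite TC// andbT; apply: integral_ge0 => x _; rewrite lee_fin sqr_ge0.
- apply: (sq_cvg0_le CM _ _ _ _ Fr Fi).
  + by move=> k; apply: measurable_funB; [exact: (FC k).1|exact: gr.1].
  + by move=> k; apply: measurable_funB; [exact: (FS k).1|exact: gi.1].
  + move=> k; apply: measurable_funB.
      exact: (sq_integrable_fourier (TL _ (FL k))).1.1.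
    by apply: measurable_funB; apply: measurable_funM => //; [exact: gr.1|exact: gi.1].
  + move=> k t; rewrite TCF//.
    have -> : a t * fourier_cos (F k) t - b t * fourier_sin (F k) t - (a t * g_cos t - b t * g_sin t) =
      a t * (fourier_cos (F k) t - g_cos t) + (- b t) * (fourier_sin (F k) t - g_sin t) by ring.
    by apply: sqb; rewrite ?normrN.
- apply: (sq_cvg0_le CM _ _ _ _ Fr Fi).
  + by move=> k; apply: measurable_funB; [exact: (FC k).1|exact: gr.1].
  + by move=> k; apply: measurable_funB; [exact: (FS k).1|exact: gi.1].
  + move=> k; apply: measurable_funB.
      exact: (sq_integrable_fourier (TL _ (FL k))).2.1.
    by apply: measurable_funD; apply: measurable_funM => //; [exact: gr.1|exact: gi.1].
  + move=> k t; rewrite TSF//.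
    have -> : b t * fourier_cos (F k) t + a t * fourier_sin (F k) t - (b t * g_cos t + a t * g_sin t) =
      b t * (fourier_cos (F k) t - g_cos t) + a t * (fourier_sin (F k) t - g_sin t) by ring.
    exact: sqb.
Qed.

End fourier_L2.

(** * Translation differences and convolutions as multipliers *)

Section multipliers.
Context {R : realType} {n : nat}.
Local Notation mu := (lebesgue_rV R n).
Local Notation rV := 'rV[R]_n.
Implicit Types (f g F K : rV -> R) (h t : rV) (B : R).

Lemma sq_integrable_difference f h : sq_integrable mu f ->
  sq_integrable mu (fun x => f (x + h) - f x).
Proof. by move=> fi; apply: sq_integrableB => //; exact: sq_integrable_translate. Qed.

Lemma integral_difference_le g h : sq_integrable mu g ->
  (\int[mu]_x ((g (x + h) - g x) ^+ 2)%:E <= 4%:E * \int[mu]_x (g x ^+ 2)%:E)%E.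
Proof.
move=> gi; have ghi := sq_integrable_translate h gi.
have [mg g2] := gi; have [mgh gh2] := ghi.
rewrite -(EFin_Rintegral g2) -EFinM -EFin_Rintegral; last exact: (sq_integrable_difference h gi).2.
rewrite lee_fin.
have -> : 4 * \int[mu]_x g x ^+ 2 = \int[mu]_x (2 * g (x + h) ^+ 2 + 2 * g x ^+ 2).
  rewrite RintegralD//; [|exact: integrableZR|exact: integrableZR].
  rewrite !RintegralZl// (@Rintegral_translate _ _ h (fun x => g x ^+ 2)); last exact: measurable_funX.
  by ring.
apply: le_Rintegral => //; first exact: (sq_integrable_difference h gi).2.
  by apply: integrableDR; exact: integrableZR.
by move=> x _; have := sqr_ge0 (g (x + h) + g x); nra.
Qed.

(** With the positive sign in the exponent of the transform, the translation multiplies it by e^(-2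
    pi i h.t); the two formulas are its real and imaginary parts. *)
Lemma fourier_translate F h t : mu.-integrable setT (EFin \o F) ->
  fourier_cos (fun x => F (x + h)) t =
    cos (2 * pi * dotp h t) * fourier_cos F t + sin (2 * pi * dotp h t) * fourier_sin F t /\
  fourier_sin (fun x => F (x + h)) t =
    cos (2 * pi * dotp h t) * fourier_sin F t - sin (2 * pi * dotp h t) * fourier_cos F t.
Proof.
move=> Fi; have Ci := integrable_cosM t Fi; have Si := integrable_sinM t Fi.
set c := cos (2 * pi * dotp h t); set s := sin (2 * pi * dotp h t).
have cC := integrableZR c Ci; have sC := integrableZR s Ci.
have cS := integrableZR c Si; have sS := integrableZR s Si.
have e x : 2 * pi * dotp x t = 2 * pi * dotp (x + h) t - 2 * pi * dotp h t.
  by rewrite dotpDl; ring.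
split.
  rewrite /fourier_cos /fourier_sin -!RintegralZl// -RintegralD//.
  rewrite -[RHS](@Rintegral_translate _ _ h); last exact: integrable_measurable (integrableDR cC sS).
  by apply: eq_Rintegral => x _; rewrite {1}e cosB -/c -/s; ring.
rewrite /fourier_cos /fourier_sin -!RintegralZl// -RintegralB//.
rewrite -[RHS](@Rintegral_translate _ _ h); last exact: integrable_measurable (integrableBR cS sC).
by apply: eq_Rintegral => x _; rewrite {1}e sinB -/c -/s; ring.
Qed.

Lemma is_FT_difference f g_cos g_sin h : is_FT f g_cos g_sin ->
  \int[mu]_x (f (x + h) - f x) ^+ 2 =
  \int[mu]_t ((2 - 2 * cos (2 * pi * dotp h t)) * (g_cos t ^+ 2 + g_sin t ^+ 2)).
Proof.
move=> FTf; have [fi _ _ _] := FTf.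
pose T F (x : rV) := F (x + h) - F x.
(* a + i b = e^(-2 pi i h.t) - 1, of squared modulus 2 - 2 cos(2 pi h.t). *)
pose a t := cos (2 * pi * dotp h t) - 1; pose b t := - sin (2 * pi * dotp h t).
have c1 t := normr_cos_le1 (2 * pi * dotp h t); have s1 t := normr_sin_le1 (2 * pi * dotp h t).
have mcos : measurable_fun setT (fun t => cos (2 * pi * dotp h t)).
  exact: (measurableT_comp measurable_cos_phase (pair1_measurable h)).
have msin : measurable_fun setT (fun t => sin (2 * pi * dotp h t)).
  exact: (measurableT_comp measurable_sin_phase (pair1_measurable h)).
have FT : is_FT (T f) (fun t => a t * g_cos t - b t * g_sin t) (fun t => b t * g_cos t + a t * g_sin t).
  (* 4 is the L2 bound of [integral_difference_le], and 2 bounds both |a| and |b|. *)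
  apply: (@is_FT_multiplier _ _ T 4 2) => //.
  - exact: measurable_funB.
  - exact: measurableT_comp.
  - move=> t; apply: le_trans (ler_normB _ _) _; rewrite normr1.
    by rewrite [leRHS](_ : 2 = 1 + 1) ?lerD2r//; ring.
  - by move=> t; rewrite normrN (le_trans (s1 t))// ler1n.
  - move=> F [Fi F2]; split; last exact: sq_integrable_difference.
    by apply: integrableBR => //; exact: integrable_translate.
  - exact: sq_integrable_difference.
  - move=> F [Fi F2].
    have := integral_difference_le h (sq_integrableB F2 fi).
    rewrite (_ : (\int[mu]_x ((T F x - T f x) ^+ 2)%:E)%E =
        \int[mu]_x ((F (x + h) - f (x + h) - (F x - f x)) ^+ 2)%:E)%E//.
    by apply: eq_integral => x _; rewrite /T; congr (_ ^+ 2)%:E; ring.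
  - move=> F t [Fi F2]; have Fh := integrable_cosM t (integrable_translate h Fi).
    rewrite {1}/fourier_cos; under eq_Rintegral do rewrite mulrBr.
    rewrite RintegralB//; last exact: integrable_cosM.
    by rewrite -/(fourier_cos (fun x => F (x + h)) t) (fourier_translate h t Fi).1 /a /b /fourier_cos; ring.
  - move=> F t [Fi F2]; have Fh := integrable_sinM t (integrable_translate h Fi).
    rewrite {1}/fourier_sin; under eq_Rintegral do rewrite mulrBr.
    rewrite RintegralB//; last exact: integrable_sinM.
    by rewrite -/(fourier_sin (fun x => F (x + h)) t) (fourier_translate h t Fi).2 /a /b /fourier_sin; ring.
rewrite (plancherel FT); apply: eq_Rintegral => t _; rewrite /a /b.
have := cos2Dsin2 (2 * pi * dotp h t).
set c := cos _; set s := sin _ => cs.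
have -> : 2 - 2 * c = (c - 1) ^+ 2 + s ^+ 2.
  by have -> : s ^+ 2 = 1 - c ^+ 2 by [rewrite -cs addrC addKr]; ring.
by ring.
Qed.

Definition conv K F (x : rV) : R := \int[mu]_t (F t * K (x - t)).

Lemma integrable_convM B K g x : mu.-integrable setT (EFin \o K) -> (forall t, `|K t| <= B) ->
  sq_integrable mu g -> mu.-integrable setT (EFin \o (fun t => g t * K (x - t))).
Proof.
move=> Ki KB gi; apply: sq_integrableM => //; apply: sq_integrable_reflect.
exact: (sq_integrable_bounded (integrable_measurable Ki) KB Ki).
Qed.

Lemma measurable_conv K g : measurable_fun setT K -> measurable_fun setT g ->
  measurable_fun setT (conv K g).
Proof.
move=> mK mg; apply: (@measurable_Rintegral1 _ _ _ _ _ mu (fun p : rV * rV => g p.2 * K (p.1 - p.2))).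
by apply: measurable_funM; [exact: measurableT_comp mg measurable_snd|exact: measurable_diff].
Qed.

(** Cauchy-Schwarz in the form of a quadratic polynomial in [s] that stays nonnegative. *)
Lemma discriminant_le (I J m : R) : 0 <= m -> 0 <= J ->
  (forall s, 0 <= J - 2 * s * I + s ^+ 2 * m) -> I ^+ 2 <= m * J.
Proof.
move=> m0 J0 H; have [m_eq0|m_neq0] := eqVneq m 0.
  rewrite m_eq0 mul0r; have [->|I0] := eqVneq I 0; first by rewrite expr0n.
  (* If m = 0 and I != 0 the polynomial is affine, and this [s] gives it the value -1. *)
  have := H ((J + 1) / (2 * I)); rewrite m_eq0 mulr0 addr0.
  have -> : 2 * ((J + 1) / (2 * I)) * I = J + 1 by field.
  by lra.
have mp : 0 < m by rewrite lt0r m_neq0.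
have := H (I / m); have -> : J - 2 * (I / m) * I + (I / m) ^+ 2 * m = (m * J - I ^+ 2) / m.
  by field.
by rewrite pmulr_lge0 ?invr_gt0// subr_ge0.
Qed.

(** Cauchy-Schwarz for the weight |K (x - t)|: the nonnegative quadratic polynomial is the integral
    of (g - s sgn K)^2 |K|. *)
Lemma conv_sq_le B K g x : mu.-integrable setT (EFin \o K) -> (forall t, `|K t| <= B) ->
  sq_integrable mu g ->
  conv K g x ^+ 2 <= (\int[mu]_t `|K t|) * \int[mu]_t (g t ^+ 2 * `|K (x - t)|).
Proof.
move=> Ki KB gi; have KgI := integrable_convM x Ki KB gi.
have nKi : mu.-integrable setT (EFin \o (fun t => `|K t|)) by exact: integrable_norm.
have nKx := integrable_reflect x nKi.
have [mg g2] := gi.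
have Ji : mu.-integrable setT (EFin \o (fun t => g t ^+ 2 * `|K (x - t)|)).
  apply: (integrableMR (C := B) _ _ g2); last by move=> t; rewrite normr_id.
  exact: integrable_measurable nKx.
apply: discriminant_le; [exact: Rintegral_ge0| |].
  by apply: Rintegral_ge0 => t _; rewrite mulr_ge0 ?sqr_ge0.
move=> s; have i1 := integrableZR (2 * s) KgI; have i2 := integrableZR (s ^+ 2) nKx.
have <- : \int[mu]_t (g t ^+ 2 * `|K (x - t)| - 2 * s * (g t * K (x - t)) + s ^+ 2 * `|K (x - t)|) =
    \int[mu]_t (g t ^+ 2 * `|K (x - t)|) - 2 * s * conv K g x + s ^+ 2 * \int[mu]_t `|K t|.
  rewrite RintegralD//; last exact: integrableBR.
  rewrite RintegralB// !RintegralZl//; congr (_ + _ * _).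
  by rewrite (@Rintegral_reflect _ _ x (fun t => `|K t|))//; exact: integrable_measurable nKi.
apply: Rintegral_ge0 => t _.
have [K0|K0] := leP 0 (K (x - t)).
  rewrite ger0_norm// (_ : _ + _ = K (x - t) * (g t - s) ^+ 2); last by ring.
  by rewrite mulr_ge0// sqr_ge0.
rewrite ltr0_norm// (_ : _ + _ = - K (x - t) * (g t + s) ^+ 2); last by ring.
by rewrite mulr_ge0 ?sqr_ge0// oppr_ge0 ltW.
Qed.

(** Young's inequality for L1 and L2, by integrating [conv_sq_le] with Tonelli. The bound [B] makes
    K square integrable too, so the convolution integral converges at every point. *)
Lemma conv_L2_le B K g : mu.-integrable setT (EFin \o K) -> (forall t, `|K t| <= B) ->
  sq_integrable mu g ->
  (\int[mu]_x (conv K g x ^+ 2)%:E <=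
    ((\int[mu]_t `|K t|) ^+ 2)%:E * \int[mu]_x (g x ^+ 2)%:E)%E.
Proof.
move=> Ki KB gi; have [mg g2] := gi.
have nKi : mu.-integrable setT (EFin \o (fun t => `|K t|)) by exact: integrable_norm.
have mK := integrable_measurable Ki; have mnK := integrable_measurable nKi.
set m := \int[mu]_t `|K t|; have m0 : 0 <= m by exact: Rintegral_ge0.
have Ji x : mu.-integrable setT (EFin \o (fun t => g t ^+ 2 * `|K (x - t)|)).
  apply: (integrableMR (C := B) _ _ g2); last by move=> t; rewrite normr_id.
  exact: integrable_measurable (integrable_reflect x nKi).
have mJ : measurable_fun setT (fun p : rV * rV => g p.2 ^+ 2 * `|K (p.1 - p.2)|).
  apply: measurable_funM; last exact: (measurable_diff mnK).
  by apply: measurable_funX; exact: measurableT_comp mg measurable_snd.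
have mJ1 : measurable_fun setT (fun x : rV => \int[mu]_t (g t ^+ 2 * `|K (x - t)|)).
  exact: (@measurable_Rintegral1 _ _ _ _ _ mu (fun p : rV * rV => g p.2 ^+ 2 * `|K (p.1 - p.2)|)).
apply: (@le_trans _ _ (\int[mu]_x (m * \int[mu]_t (g t ^+ 2 * `|K (x - t)|))%:E)%E).
  apply: ge0_le_integral => //.
  - by move=> x _; rewrite lee_fin sqr_ge0.
  - by apply/measurable_EFinP/measurable_funX; exact: measurable_conv.
  - by apply/measurable_EFinP/measurable_funM.
  - by move=> x _; rewrite lee_fin; exact: conv_sq_le KB _.
under eq_integral do rewrite EFinM.
rewrite ge0_integralZl//.
2: exact/measurable_EFinP.
2: by move=> x _; rewrite lee_fin; apply: Rintegral_ge0 => t _; rewrite mulr_ge0 ?sqr_ge0.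
under eq_integral do rewrite (EFin_Rintegral (Ji _)).
rewrite (@conv_mass2 R n (fun x => g x ^+ 2) (fun x => `|K x|))//.
- by rewrite -(EFin_Rintegral nKi) -/m [X in (_ * X)%E]muleC muleA -EFinM expr2.
- exact: measurable_funX.
- by move=> x; exact: sqr_ge0.
Qed.

(** Fubini reduces the transform of the convolution to that of a translate of [K]; the formulas are
    the real and imaginary parts of a complex product. *)
Lemma fourier_conv B K F t : mu.-integrable setT (EFin \o K) -> (forall t, `|K t| <= B) ->
  L1L2 F ->
  fourier_cos (conv K F) t = fourier_cos K t * fourier_cos F t - fourier_sin K t * fourier_sin F t /\
  fourier_sin (conv K F) t = fourier_sin K t * fourier_cos F t + fourier_cos K t * fourier_sin F t.
Proof.
move=> Ki KB [Fi F2]; have hi := integrable_conv2 Fi Ki.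
have Ci := integrable_cosM t Fi; have Si := integrable_sinM t Fi.
have cC := integrableZR (fourier_cos K t) Ci; have sS := integrableZR (fourier_sin K t) Si.
have sC := integrableZR (fourier_sin K t) Ci; have cS := integrableZR (fourier_cos K t) Si.
have tr y := fourier_translate (- y) t Ki.
have dN y : 2 * pi * dotp (- y) t = - (2 * pi * dotp y t) by rewrite dotpNl mulrN.
have Kc y : mu.-integrable setT (EFin \o (fun x => cos (2 * pi * dotp x t) * K (x - y))).
  exact/integrable_cosM/integrable_translate.
have Ks y : mu.-integrable setT (EFin \o (fun x => sin (2 * pi * dotp x t) * K (x - y))).
  exact/integrable_sinM/integrable_translate.
split.
  have mc : measurable_fun setT (fun p : rV * rV => cos (2 * pi * dotp p.1 t)).
    exact: measurableT_comp (measurable_cos_phase1 t) measurable_fst.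
  have := RFubini (integrableMR mc (fun p => normr_cos_le1 _) hi).
  rewrite [RHS](_ : _ = fourier_cos K t * fourier_cos F t - fourier_sin K t * fourier_sin F t).
    move=> <-; apply: eq_Rintegral => x _ /=; rewrite mulrC -RintegralZr//.
    exact: integrable_convM KB F2.
  rewrite {2}/fourier_cos {2}/fourier_sin -!RintegralZl// -RintegralB//.
  apply: eq_Rintegral => y _ /=.
  transitivity (F y * fourier_cos (fun x => K (x + - y)) t).
    by rewrite -RintegralZl//; apply: eq_Rintegral => x _; ring.
  by rewrite (tr y).1 dN cosN sinN; ring.
have ms : measurable_fun setT (fun p : rV * rV => sin (2 * pi * dotp p.1 t)).
  exact: measurableT_comp (measurable_sin_phase1 t) measurable_fst.
have := RFubini (integrableMR ms (fun p => normr_sin_le1 _) hi).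
rewrite [RHS](_ : _ = fourier_sin K t * fourier_cos F t + fourier_cos K t * fourier_sin F t).
  move=> <-; apply: eq_Rintegral => x _ /=; rewrite mulrC -RintegralZr//.
  exact: integrable_convM KB F2.
rewrite {1}/fourier_cos {2}/fourier_sin -!RintegralZl// -RintegralD//.
apply: eq_Rintegral => y _ /=.
transitivity (F y * fourier_sin (fun x => K (x + - y)) t).
  by rewrite -RintegralZl//; apply: eq_Rintegral => x _; ring.
by rewrite (tr y).2 dN cosN sinN; ring.
Qed.

Lemma sq_integrable_conv B K g : mu.-integrable setT (EFin \o K) -> (forall t, `|K t| <= B) ->
  sq_integrable mu g -> sq_integrable mu (conv K g).
Proof.
move=> Ki KB gi; apply: sq_integrable_lty.
  exact: measurable_conv (integrable_measurable Ki) gi.1.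
apply: le_lt_trans (conv_L2_le Ki KB gi) _.
by rewrite -(EFin_Rintegral gi.2) -EFinM ltry.
Qed.

Lemma is_FT_conv B K f g_cos g_sin : mu.-integrable setT (EFin \o K) ->
  (forall t, `|K t| <= B) -> is_FT f g_cos g_sin ->
  \int[mu]_x conv K f x ^+ 2 =
  \int[mu]_t (fourier_sq K t * (g_cos t ^+ 2 + g_sin t ^+ 2)).
Proof.
move=> Ki KB FTf; have [fi _ _ _] := FTf; have mK := integrable_measurable Ki.
have FT : is_FT (conv K f) (fun t => fourier_cos K t * g_cos t - fourier_sin K t * g_sin t)
    (fun t => fourier_sin K t * g_cos t + fourier_cos K t * g_sin t).
  apply: (@is_FT_multiplier _ _ (conv K) ((\int[mu]_t `|K t|) ^+ 2) (\int[mu]_t `|K t|)) => //.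
  - exact: sqr_ge0.
  - exact: measurable_fourier_cos.
  - exact: measurable_fourier_sin.
  - by move=> t; exact: fourier_cos_le.
  - by move=> t; exact: fourier_sin_le.
  - move=> F [Fi F2]; split; last exact: sq_integrable_conv KB F2.
    exact: (RFubini1 (integrable_conv2 Fi Ki)).1.
  - exact: sq_integrable_conv KB fi.
  - move=> F [Fi F2]; have := conv_L2_le Ki KB (sq_integrableB F2 fi).
    rewrite (_ : (\int[mu]_x (conv K (fun x => F x - f x)%R x ^+ 2)%:E)%E =
        \int[mu]_x ((conv K F x - conv K f x) ^+ 2)%:E)%E//.
    apply: eq_integral => x _; congr (_ ^+ 2)%:E.
    rewrite /conv -RintegralB//; [|exact: integrable_convM KB F2|exact: integrable_convM KB fi].
    by apply: eq_Rintegral => t _; ring.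
  - by move=> F t FL; rewrite (fourier_conv t Ki KB FL).1.
  - by move=> F t FL; rewrite (fourier_conv t Ki KB FL).2.
rewrite (plancherel FT); apply: eq_Rintegral => t _; rewrite /fourier_sq; ring.
Qed.

End multipliers.

(** * The gradient of the Poisson integral *)

Lemma sum_option (V : nmodType) (I : finType) (F : option I -> V) :
  \sum_j F j = F None + \sum_i F (Some i).
Proof.
rewrite (bigD1 None)//; congr (_ + _).
rewrite (reindex_omap Some id) => [|[]//]; apply: eq_bigl => i.
by rewrite /= eqxx.
Qed.

Section riesz_kernels.
Context {R : realType} {n : nat}.
Local Notation mu := (lebesgue_rV R n).
Local Notation rV := 'rV[R]_n.
Implicit Types (p q : rV * R) (i j : option 'I_n).

(* Following [direction], [None] is the coordinate y and [Some k] is x_k. *)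
Definition zcoord j p : R := if j is Some k then p.1 0 k else p.2.

Definition rad p : R := radius p.2 p.1.

Definition rkern j p : R := zcoord j p * rad p ^- n.+1.

(* The partial derivative of [rkern j] in direction [i]. *)
Definition drkern i j p : R :=
  (i == j)%:R * rad p ^- n.+1 - n.+1%:R * (zcoord i p * zcoord j p) * rad p ^- n.+3.

Lemma zcoordD j p q : zcoord j (p + q) = zcoord j p + zcoord j q.
Proof. by case: j => [k|]; rewrite /= ?mxE. Qed.

Lemma zcoord_direction i j (h : R) : zcoord j (h *: direction i) = h * (i == j)%:R.
Proof.
case: i j => [k|] [l|] /=; rewrite ?mxE ?scaler0 //= ?mulr0 //.
by rewrite eq_sym.
Qed.

Lemma rad_sqr p : rad p ^+ 2 = \sum_j zcoord j p ^+ 2.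
Proof.
rewrite /rad radius_sqr sum_option; congr (_ + _).
Qed.

Lemma rad_sqrD p i (h : R) :
  rad (p + h *: direction i) ^+ 2 = rad p ^+ 2 + 2 * h * zcoord i p + h ^+ 2.
Proof.
rewrite !rad_sqr (bigD1 i)//= [in RHS](bigD1 i)//= zcoordD zcoord_direction eqxx mulr1.
rewrite (eq_bigr (fun j => zcoord j p ^+ 2)); first by ring.
by move=> j ji; rewrite zcoordD zcoord_direction eq_sym (negbTE ji) mulr0 addr0.
Qed.

Lemma rad_ge0 p : 0 <= rad p. Proof. exact: sqrtr_ge0. Qed.

Lemma rad_gt0 p : half_space p -> 0 < rad p.
Proof. exact: radius_gt0. Qed.

Lemma zcoord_le j p : `|zcoord j p| <= rad p.
Proof.
rewrite -(@ler_pXn2r _ 2%N) ?nnegrE ?rad_ge0// real_normK ?num_real// rad_sqr (bigD1 j)//=.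
by rewrite lerDl sumr_ge0// => k _; exact: sqr_ge0.
Qed.

Lemma is_derive_rkern i j p (h : R) : half_space (p + h *: direction i) ->
  is_derive h 1 (fun s : R => rkern j (p + s *: direction i))
    (drkern i j (p + h *: direction i)).
Proof.
move=> hs; set q := p + h *: direction i.
have r0 : 0 < rad q by exact: rad_gt0.
(* Along the line the squared radius is a quadratic polynomial in [s], so the radius is
   differentiated as the square root of a polynomial. *)
pose S (s : R) := rad p ^+ 2 + zcoord i p * (2 * s) + s * s.
have SE s : rad (p + s *: direction i) = Num.sqrt (S s).
  have -> : S s = rad (p + s *: direction i) ^+ 2 by rewrite rad_sqrD /S; ring.
  by rewrite sqrtr_sqr ger0_norm ?rad_ge0.
have S0 : 0 < S h by rewrite -sqrtr_gt0 -SE.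
have zE : zcoord i q = zcoord i p + h by rewrite zcoordD zcoord_direction eqxx mulr1.
have dS : is_derive h 1 S (2 * zcoord i q).
  by apply: is_derive_eq; rewrite /GRing.scale/= zE; ring.
have dR : is_derive h 1 (fun s => Num.sqrt (S s)) (zcoord i q / rad q).
  have := is_derive1_comp (is_derive1_sqrt S0) dS.
  by rewrite -SE -/q (_ : _ * _ = zcoord i q / rad q)//; field; exact: lt0r_neq0.
have rn0 : Num.sqrt (S h) ^+ n.+1 != 0 by rewrite -SE expf_neq0// gt_eqF.
have dX := is_deriveX n.+1 dR; rewrite exprfctE in dX.
have dV := @is_deriveV R (fun s => Num.sqrt (S s) ^+ n.+1) _ _ _ rn0 dX.
rewrite (_ : (fun s => _) = (fun s : R => (zcoord j p + (i == j)%:R * s) * (Num.sqrt (S s) ^+ n.+1)^-1)).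
  have zjE : zcoord j q = zcoord j p + h * (i == j)%:R by rewrite zcoordD zcoord_direction.
  apply: is_derive_eq; rewrite /GRing.scale/= -SE -/q /drkern zjE !exprS.
  move: (rad q) r0 (i == j)%:R (zcoord i q) => r r0 d z.
  have rn : r ^+ n != 0 by rewrite expf_neq0// gt_eqF.
  by move: (r ^+ n) rn => rn rn_neq0; field; rewrite rn_neq0 gt_eqF.
by apply/funext => s; rewrite /rkern SE zcoordD zcoord_direction [s * _]mulrC.
Qed.

(** Both terms have order -(n+1), because |z_i z_j| <= |z|^2; the first contributes 1 to the
    constant and the second n+1. *)
Lemma drkern_le i j p : half_space p -> `|drkern i j p| <= n.+2%:R * rad p ^- n.+1.
Proof.
move=> hp; have r0 := rad_gt0 hp; have rn0 : 0 < rad p ^- n.+1 by rewrite invr_gt0 exprn_gt0.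
apply: le_trans (ler_normB _ _) _; rewrite -[n.+2%:R]natr1 mulrDl mul1r addrC; apply: lerD.
  rewrite !normrM [X in _ * X]ger0_norm ?invr_ge0 ?exprn_ge0 ?(ltW r0)// normr_nat.
  rewrite -mulrA ler_wpM2l// (_ : rad p ^- n.+1 = rad p * rad p * rad p ^- n.+3); last first.
    by rewrite !exprS; field; rewrite expf_neq0 gt_eqF.
  by rewrite ler_wpM2r ?invr_ge0 ?exprn_ge0 ?(ltW r0)// ler_pM// zcoord_le.
rewrite normrM normr_nat [X in _ * X]ger0_norm ?(ltW rn0)// -[leRHS]mul1r ler_wpM2r ?(ltW rn0)//.
by case: (_ == _).
Qed.

Lemma half_space_shift i p (h : R) : `|h| < p.2 -> half_space (p + h *: direction i).
Proof.
rewrite ltr_norml => /andP[h1 h2]; rewrite /half_space /=.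
by case: i => [k|] /=; rewrite /GRing.scale/= ?mulr0 ?mulr1; lra.
Qed.

Lemma rad_shift i p (h : R) : half_space p -> `|h| <= p.2 / 2 ->
  rad p / 2 <= rad (p + h *: direction i).
Proof.
move=> hp hh; have r0 := rad_gt0 hp; have := zcoord_le None p.
have := zcoord_le i p; rewrite /= ler_norml => /andP[z1 z2].
rewrite (ger0_norm (ltW hp)) => y1.
rewrite -(@ler_pXn2r _ 2%N) ?nnegrE ?rad_ge0 ?divr_ge0 ?rad_ge0// rad_sqrD.
move: hh; rewrite ler_norml => /andP[h1 h2].
have hz : - (`|h| * rad p) <= h * zcoord i p.
  by rewrite lerNl -mulrN; apply: le_trans (ler_norm _) _; rewrite normrM normrN ler_wpM2l// zcoord_le.
have : `|h| <= rad p / 2 by rewrite (@le_trans _ _ (p.2 / 2))// ?ler_norml ?h1//; lra.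
by rewrite -[h ^+ 2]real_normK ?num_real//; move: (`|h|) hz (normr_ge0 h) => a; nra.
Qed.

Lemma drkern_shift_le i j p (h : R) : half_space p -> `|h| <= p.2 / 2 ->
  `|drkern i j (p + h *: direction i)| <= n.+2%:R * 2 ^+ n.+1 * rad p ^- n.+1.
Proof.
move=> hp hh; have r0 := rad_gt0 hp.
have hs : half_space (p + h *: direction i).
  by apply: half_space_shift; apply: le_lt_trans hh _; move: hp; rewrite /half_space/=; lra.
apply: le_trans (drkern_le _ _ hs) _; rewrite -mulrA ler_wpM2l//.
have -> : 2 ^+ n.+1 * rad p ^- n.+1 = (rad p / 2) ^- n.+1 by rewrite exprMn invfM mulrC exprVn invrK.
by rewrite lef_pV2 ?posrE ?exprn_gt0 ?rad_gt0 ?divr_gt0// lerXn2r ?nnegrE ?rad_ge0 ?rad_shift// divr_ge0// rad_ge0.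
Qed.

Lemma measurable_zcoord j : measurable_fun setT (zcoord j : rV * R -> R).
Proof.
case: j => [k|] /=; last exact: measurable_snd.
exact: measurableT_comp (measurable_coord _ _) measurable_fst.
Qed.

Lemma measurable_rad_exp (k : nat) : measurable_fun setT (fun p : rV * R => rad p ^- k).
Proof.
apply: measurable_funVR; apply: measurable_funX.
apply: measurableT_comp; first by apply: continuous_measurable_fun; exact: sqrt_continuous.
apply: measurable_funD; first by apply: measurable_funX; exact: measurable_snd.
exact: measurableT_comp measurable_dotpp measurable_fst.
Qed.

Lemma measurable_rkern j : measurable_fun setT (rkern j : rV * R -> R).
Proof. by apply: measurable_funM; [exact: measurable_zcoord|exact: measurable_rad_exp]. Qed.

Lemma measurable_drkern i j : measurable_fun setT (drkern i j : rV * R -> R).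
Proof.
apply: measurable_funB; apply: measurable_funM => //; try exact: measurable_rad_exp.
by apply: measurable_funM => //; apply: measurable_funM; exact: measurable_zcoord.
Qed.

End riesz_kernels.

(** * Differentiation of potentials under the integral sign *)

Section leibniz.
Context {R : realType} {n : nat}.
Local Notation mu := (lebesgue_rV R n).
Local Notation rV := 'rV[R]_n.
Implicit Types (g : rV -> R) (p : rV * R) (i j : option 'I_n).

Definition at_height (t : rV) p : rV * R := (p.1 - t, p.2).

Lemma at_heightD t p i (h : R) : at_height t (p + h *: direction i) = at_height t p + h *: direction i.
Proof. by rewrite /at_height; congr pair; rewrite /= addrAC. Qed.

Definition potential j g p : R := \int[mu]_t (g t * rkern j (at_height t p)).

Definition dpotential i j g p : R := \int[mu]_t (g t * drkern i j (at_height t p)).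

(** The common ground of square-integrable functions and bounded waves: [kern] dominates every
    [drkern i j], so this is what differentiation under the integral requires. *)
Definition admissible g := measurable_fun setT g /\ forall p, half_space p ->
  mu.-integrable setT (EFin \o (fun t => g t * kern p.2 (p.1 - t))).

Lemma measurable_at_height p : measurable_fun setT (at_height ^~ p).
Proof. by apply: measurable_fun_pair => //; exact: measurable_rVB. Qed.

Lemma integrable_drkernM i j g p : admissible g -> half_space p ->
  mu.-integrable setT (EFin \o (fun t => g t * drkern i j (at_height t p))).
Proof.
move=> [mg gk] hp.
have gkn : mu.-integrable setT (EFin \o (fun t => `|g t * kern p.2 (p.1 - t)|)).
  by apply: integrable_norm => //; exact: gk.
apply: le_integrableR (integrableZR n.+2%:R gkn).
- apply: measurable_funM => //; exact: measurableT_comp (measurable_drkern i j) (measurable_at_height p).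
- move=> t; rewrite !normrM mulrCA ler_wpM2l// [X in _ * X]ger0_norm ?kern_ge0//.
  exact: (@drkern_le R n i j (at_height t p)).
Qed.

(** Convergence of the potential itself is a separate hypothesis: for a spatial index [rkern j]
    decays like |t|^-n only, one order less than [kern], whereas its derivatives decay like
    [kern]. *)
Lemma is_derive_potential i j g p : admissible g -> half_space p ->
  (forall q, half_space q -> mu.-integrable setT (EFin \o (fun t => g t * rkern j (at_height t q)))) ->
  is_derive (0 : R) 1 (fun h : R => potential j g (p + h *: direction i)) (dpotential i j g p).
Proof.
move=> ga hp gr; have [mg gk] := ga; have p0 : 0 < p.2 by [].
pose f (h : R) t := g t * rkern j (at_height t (p + h *: direction i)).
pose d := p.2 / 2.
have d0 : 0 < d by rewrite divr_gt0.
have I0 : `](- d), d[%classic (0 : R) by rewrite /= in_itv/= oppr_lt0 d0.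
have Id (h : R) : `](- d), d[%classic h -> `|h| <= d.
  by rewrite /= in_itv/= => /andP[h1 h2]; rewrite ler_norml !ltW.
have hh (h : R) t : `](- d), d[%classic h -> half_space (at_height t p + h *: direction i).
  by move=> /Id hd; apply: half_space_shift; apply: le_lt_trans hd _; rewrite /d /=; lra.
have I1 (h : R) : `](- d), d[%classic h -> mu.-integrable setT (EFin \o f h).
  by move=> /hh; move=> /(_ 0) H; apply: gr; move: H; rewrite -at_heightD.
have df (h : R) t : `](- d), d[%classic h ->
    is_derive h 1 (f ^~ t) (g t * drkern i j (at_height t p + h *: direction i)).
  move=> Ih; rewrite /f; under eq_fun do rewrite at_heightD.
  have dr := is_derive_rkern j (hh _ t Ih).
  by apply: is_derive_eq; rewrite /GRing.scale/=.
have I2 (h : R) t : `](- d), d[%classic h -> [set: rV] t -> derivable (f ^~ t) h 1.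
  by move=> Ih _; have [] := df h t Ih.
pose G t := n.+2%:R * 2 ^+ n.+1 * `|g t * kern p.2 (p.1 - t)|.
have G0 t : 0 <= G t by rewrite mulr_ge0// mulr_ge0.
have Gi : mu.-integrable setT (EFin \o G).
  by apply: integrableZR; apply: integrable_norm => //; exact: gk.
have p1 (h : R) t : `](- d), d[%classic h ->
    partial1of2 f h t = g t * drkern i j (at_height t p + h *: direction i).
  by move=> Ih; rewrite partial1of2E; apply: derive_val; exact: df.
have I3 (h : R) t : `](- d), d[%classic h -> [set: rV] t -> `|partial1of2 f h t| <= G t.
  move=> Ih _; rewrite p1// /G !normrM mulrCA ler_wpM2l// [X in _ * X]ger0_norm ?kern_ge0//.
  by apply: drkern_shift_le => //; exact: Id.
apply: DeriveDef.
  exact: (derivable_under_integral measurableT I0 I1 I2 G0 Gi I3).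
rewrite -derive1E (differentiation_under_integral measurableT I0 I1 I2 G0 Gi I3).
by apply: eq_Rintegral => t _; rewrite p1// scale0r addr0.
Qed.

Lemma is_derive_line (V W : normedModType R) (f : V -> W) (p v : V) (l : W) :
  is_derive (0 : R) 1 (fun h : R => f (p + h *: v)) l -> is_derive p v f l.
Proof.
have e : (fun h : R => h^-1 *: (((fun h : R => f (p + h *: v)) \o shift 0) (h *: 1) - f (p + 0 *: v))) =
    (fun h : R => h^-1 *: ((f \o shift p) (h *: v) - f p)).
  apply/funext => h /=; rewrite addr0 scale0r addr0 /GRing.scale/= mulr1.
  by rewrite [p + _]addrC.
by case=> fd dl; split; [move: fd; rewrite /derivable e|move: dl; rewrite /derive e].
Qed.

Lemma near_half_space p : half_space p -> \forall q \near p, half_space q.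
Proof.
move=> hp.
have h : (nbhs p) (snd @^-1` [set y : R | 0 < y]).
  by apply: (@cvg_snd _ _ (nbhs p.1) (nbhs p.2) _); exact: (lt_nbhsr hp).
exact: h.
Qed.

Lemma partial_potential i j g p : admissible g -> half_space p ->
  (forall q, half_space q -> mu.-integrable setT (EFin \o (fun t => g t * rkern j (at_height t q)))) ->
  is_derive p (direction i) (potential j g) (dpotential i j g p).
Proof. by move=> ga hp gr; apply: is_derive_line; exact: is_derive_potential. Qed.

End leibniz.

(** * Transforms of the derivatives of the Poisson kernel *)

Section riesz_fourier.
Context {R : realType} {n : nat}.
Hypothesis n0 : (0 < n)%N.
Local Notation mu := (lebesgue_rV R n).
Local Notation rV := 'rV[R]_n.
Implicit Types (g : rV -> R) (p : rV * R) (i j : option 'I_n).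

Lemma admissible_bounded (C : R) g : measurable_fun setT g -> (forall t, `|g t| <= C) -> admissible g.
Proof.
move=> mg gC; split=> // p hp.
have ki := integrable_reflect p.1 (integrable_kern n0 hp).
by have := integrableMR mg gC ki; under [X in EFin \o X]eq_fun do rewrite mulrC.
Qed.

Lemma integrable_rkern_None g p : admissible g -> half_space p ->
  mu.-integrable setT (EFin \o (fun t => g t * rkern None (at_height t p))).
Proof.
move=> [mg gk] hp; have := integrableZR p.2 (gk p hp).
by under [X in EFin \o X]eq_fun do rewrite mulrCA.
Qed.

(** Plane waves have an explicit Poisson extension. The phases 0 and pi / 2 give the cosine and sine
    integrals, so one computation covers both parts of a transform. *)
Definition wave (xi : rV) (q : R) (t : rV) : R := cos (2 * pi * dotp t xi + q).

(* The integral over R^n of y / (y^2 + |x|^2)^((n+1)/2), for every y > 0. *)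
Definition poisson_const : R := Num.sqrt pi ^+ n.+1 / pow_gauss_integral n.

Lemma measurable_wave xi q : measurable_fun setT (wave xi q).
Proof.
apply: (@measurableT_comp _ _ _ _ _ _ (@cos R)).
  by apply: continuous_measurable_fun; exact: continuous_cos.
by apply: measurable_funD => //; apply: measurable_funM => //; exact: measurable_dotpl.
Qed.

Lemma admissible_wave xi q : admissible (wave xi q).
Proof. by apply: (admissible_bounded (measurable_wave xi q)) => t; exact: normr_cos_le1. Qed.

(** After the reflection of the variable about [p.1] the wave splits by the addition formula; the
    sine part is odd and vanishes, and the cosine part is [kern_cos]. *)
Lemma potential_wave xi q p : half_space p ->
  potential None (wave xi q) p =
  poisson_const * (wave xi q p.1 * expR (- (2 * pi * enorm xi * p.2))).
Proof.
move=> hp; have ki := integrable_kern n0 hp.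
have kc := integrable_cosM xi ki; have ks := integrable_sinM xi ki.
pose A := 2 * pi * dotp p.1 xi + q.
pose h z := p.2 * (cos A * (cos (2 * pi * dotp z xi) * kern p.2 z) +
  sin A * (sin (2 * pi * dotp z xi) * kern p.2 z)).
have i1 := integrableZR (cos A) kc; have i2 := integrableZR (sin A) ks.
have mh : measurable_fun setT h by exact: integrable_measurable (integrableZR p.2 (integrableDR i1 i2)).
have -> : potential None (wave xi q) p = \int[mu]_t h (p.1 - t).
  apply: eq_Rintegral => t _; rewrite /h /rkern /wave /=.
  have -> : 2 * pi * dotp t xi + q = A - 2 * pi * dotp (p.1 - t) xi by rewrite /A dotpBl; ring.
  by rewrite cosB; rewrite -[rad _ ^- _]/(kern p.2 (p.1 - t)); ring.
rewrite (Rintegral_reflect p.1 mh) RintegralZl//; last exact: integrableDR.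
rewrite RintegralD// !RintegralZl//.
have -> : \int[mu]_z (sin (2 * pi * dotp z xi) * kern p.2 z) = 0.
  apply: Rintegral_odd => //; first exact: integrable_measurable ks.
  move=> t; rewrite dotpNl mulrN sinN mulNr.
  by have -> : kern p.2 (- t) = kern p.2 t by rewrite /kern /radius dotpNl dotpC dotpNl opprK.
have -> : \int[mu]_z (cos (2 * pi * dotp z xi) * kern p.2 z) =
    Num.sqrt pi ^+ n.+1 / (pow_gauss_integral n * p.2) * expR (- (2 * pi * enorm xi * p.2)).
  by rewrite -kern_cos//; apply: eq_Rintegral => z _; rewrite mulrC.
rewrite /wave -/A /poisson_const; field.
by rewrite !gt_eqF ?pow_gauss_integral_gt0.
Qed.

(** Two evaluations of one derivative: under the integral sign, and on the closed form of
    [potential_wave], which holds in a neighbourhood of the point. *)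
Lemma dpotential_wave i xi q (y : R) : 0 < y ->
  dpotential i None (wave xi q) (0, y) =
  - (2 * pi) * poisson_const * expR (- (2 * pi * enorm xi * y)) *
    (if i is Some k then sin q * xi 0 k else cos q * enorm xi).
Proof.
move=> y0; have hp : @half_space R n (0, y) by [].
have h1 := @partial_potential R n i None _ (0, y) (admissible_wave xi q) hp
  (fun q hq => integrable_rkern_None (admissible_wave xi _) hq).
pose E p := poisson_const * (wave xi q p.1 * expR (- (2 * pi * enorm xi * p.2))).
have h2 : is_derive ((0, y) : rV * R) (direction i) E (dpotential i None (wave xi q) (0, y)).
  apply: near_eq_is_derive h1; near=> p'; apply: potential_wave.
  by near: p'; exact: near_half_space.
rewrite -(derive_val (is_derive := h2)).
apply: derive_val; apply: is_derive_line.
case: i {h1 h2} => [k|] /=.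
- have -> : (fun h : R => E ((0, y) + h *: (delta_mx 0 k, 0))) = (fun h : R =>
      poisson_const * expR (- (2 * pi * enorm xi * y)) * cos (2 * pi * xi 0 k * h + q)).
    apply/funext => h; rewrite /E /wave /= add0r scaler0 addr0.
    have -> : dotp (h *: delta_mx 0 k : rV) xi = h * xi 0 k.
      rewrite /dotp (bigD1 k)//= big1 ?addr0 => [|l lk]; first by rewrite !mxE !eqxx mulr1.
      by rewrite !mxE (negbTE lk) andbF mulr0 mul0r.
    by rewrite mulrA [h * _]mulrC mulrA [in RHS]mulrAC.
  have dm : is_derive (0 : R) 1 (fun h : R => 2 * pi * xi 0 k * h + q) (2 * pi * xi 0 k).
    by apply: is_derive_eq; rewrite /GRing.scale/=; ring.
  have dc := is_derive1_comp (is_derive_cos _) dm.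
  by apply: is_derive_eq; rewrite /GRing.scale/= mulr0 add0r; ring.
- have -> : (fun h : R => E ((0, y) + h *: (0, 1))) = (fun h : R =>
      poisson_const * cos q * expR (- (2 * pi * enorm xi) * (y + h))).
    apply/funext => h; rewrite /E /wave /= add0r scaler0.
    have -> : dotp (0 : rV) xi = 0 by rewrite -(subrr (0 : rV)) dotpBl subrr.
    by rewrite mulr0 add0r mulrA mulNr /GRing.scale/= mulr1.
  have dm : is_derive (0 : R) 1 (fun h : R => - (2 * pi * enorm xi) * (y + h)) (- (2 * pi * enorm xi)).
    by apply: is_derive_eq; rewrite /GRing.scale/=; ring.
  have de := is_derive1_comp (is_derive_expR _) dm.
  by apply: is_derive_eq; rewrite /GRing.scale/= addr0 !mulNr; ring.
Unshelve. all: by end_near.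
Qed.

(** The cosine and sine integrals of the kernel are, after reflection, the values above the origin
    of the differentiated potentials of the waves with phases 0 and pi / 2. *)
Lemma fourier_drkern i (xi : rV) (y : R) : 0 < y ->
  fourier_sq (fun w => drkern i None (w, y)) xi =
  (2 * pi * poisson_const) ^+ 2 * expR (- (4 * pi * enorm xi * y)) *
    (if i is Some k then xi 0 k else enorm xi) ^+ 2.
Proof.
move=> y0; pose K (w : rV) := drkern i None (w, y).
have mK : measurable_fun setT K.
  exact: (measurableT_comp (measurable_drkern i None) (pair2_measurable y)).
have T q : \int[mu]_z (cos (q - 2 * pi * dotp z xi) * K z) = dpotential i None (wave xi q) (0, y).
  pose h z := cos (q - 2 * pi * dotp z xi) * K z.
  have mh : measurable_fun setT h.
    apply: measurable_funM mK; apply: (@measurableT_comp _ _ _ _ _ _ (@cos R)).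
      by apply: continuous_measurable_fun; exact: continuous_cos.
    by apply: measurable_funB => //; apply: measurable_funM => //; exact: measurable_dotpl.
  rewrite -(Rintegral_reflect 0 mh); apply: eq_Rintegral => t _.
  by rewrite /h /wave /at_height /K /= sub0r dotpNl mulrN opprK addrC.
have FC : fourier_cos K xi = dpotential i None (wave xi 0) (0, y).
  by rewrite -T; apply: eq_Rintegral => z _; rewrite sub0r cosN.
have FS : fourier_sin K xi = dpotential i None (wave xi (pi / 2)) (0, y).
  by rewrite -T; apply: eq_Rintegral => z _; rewrite cosB sin_pihalf cos_pihalf mul0r mul1r add0r.
rewrite /fourier_sq -/K FC FS !dpotential_wave// sin_pihalf cos_pihalf sin0 cos0.
have -> : expR (- (4 * pi * enorm xi * y)) = expR (- (2 * pi * enorm xi * y)) ^+ 2.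
  by rewrite expr2 -expRD; congr expR; ring.
by case: i {K mK T FC FS} => [k|]; ring.
Qed.

(** The normal derivative contributes as much as all the tangential ones together, whence the factor
    2. *)
Lemma sum_fourier_drkern (xi : rV) (y : R) : 0 < y ->
  \sum_i fourier_sq (fun w => drkern i None (w, y)) xi =
  2 * (2 * pi * poisson_const * enorm xi) ^+ 2 * expR (- (4 * pi * enorm xi * y)).
Proof.
move=> y0; under eq_bigr do rewrite fourier_drkern//.
rewrite -mulr_sumr sum_option.
have -> : \sum_k xi 0 k ^+ 2 = enorm xi ^+ 2.
  by rewrite enorm_sqr; apply: eq_bigr => k _; rewrite expr2.
by ring.
Qed.

End riesz_fourier.

(** * The energy at a fixed height *)

Section slice_energy.
Context {R : realType} {n : nat}.
Hypothesis n0 : (0 < n)%N.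
Local Notation mu := (lebesgue_rV R n).
Local Notation rV := 'rV[R]_n.
Implicit Types (f g : rV -> R) (p : rV * R) (i j : option 'I_n).

Lemma rad_height p : half_space p -> p.2 <= rad p.
Proof. by move=> hp; have := zcoord_le None p; rewrite ger0_norm// ltW. Qed.

Lemma rad_exp_le (k : nat) p : half_space p -> rad p ^- k <= p.2 ^- k.
Proof.
move=> hp; have r0 := rad_gt0 hp; have y0 : 0 < p.2 by [].
by rewrite lef_pV2 ?posrE ?exprn_gt0// lerXn2r ?nnegrE ?rad_ge0 ?rad_height// ltW.
Qed.

(* Uses n >= 1: the square decays like |w|^(-2n). *)
Lemma sq_integrable_rkern j (y : R) : 0 < y ->
  sq_integrable mu (fun w => rkern j (w, y)).
Proof.
move=> y0; have mr : measurable_fun setT (fun w => rkern j (w, y)).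
  exact: (measurableT_comp (measurable_rkern j) (pair2_measurable y)).
split=> //; apply: le_integrableR (integrableZR (y ^- n.-1) (integrable_kern n0 y0)).
  exact: measurable_funX.
move=> w; have hw : half_space (w, y) by [].
have r0 := rad_gt0 hw.
rewrite ger0_norm ?sqr_ge0// /rkern exprMn.
apply: (@le_trans _ _ (rad (w, y) ^+ 2 * (rad (w, y) ^- n.+1) ^+ 2)).
  by rewrite ler_wpM2r ?sqr_ge0// -real_normK ?num_real// lerXn2r ?nnegrE ?rad_ge0// zcoord_le.
have -> : rad (w, y) ^+ 2 * (rad (w, y) ^- n.+1) ^+ 2 = rad (w, y) ^- n.-1 * rad (w, y) ^- n.+1.
  move: (rad (w, y)) r0 => r r0; rewrite -(prednK n0) /= !exprS.
  have rn : r ^+ n.-1 != 0 by rewrite expf_neq0// gt_eqF.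
  by move: (r ^+ n.-1) rn => rn rn_neq0; field; rewrite rn_neq0 gt_eqF.
by rewrite ler_wpM2r ?kern_ge0//; exact: rad_exp_le hw.
Qed.

Lemma integrable_rkernM j g p : sq_integrable mu g -> half_space p ->
  mu.-integrable setT (EFin \o (fun t => g t * rkern j (at_height t p))).
Proof.
move=> gi hp; apply: sq_integrableM => //.
exact: (sq_integrable_reflect p.1 (sq_integrable_rkern j hp)).
Qed.

Lemma sq_integrable_kern (y : R) : 0 < y -> sq_integrable mu (kern y).
Proof.
move=> y0; apply: (sq_integrable_bounded (C := y ^- n.+1)) (measurable_kern y) _ (integrable_kern n0 y0).
by move=> w; rewrite ger0_norm ?kern_ge0//; exact: (@rad_exp_le n.+1 (w, y)).
Qed.

Lemma admissible_L2 g : sq_integrable mu g -> admissible g.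
Proof.
move=> gi; split=> [|p hp]; first exact: gi.1.
by apply: sq_integrableM => //; apply: sq_integrable_reflect; exact: sq_integrable_kern.
Qed.

Lemma measurable_drkern1 i j (y : R) : measurable_fun setT (fun w : rV => drkern i j (w, y)).
Proof. exact: (measurableT_comp (measurable_drkern i j) (pair2_measurable y)). Qed.

Lemma integrable_drkern i j (y : R) : 0 < y ->
  mu.-integrable setT (EFin \o (fun w => drkern i j (w, y))).
Proof.
move=> y0; apply: le_integrableR (integrableZR n.+2%:R (integrable_kern n0 y0)).
  exact: measurable_drkern1.
by move=> w; exact: (@drkern_le R n i j (w, y)).
Qed.

Lemma drkern_bounded i j (y : R) (w : rV) : 0 < y -> `|drkern i j (w, y)| <= n.+2%:R * y ^- n.+1.
Proof.
move=> y0; apply: le_trans (@drkern_le R n i j (w, y) y0) _.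
by rewrite ler_wpM2l//; exact: (@rad_exp_le n.+1 (w, y)).
Qed.

(** At fixed height each partial derivative of the potential is, by definition, the convolution of
    [f] with a bounded integrable kernel, so the multiplier form of Plancherel applies to each and
    the sum is taken on the Fourier side. *)
Lemma slice_energy f g_cos g_sin (y : R) : is_FT f g_cos g_sin -> 0 < y ->
  (\int[mu]_x (\sum_i dpotential i None f (x, y) ^+ 2)%R%:E =
   \int[mu]_t (2 * (2 * pi * @poisson_const R n * enorm t) ^+ 2 * expR (- (4 * pi * enorm t * y)) *
     (g_cos t ^+ 2 + g_sin t ^+ 2))%R%:E)%E.
Proof.
move=> FTf y0; have [fi ri si _] := FTf.
pose K i (w : rV) := drkern i None (w, y).
have KE i x : dpotential i None f (x, y) = conv (K i) f x by [].
have Ki i := integrable_drkern i None y0.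
have KB i w := drkern_bounded i None w y0.
have ci i : sq_integrable mu (conv (K i) f) := sq_integrable_conv (Ki i) (KB i) fi.
have gi := integrableDR ri.2 si.2.
have fsi i : mu.-integrable setT (EFin \o (fun t => fourier_sq (K i) t * (g_cos t ^+ 2 + g_sin t ^+ 2))).
  have := integrableMR (measurable_fourier_sq (measurable_drkern1 i None y)) (fun t => fourier_sq_le t (Ki i)) gi.
  by under [X in EFin \o X]eq_fun do rewrite mulrC.
under eq_integral do rewrite -sumEFin.
rewrite ge0_integral_sum//; last 2 first.
- by move=> i; apply/measurable_EFinP/measurable_funX; exact: (ci i).1.
- by move=> i x _; rewrite lee_fin sqr_ge0.
under eq_bigr do rewrite -(EFin_Rintegral (ci _).2) (is_FT_conv (Ki _) (KB _) FTf) (EFin_Rintegral (fsi _)).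
rewrite -ge0_integral_sum//; last 2 first.
- by move=> i; apply/measurable_EFinP; exact: integrable_measurable (fsi i).
- by move=> i x _; rewrite lee_fin mulr_ge0 ?fourier_sq_ge0// addr_ge0 ?sqr_ge0.
apply: eq_integral => t _; rewrite sumEFin; congr EFin.
by rewrite -mulr_suml (sum_fourier_drkern n0).
Qed.

End slice_energy.

(** * The normalizing constant and the partial derivatives of u and v_k *)

Section boundary.
Context {R : realType} {n : nat}.
Hypothesis n0 : (0 < n)%N.
Local Notation mu := (lebesgue_rV R n).
Local Notation rV := 'rV[R]_n.
Implicit Types (f : rV -> R) (u : rV * R -> R) (p : rV * R) (i j : option 'I_n).

Definition normalization : R := 2 / sphere_area n.

(** The Gamma value in [sphere_area] is the same integral [pow_gauss_integral n] as in
    [poisson_const], and the powers of pi agree. *)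
Lemma normalizationK : normalization * @poisson_const R n = 1.
Proof.
have J0 := @pow_gauss_integral_gt0 R n; have p0 := @pi_gt0 R.
have S0 : 0 < Num.sqrt pi ^+ n.+1 :> R by rewrite exprn_gt0// sqrt_pi_gt0.
have -> : normalization = 2 / (2 * Num.sqrt pi ^+ n.+1 / pow_gauss_integral n).
  rewrite /normalization /sphere_area Gamma_half.
  rewrite -[X in X `^ _](sqr_sqrtr (ltW p0)) -powR_mulrn ?sqrtr_ge0// -powRrM.
  by rewrite mulrCA mulfV// mulr1 powR_mulrn// sqrtr_ge0.
rewrite /poisson_const; field.
by rewrite !gt_eqF.
Qed.

Lemma powR_rad p : (p.2 ^+ 2 + enorm p.1 ^+ 2) `^ (n.+1%:R / 2) = rad p ^+ n.+1.
Proof.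
rewrite enorm_sqr -radius_sqr -/(rad p) -powR_mulrn ?rad_ge0// -powRrM.
by rewrite mulrCA mulfV// mulr1 powR_mulrn// rad_ge0.
Qed.

Lemma poisson_integralE f p : poisson_integral f p = normalization * potential None f p.
Proof.
congr (_ * _); apply: eq_Rintegral => t _.
by rewrite (powR_rad (p.1 - t, p.2)) /rkern mulrC.
Qed.

(** The sign comes from t - x in the conjugate kernel against x - t in the potential; moving it out
    of the integral uses convergence. *)
Lemma conjugate_poisson_integralE f k p : sq_integrable mu f -> half_space p ->
  conjugate_poisson_integral f k p = - normalization * potential (Some k) f p.
Proof.
move=> fi hp; rewrite /conjugate_poisson_integral mulNr -mulrN -mulN1r /potential -[X in _ = _ * X]RintegralZl//; last first.
  exact: integrable_rkernM.
congr (_ * _); apply: eq_Rintegral => t _.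
have -> : enorm (t - p.1) = enorm (p.1 - t).
  by rewrite /enorm -opprB dotpNl dotpC dotpNl opprK.
rewrite (powR_rad (p.1 - t, p.2)) /rkern /= !mxE /at_height; ring.
Qed.

Section gradient.
Variables (u : rV * R -> R) (f : rV -> R).
Hypothesis uf : boundary_function u f.

Let fi : sq_integrable mu f. Proof. exact: Lfun2_sq_integrable uf.1. Qed.

Lemma is_derive_dpotential i j p : half_space p ->
  is_derive p (direction i) (potential j f) (dpotential i j f p).
Proof.
move=> hp; apply: partial_potential => //; first exact: admissible_L2.
by move=> q hq; exact: integrable_rkernM.
Qed.

Lemma partial_u i p : half_space p -> partial i u p = normalization * dpotential i None f p.
Proof.
move=> hp.
have d := is_derive_dpotential i None hp.
have dc : is_derive p (direction i) (fun q => normalization * potential None f q)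
    (normalization * dpotential i None f p).
  exact: is_deriveZ.
rewrite /partial; transitivity ('D_(direction i) (fun q => normalization * potential None f q) p).
  apply: near_eq_derive; near=> q; rewrite uf.2 ?poisson_integralE//.
  by near: q; exact: near_half_space.
exact: derive_val.
Unshelve. all: by end_near.
Qed.

Lemma partial_conjugate i k p : half_space p ->
  partial i (conjugate_poisson_integral f k) p = - (normalization * dpotential i (Some k) f p).
Proof.
move=> hp; have d := is_derive_dpotential i (Some k) hp.
have dc : is_derive p (direction i) (fun q => - normalization * potential (Some k) f q)
    (- normalization * dpotential i (Some k) f p).
  exact: is_deriveZ.
rewrite /partial -mulNr.
transitivity ('D_(direction i) (fun q => - normalization * potential (Some k) f q) p).
  apply: near_eq_derive; near=> q; apply: conjugate_poisson_integralE => //.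
  by near: q; exact: near_half_space.
exact: derive_val.
Unshelve. all: by end_near.
Qed.

End gradient.
End boundary.

(** * The Clifford-valued gradient *)

Section clifford_paravectors.
Context {R : realType} {n : nat}.
Local Notation cl := (@clifford R n).
Implicit Types (x y z : cl) (A : {set 'I_n}) (b : 'I_n -> R).

(** Scalar part plus vector part: the form of F, of its partial derivatives and of Dbar F, but not
    of the individual products e_k times a derivative. *)
Definition paravector (a : R) b : cl := cl_scalar a + \sum_k b k *: cl_gen k.

Lemma paravector_scalar a b : paravector a b finset.set0 = a.
Proof.
rewrite ffunE ffunE eqxx sum_ffunE big1 ?addr0// => k _; rewrite !ffunE.
suff -> : (finset.set0 == [set k]%SET) = false by rewrite scaler0.
by apply/negbTE/eqP => /setP/(_ k); rewrite !inE eqxx.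
Qed.

Lemma paravector_gen a b k : paravector a b [set k]%SET = b k.
Proof.
rewrite ffunE ffunE sum_ffunE (bigD1 k)//= big1 ?addr0 => [|l lk]; rewrite !ffunE.
  rewrite eqxx [X in if X then _ else _](_ : _ = false) ?add0r /GRing.scale/= ?mulr1//.
  by apply/negbTE/eqP => /setP/(_ k); rewrite !inE eqxx.
suff -> : ([set k]%SET == [set l]%SET) = false by rewrite scaler0.
by apply/negbTE/eqP => /setP/(_ k); rewrite !inE eqxx eq_sym (negbTE lk).
Qed.

Lemma paravector_other a b A : A != finset.set0 -> (forall k, A != [set k]%SET) ->
  paravector a b A = 0.
Proof.
move=> A0 A1; rewrite ffunE ffunE (negbTE A0) sum_ffunE big1 ?addr0// => k _.
by rewrite !ffunE (negbTE (A1 k)) scaler0.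
Qed.

Variant paravector_index_spec A : Prop :=
| ParavectorScalar of A = finset.set0
| ParavectorGen k of A = [set k]%SET
| ParavectorOther of A != finset.set0 & forall k, A != [set k]%SET.

Lemma paravector_index A : paravector_index_spec A.
Proof.
have [->|A0] := eqVneq A finset.set0; first exact: ParavectorScalar.
have [/existsP[k /eqP ->]|] := boolP [exists k, A == [set k]%SET]; first exact: ParavectorGen.
rewrite negb_exists => /forallP A1; exact: ParavectorOther.
Qed.

Lemma paravectorB a b a' b' :
  paravector a b - paravector a' b' = paravector (a - a') (fun k => b k - b' k).
Proof.
apply/ffunP => A; rewrite ffunE [X in _ + X]ffunE.
by case: (paravector_index A) => [->|k ->|A0 A1];
  rewrite ?paravector_scalar ?paravector_gen ?paravector_other// subrr.
Qed.

Lemma paravectorZ c a b : c *: paravector a b = paravector (c * a) (fun k => c * b k).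
Proof.
apply/ffunP => A; rewrite ffunE.
by case: (paravector_index A) => [->|k ->|A0 A1];
  rewrite ?paravector_scalar ?paravector_gen ?paravector_other// scaler0.
Qed.

Lemma cl_norm_paravector a b : cl_norm (paravector a b) ^+ 2 = a ^+ 2 + \sum_k b k ^+ 2.
Proof.
rewrite sqr_sqrtr; last by apply: sumr_ge0 => A _; exact: sqr_ge0.
have e A : `|paravector a b A| ^+ 2 =
    (A == finset.set0)%:R * a ^+ 2 + \sum_k (A == [set k]%SET)%:R * b k ^+ 2.
  rewrite real_normK ?num_real//; case: (paravector_index A) => [->|k ->|A0 A1].
  - rewrite paravector_scalar eqxx mul1r big1 ?addr0// => k _.
    suff -> : (finset.set0 == [set k]%SET) = false by rewrite mul0r.
    by apply/negbTE/eqP => /setP/(_ k); rewrite !inE eqxx.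
  - rewrite paravector_gen (bigD1 k)//= eqxx mul1r big1 ?addr0 => [|l lk].
      suff -> : ([set k]%SET == finset.set0) = false by rewrite mul0r add0r.
      by apply/negbTE/eqP => /setP/(_ k); rewrite !inE eqxx.
    suff -> : ([set k]%SET == [set l]%SET) = false by rewrite mul0r.
    by apply/negbTE/eqP => /setP/(_ k); rewrite !inE eqxx eq_sym (negbTE lk).
  - rewrite paravector_other// (negbTE A0) mul0r add0r expr0n big1// => k _.
    by rewrite (negbTE (A1 k)) mul0r.
under eq_bigr do rewrite e.
rewrite big_split/=; congr (_ + _).
  by rewrite (bigD1 finset.set0)//= eqxx mul1r big1 ?addr0// => A /negbTE ->; rewrite mul0r.
rewrite exchange_big; apply: eq_bigr => k _.
by rewrite (bigD1 [set k]%SET)//= eqxx mul1r big1 ?addr0// => A /negbTE ->; rewrite mul0r.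
Qed.

Lemma cl_mulD x y z : cl_mul x (y + z) = cl_mul x y + cl_mul x z.
Proof.
apply/ffunP => C; rewrite !ffunE -big_split; apply: eq_bigr => A _.
rewrite -big_split; apply: eq_bigr => B _ /=; rewrite ffunE; ring.
Qed.

Lemma cl_mulZ c x y : cl_mul x (c *: y) = c *: cl_mul x y.
Proof.
apply/ffunP => C; rewrite !ffunE scaler_sumr; apply: eq_bigr => A _.
rewrite scaler_sumr; apply: eq_bigr => B _ /=; rewrite ffunE /GRing.scale/=; ring.
Qed.

Lemma cl_mul0 x : cl_mul x 0 = 0.
Proof. by rewrite -[X in cl_mul x X](scale0r (0 : cl)) cl_mulZ scale0r. Qed.

Lemma cl_mul_sum x (F : 'I_n -> cl) : cl_mul x (\sum_k F k) = \sum_k cl_mul x (F k).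
Proof. by elim/big_rec2: _ => [|k y z _ <-]; rewrite ?cl_mul0// cl_mulD. Qed.

Lemma cl_mul_scalar (k : 'I_n) (a : R) : cl_mul (cl_gen k) (cl_scalar a) = a *: cl_gen k :> cl.
Proof.
apply/ffunP => C; rewrite ffunE [RHS]ffunE (bigD1 [set k]%SET)//= [X in _ + X]big1 ?addr0; last first.
  move=> A nA; apply: big1 => B _; by rewrite !ffunE (negbTE nA) mul0r mulr0.
rewrite big_mkcond (bigD1 finset.set0)//= [X in _ + X]big1 ?addr0; last first.
  by move=> B nB; case: ifP => // _; rewrite !ffunE (negbTE nB) !mulr0.
rewrite !ffunE !eqxx mul1r /symdiff finset.setD0 finset.set0D finset.setU0 eq_sym.
case: (C == _); rewrite ?scaler0 ?[1%:R]mulr1n//.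
rewrite /cl_sign (_ : [set ij | _]%SET = finset.set0); last first.
  by apply/setP => ij; rewrite !inE andbF.
by rewrite finset.cards0 expr0 mul1r /GRing.scale/= mulr1.
Qed.

Lemma cl_scalarZ (a b : R) : a *: cl_scalar b = cl_scalar (a * b) :> cl.
Proof. by apply/ffunP => A; rewrite !ffunE; case: ifP => _; rewrite ?scaler0. Qed.

Lemma cl_scalarD (a b : R) : cl_scalar a + cl_scalar b = cl_scalar (a + b) :> cl.
Proof. by apply/ffunP => A; rewrite !ffunE; case: ifP => _; rewrite ?addr0. Qed.

Lemma cl_scalar0 : cl_scalar 0 = 0 :> cl.
Proof. by apply/ffunP => A; rewrite !ffunE if_same. Qed.

Lemma cl_scalar_sum b : \sum_k cl_scalar (b k) = cl_scalar (\sum_k b k) :> cl.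
Proof.
by elim/big_rec2: _ => [|k x y _ ->]; rewrite ?cl_scalar0// cl_scalarD.
Qed.

(* The bivectors cancel because m is symmetric. *)
Lemma cl_symmetric_form (m : 'I_n -> 'I_n -> R) : (forall k l, m k l = m l k) ->
  \sum_k \sum_l m k l *: cl_mul (cl_gen k) (cl_gen l) = cl_scalar (- \sum_k m k k) :> cl.
Proof.
(* Doubling the sum pairs the index (k, l) with (l, k), where the anticommutation relation
   applies. *)
move=> ms; set X := LHS; set Y := RHS; suff XY : X + X = Y + Y.
  apply/ffunP => A; have := congr1 (fun z : cl => z A) XY; rewrite ffunE [X in _ = X -> _]ffunE => e.
  have e2 : 2 * (X A : R) = 2 * (Y A : R) by rewrite !mulr_natl.
  exact: (mulfI _ e2).
have {2}-> : X = \sum_k \sum_l m k l *: cl_mul (cl_gen l) (cl_gen k).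
  rewrite /X exchange_big; apply: eq_bigr => k _; apply: eq_bigr => l _.
  by rewrite ms.
rewrite /X /Y cl_scalarD -big_split/= (eq_bigr (fun k => cl_scalar (- 2 * m k k))).
  by rewrite cl_scalar_sum -mulr_sumr; congr cl_scalar; ring.
move=> k _; rewrite -big_split/= (bigD1 k)//= big1 ?addr0.
  by rewrite -scalerDr cl_mul_gen eqxx mulr1 cl_scalarZ mulrC.
by move=> l lk; rewrite -scalerDr cl_mul_gen eq_sym (negbTE lk) mulr0 cl_scalar0 scaler0.
Qed.

(* [m i j] stands for the [i]-th partial derivative of the [j]-th conjugate
   Poisson integral; symmetry and vanishing trace are the Cauchy-Riemann system. *)
Lemma cl_Dbar_symbol (m : option 'I_n -> option 'I_n -> R) :
  (forall i j, m i j = m j i) -> \sum_i m i i = 0 ->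
  2^-1 *: (paravector (m None None) (fun k => - m None (Some k)) -
     \sum_k cl_mul (cl_gen k) (paravector (m (Some k) None) (fun l => - m (Some k) (Some l)))) =
  paravector (m None None) (fun k => - m None (Some k)).
Proof.
move=> ms mt.
(* The Cauchy-Riemann system D F = 0 in disguise: the spatial part of the operator sends F to minus
   its y-derivative, so Dbar F is the y-derivative itself. *)
have -> : \sum_k cl_mul (cl_gen k) (paravector (m (Some k) None) (fun l => - m (Some k) (Some l))) =
    paravector (- m None None) (fun k => m None (Some k)).
  under eq_bigr do rewrite /paravector cl_mulD cl_mul_scalar cl_mul_sum.
  rewrite big_split/= addrC /paravector; congr (_ + _); last by apply: eq_bigr => k _; rewrite ms.
  under eq_bigr do under eq_bigr do rewrite cl_mulZ.
  rewrite cl_symmetric_form => [|k l]; last by rewrite ms.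
  by congr cl_scalar; rewrite sumrN opprK; move: mt; rewrite sum_option => /eqP; rewrite addrC addr_eq0 => /eqP.
rewrite paravectorB paravectorZ; congr paravector; first by field.
by apply/funext => k; field.
Qed.

End clifford_paravectors.

(** * Pointwise equality of |Dbar F| and |grad u| *)

Section monogenic_gradient.
Context {R : realType} {n : nat}.
Hypothesis n0 : (0 < n)%N.
Local Notation mu := (lebesgue_rV R n).
Local Notation rV := 'rV[R]_n.
Implicit Types (f : rV -> R) (p : rV * R) (i j : option 'I_n).

Lemma drkernC i j p : drkern i j p = drkern j i p.
Proof. by rewrite /drkern eq_sym [zcoord i p * _]mulrC. Qed.

(** The field z / |z|^(n+1) on R^(n+1) has divergence 0 away from the origin: the n+1 diagonal terms
    cancel against (n+1) |z|^2 / |z|^(n+3). *)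
Lemma drkern_trace p : half_space p -> \sum_i drkern i i p = 0.
Proof.
move=> hp; have r0 := rad_gt0 hp.
under eq_bigr do rewrite /drkern eqxx mul1r -expr2.
rewrite sumrB -mulr_suml -mulr_sumr -rad_sqr big_const card_option card_ord iter_addr_0 -mulr_natl.
move: (rad p) r0 => r r0; have rn : r ^+ n != 0 by rewrite expf_neq0// gt_eqF.
rewrite !exprS; move: (r ^+ n) rn => s s0; field.
by rewrite s0 gt_eqF.
Qed.

Lemma dpotential_trace f p : sq_integrable mu f -> half_space p -> \sum_i dpotential i i f p = 0.
Proof.
move=> fi hp; have fa := admissible_L2 n0 fi.
have di i := integrable_drkernM i i fa hp.
apply: EFin_inj; rewrite -sumEFin; under eq_bigr do rewrite (EFin_Rintegral (di _)).
rewrite -(integral_sum measurableT di) -[RHS](integral0 mu setT).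
apply: eq_integral => t _; rewrite sumEFin; congr EFin.
by rewrite -mulr_sumr drkern_trace// mulr0.
Qed.

Lemma cl_partial_paravector i (a : rV * R -> R) (b : 'I_n -> rV * R -> R) p :
  cl_partial i (fun q => paravector (a q) (b ^~ q)) p =
  paravector (partial i a p) (fun k => partial i (b k) p).
Proof.
apply/ffunP => A; rewrite ffunE; case: (paravector_index A) => [->|k ->|A0 A1].
- rewrite paravector_scalar; congr partial.
  by apply/funext => q; rewrite paravector_scalar.
- rewrite paravector_gen; congr partial.
  by apply/funext => q; rewrite paravector_gen.
- rewrite paravector_other//.
  have -> : (fun q => paravector (a q) (b ^~ q) A : R) = cst 0.
    by apply/funext => q; rewrite paravector_other.
  exact: derive_cst.
Qed.

(** By symmetry of [m], the components of Dbar F are the y-derivative of u and the opposites of its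
    x_k-derivatives. *)
Lemma cl_norm_Dbar (u : rV * R -> R) f p : boundary_function u f -> half_space p ->
  cl_norm (cl_Dbar (canonical_monogenic u f) p) ^+ 2 = \sum_i partial i u p ^+ 2.
Proof.
move=> uf hp; have fi := Lfun2_sq_integrable uf.1.
pose m i j := @normalization R n * dpotential i j f p.
have ms i j : m i j = m j i.
  by congr (_ * _); apply: eq_Rintegral => t _; rewrite drkernC.
have mt : \sum_i m i i = 0 by rewrite -mulr_sumr dpotential_trace// mulr0.
have PE i : cl_partial i (canonical_monogenic u f) p =
    paravector (m i None) (fun k => - m i (Some k)).
  rewrite /canonical_monogenic.
  rewrite (@cl_partial_paravector i u (conjugate_poisson_integral f)) (partial_u n0 uf)//.
  by congr paravector; apply/funext => k; rewrite (partial_conjugate n0 uf).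
rewrite /cl_Dbar PE; under eq_bigr do rewrite PE.
rewrite cl_Dbar_symbol// cl_norm_paravector sum_option (partial_u n0 uf)//.
by congr (_ + _); apply: eq_bigr => k _; rewrite sqrrN (partial_u n0 uf)// -/(m _ _) ms.
Qed.

End monogenic_gradient.

(** * The energy integrals *)

Section energy.
Context {R : realType} {n : nat}.
Hypothesis n0 : (0 < n)%N.
Local Notation leb := (@lebesgue_measure R).
Local Notation mu := (lebesgue_rV R n).
Local Notation rV := 'rV[R]_n.
Implicit Types (f : rV -> R) (p : rV * R) (i j : option 'I_n).

Lemma integral_expR_pos (b : R) : 0 < b ->
  (\int[leb]_y (\1_(`]0%R, +oo[%classic : set R) y * (b * expR (- (b * y))))%:E = 1)%E.
Proof.
move=> b0; rewrite -(integral_exponential_pdf b0).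
pose h (y : R) := b * expR (- b * y).
have mh : measurable_fun setT h.
  by apply: measurable_funM => //; apply: measurableT_comp.
have -> : (\int[leb]_y (exponential_pdf b y)%:E = \int[leb]_(y in `[0%R, +oo[) (h y)%:E)%E.
  rewrite [RHS]integral_mkcond; apply: eq_integral => y _.
  by rewrite /exponential_pdf !patchE; case: ifP.
rewrite -integral_itv_obnd_cbnd; last by apply/measurable_EFinP; exact: measurable_funS mh.
rewrite [RHS]integral_mkcond; apply: eq_integral => y _; rewrite patchE indicE /h /=.
by case: (y \in _); rewrite ?mul1r ?mulNr// mul0r.
Qed.

(** For r > 0 the weight is 2 pi r times the exponential density of rate 4 pi r; r = 0 is apart
    because a rate must be positive. *)
Lemma integral_energy_weight (r : R) : 0 <= r ->
  (\int[leb]_y (\1_(`]0%R, +oo[%classic : set R) y *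
     (2 * (2 * pi * r) ^+ 2 * expR (- (4 * pi * r * y))))%:E = (2 * pi * r)%:E)%E.
Proof.
rewrite le_eqVlt => /predU1P[<-|r0].
  under eq_integral do rewrite !(mulr0, mul0r) expr0n mulr0 mul0r mulr0.
  by rewrite integral0 mulr0.
have p0 := @pi_gt0 R.
have b0 : 0 < 4 * pi * r by rewrite !mulr_gt0.
transitivity ((2 * pi * r)%:E * \int[leb]_y (\1_(`]0%R, +oo[%classic : set R) y *
    (4 * pi * r * expR (- (4 * pi * r * y))))%:E)%E; last by rewrite integral_expR_pos// mule1.
rewrite -ge0_integralZl//.
- by apply: eq_integral => y _; rewrite -EFinM; congr EFin; ring.
- apply/measurable_EFinP; apply: measurable_funM; first exact: measurable_indic.
  by apply: measurable_funM => //; apply: measurableT_comp => //; apply: measurableT_comp => //; exact: measurable_funM.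
- by move=> y _; rewrite lee_fin mulr_ge0// mulr_ge0 ?expR_ge0// ltW.
- by rewrite lee_fin !mulr_ge0 ?ltW.
Qed.

Lemma measurable_dpotential i j f : measurable_fun setT f ->
  measurable_fun setT (dpotential i j f : rV * R -> R).
Proof.
move=> mf; apply: (@measurable_Rintegral1 _ _ _ _ _ mu
  (fun z : (rV * R) * rV => f z.2 * drkern i j (at_height z.2 z.1))).
apply: measurable_funM; first exact: measurableT_comp mf measurable_snd.
apply: measurableT_comp (measurable_drkern i j) _.
apply: measurable_fun_pair; last exact: measurableT_comp measurable_snd measurable_fst.
have m2 : measurable_fun setT (fun z : (rV * R) * rV => (z.1.1, z.2)).
  apply: measurable_fun_pair; last exact: measurable_snd.
  exact: measurableT_comp measurable_fst measurable_fst.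
exact: (measurableT_comp measurable_rV_sub m2).
Qed.

Lemma dirichlet_energy_FT (u : rV * R -> R) f g_cos g_sin :
  boundary_function u f -> is_FT f g_cos g_sin ->
  dirichlet_energy u =
  ((2 * pi)%:E * \int[mu]_t (enorm t * (g_cos t ^+ 2 + g_sin t ^+ 2)%R)%:E)%E.
Proof.
move=> uf FTf; have [fi ri si _] := FTf.
pose c : R := @normalization R n; pose D : set R := `]0%R, +oo[%classic.
pose H t := g_cos t ^+ 2 + g_sin t ^+ 2.
have H0 t : 0 <= H t by rewrite addr_ge0 ?sqr_ge0.
have mH : measurable_fun setT H.
  by apply: measurable_funD; apply: measurable_funX; [exact: ri.1|exact: si.1].
(* The indicator extends the integrand by 0 to the whole product, where Tonelli applies. *)
pose G p := \1_D p.2 * (c ^+ 2 * \sum_i dpotential i None f p ^+ 2).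
have mD : measurable_fun setT (\1_D : R -> R) by apply: measurable_indic; exact: measurable_itv.
have G0 p : 0 <= G p.
  by rewrite mulr_ge0// mulr_ge0 ?sqr_ge0// sumr_ge0// => i _; exact: sqr_ge0.
have mG : measurable_fun setT G.
  apply: measurable_funM; first exact: measurableT_comp mD measurable_snd.
  apply: measurable_funM => //; apply: measurable_sum => i.
  by apply: measurable_funX; apply: measurable_dpotential; exact: fi.1.
pose e (z : R * rV) := \1_D z.1 * (2 * (2 * pi * enorm z.2) ^+ 2 * expR (- (4 * pi * enorm z.2 * z.1))) * H z.2.
have e0 z : 0 <= e z by rewrite mulr_ge0// mulr_ge0// mulr_ge0 ?expR_ge0// mulr_ge0 ?sqr_ge0.
have Dy (y : R) : (\1_D y : R) = (0 < y)%R%:R.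
  by rewrite indicE /D; congr (nat_of_bool _)%:R; rewrite mem_setE in_itv/= andbT.
have mr : measurable_fun setT (fun z : R * rV => enorm z.2).
  exact: measurableT_comp (@measurable_enorm R n) measurable_snd.
have me : measurable_fun setT e.
  apply: measurable_funM; last exact: measurableT_comp mH measurable_snd.
  apply: measurable_funM; first exact: measurableT_comp mD measurable_fst.
  apply: measurable_funM.
    by apply: measurable_funM => //; apply: measurable_funX; exact: measurable_funM.
  apply: measurableT_comp => //; apply: measurableT_comp => //; apply: measurable_funM => //.
  exact: measurable_funM.
rewrite /dirichlet_energy integral_mkcond.
transitivity (\int[(mu \x leb)%E]_p (G p)%:E)%E.
  apply: eq_integral => p _; rewrite patchE /G Dy.
  have -> : (p \in half_space) = (0 < p.2) by apply/idP/idP; rewrite inE.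
  case: ifPn => [p0|]; last by rewrite mul0r.
  rewrite mul1r mulr_sumr; congr EFin; apply: eq_bigr => i _.
  by rewrite (partial_u n0 uf)// exprMn.
rewrite (@fubini_tonelli2 _ _ _ _ _ mu leb (EFin \o G))//.
2: exact/measurable_EFinP.
transitivity (\int[leb]_y \int[mu]_t (e (y, t))%:E)%E.
  apply: eq_integral => y _; rewrite /fubini_G /= /G /e /= Dy.
  have [y0|_] := ltP 0 y; last first.
    under eq_integral do rewrite mul0r.
    by under [in RHS]eq_integral do rewrite !mul0r; rewrite !integral0.
  under eq_integral do rewrite mul1r EFinM.
  rewrite ge0_integralZl//.
  2: by apply/measurable_EFinP; apply: measurable_sum => i; apply: measurable_funX;
     exact: (measurableT_comp (measurable_dpotential i None fi.1) (pair2_measurable y)).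
  2: by move=> x _; rewrite lee_fin sumr_ge0// => i _; exact: sqr_ge0.
  2: by rewrite lee_fin sqr_ge0.
  rewrite (slice_energy n0 FTf y0) -ge0_integralZl//.
  - apply: eq_integral => t _; rewrite -EFinM mul1r; congr EFin.
    (* The squares of the two constants meet here, one from [partial_u] and one from the transforms,
       and cancel. *)
    have cK : c * @poisson_const R n = 1 by exact: normalizationK.
    move: (@poisson_const R n) (expR _) cK => q E cK; rewrite -/(H t).
    transitivity (2 * (2 * pi * (c * q) * enorm t) ^+ 2 * E * H t); first by ring.
    by rewrite cK mulr1.
  - apply/measurable_EFinP; apply: measurable_funM mH; have me1 := @measurable_enorm R n.
    apply: measurable_funM.
      by apply: measurable_funM => //; apply: measurable_funX; exact: measurable_funM.
    apply: measurableT_comp => //; apply: measurableT_comp => //; apply: measurable_funM => //.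
    exact: measurable_funM.
  - move=> t _; rewrite lee_fin; apply: mulr_ge0 (H0 t).
    by rewrite mulr_ge0 ?expR_ge0// mulr_ge0 ?sqr_ge0.
  - by rewrite lee_fin sqr_ge0.
rewrite (@fubini_tonelli _ _ _ _ _ leb mu (EFin \o e))//.
2: exact/measurable_EFinP.
rewrite -ge0_integralZl//; last 3 first.
- by apply/measurable_EFinP; apply: measurable_funM => //; exact: measurable_enorm.
- by move=> t _; rewrite lee_fin; apply: mulr_ge0 (enorm_ge0 t) (H0 t).
- by rewrite lee_fin mulr_ge0// pi_ge0.
apply: eq_integral => t _; rewrite /e/=.
under eq_integral do rewrite mulrC EFinM.
rewrite ge0_integralZl//.
2: apply/measurable_EFinP; apply: measurable_funM => //; apply: measurable_funM => //;
   apply: measurableT_comp => //; apply: measurableT_comp => //; exact: measurable_funM.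
2: by move=> y _; rewrite lee_fin mulr_ge0// mulr_ge0 ?expR_ge0// mulr_ge0 ?sqr_ge0.
2: by rewrite lee_fin.
by rewrite integral_energy_weight ?enorm_ge0// -EFinM -EFinM; congr EFin; rewrite /H; ring.
Qed.

End energy.

(** * The double integral of differences *)

Section gagliardo.
Context {R : realType} {n : nat}.
Hypothesis n0 : (0 < n)%N.
Local Notation mu := (lebesgue_rV R n).
Local Notation rV := 'rV[R]_n.
Implicit Types (f : rV -> R).

(** Both bounds of the squeeze come from 1 + s <= e^s, with s = a y below and s = - a y above. *)
Lemma one_minus_expR_cvg (a : R) : 0 <= a ->
  (1 - expR (- (a * k.+1%:R^-1))) / k.+1%:R^-1 @[k --> \oo] --> a.
Proof.
move=> a0.
apply: (@squeeze_cvgr _ _ _ _ (fun k : nat => a / (1 + a * k.+1%:R^-1)) (fun=> a)).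
- apply: nearW => k; have y0 : 0 < k.+1%:R^-1 :> R by rewrite invr_gt0.
  move: (k.+1%:R^-1) y0 => y y0; have ay : 0 <= a * y by rewrite mulr_ge0// ltW.
  apply/andP; split; last first.
    by rewrite ler_pdivrMr// lerBlDr -lerBlDl; exact: expR_ge1Dx.
  rewrite ler_pdivlMr// expRN mulrAC -[leLHS]/(a * y / (1 + a * y)).
  have h := expR_ge1Dx (a * y); have p1 : 0 < 1 + a * y by lra.
  have -> : a * y / (1 + a * y) = 1 - (1 + a * y)^-1 by field; rewrite gt_eqF.
  by rewrite lerB// lef_pV2 ?posrE ?expR_gt0.
- have h : 1 + a * k.+1%:R^-1 @[k --> \oo] --> (1 : R).
    rewrite -[X in _ --> X](addr0 1) -[X in _ + X](mulr0 a).
    by apply: cvgD; [exact: cvg_cst|apply: cvgM; [exact: cvg_cst|exact: cvg_harmonic]].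
  rewrite -[X in _ --> X](divr1 a); apply: cvgM; first exact: cvg_cst.
  exact: cvgV.
- exact: cvg_cst.
Qed.

Lemma Rintegral_kern_cos (y : R) (t : rV) : 0 < y ->
  \int[mu]_h ((2 - 2 * cos (2 * pi * dotp h t)) * kern y h) =
  2 * @poisson_const R n * ((1 - expR (- (2 * pi * enorm t * y))) / y).
Proof.
move=> y0; have ki := integrable_kern n0 y0; have kc := integrable_cosM t ki.
have e h : (2 - 2 * cos (2 * pi * dotp h t)) * kern y h =
    2 * kern y h - 2 * (cos (2 * pi * dotp h t) * kern y h) by ring.
under eq_Rintegral do rewrite e.
rewrite RintegralB//; [|exact: integrableZR|exact: integrableZR].
rewrite !RintegralZl//.
have cE (s : rV) : \int[mu]_h (cos (2 * pi * dotp h s) * kern y h) =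
    @poisson_const R n / y * expR (- (2 * pi * enorm s * y)).
  transitivity (\int[mu]_h (kern y h * cos (2 * pi * dotp h s))).
    by apply: eq_Rintegral => h _; rewrite mulrC.
  by rewrite kern_cos// /poisson_const invfM !mulrA.
have -> : \int[mu]_h kern y h = @poisson_const R n / y.
  (* The mass of the kernel is its cosine transform at frequency 0. *)
  have d0 (h : rV) : dotp h 0 = 0 by rewrite dotpC -(subrr (0 : rV)) dotpBl subrr.
  have := cE 0; rewrite /enorm d0 sqrtr0 mulr0 mul0r oppr0 expR0 mulr1 => <-.
  by apply: eq_Rintegral => h _; rewrite d0 mulr0 cos0 mul1r.
by rewrite cE; field; rewrite gt_eqF.
Qed.

(* The kernels [kern y] increase to |h|^-(n+1) as y decreases to 0. *)
Lemma integral_one_minus_cos (t : rV) :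
  (\int[mu]_h ((2 - 2 * cos (2 * pi * dotp h t)) / enorm h ^+ n.+1)%:E =
   (2 * @poisson_const R n * (2 * pi * enorm t))%:E)%E.
Proof.
pose w (h : rV) := 2 - 2 * cos (2 * pi * dotp h t).
have w0 h : 0 <= w h by rewrite subr_ge0 -[leRHS]mulr1 ler_wpM2l// cos_le1.
have mw : measurable_fun setT w.
  by apply: measurable_funB => //; apply: measurable_funM => //; exact: measurable_cos_phase1.
pose y (k : nat) : R := k.+1%:R^-1.
have y0 k : 0 < y k by rewrite invr_gt0.
pose g (k : nat) h : \bar R := (w h * kern (y k) h)%:E.
have gcvg h : g k h @[k --> \oo] --> (w h / enorm h ^+ n.+1)%:E.
  apply: cvg_EFin; first exact: nearW.
  (* At h = 0 the kernels blow up, but the weight [w] is 0 there, and so is the limit function. *)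
  have [h0|h0] := eqVneq (dotp h h) 0.
    have hz : h = 0 by apply/eqP; rewrite -dotp_eq0 h0.
    have wz : w h = 0.
      by rewrite /w hz -(subrr (0 : rV)) dotpBl subrr mulr0 cos0 mulr1 subrr.
    rewrite wz mul0r; rewrite (_ : _ \o _ = fun=> 0); first exact: cvg_cst.
    by apply/funext => k; rewrite /g /= wz mul0r.
  apply: cvgM; first exact: cvg_cst.
  apply: cvgV; first by rewrite expf_neq0// sqrtr_eq0 -ltNge lt0r h0 dotp_ge0.
  have rc : radius (y k) h @[k --> \oo] --> enorm h.
    rewrite /radius /enorm -[X in _ --> Num.sqrt X]add0r; apply: continuous_cvg; first exact: sqrt_continuous.
    apply: cvgD; last exact: cvg_cst.
    by rewrite -(mulr0 0); apply: cvgM; exact: cvg_harmonic.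
  exact: (cvg_comp _ _ rc (@exprn_continuous R n.+1 (enorm h))).
have gk k : (\int[mu]_h g k h = (2 * @poisson_const R n * ((1 - expR (- (2 * pi * enorm t * y k))) / y k))%:E)%E.
  rewrite -Rintegral_kern_cos// EFin_Rintegral//.
  have w4 h : `|w h| <= 4.
    by rewrite ger0_norm ?w0// /w; have := cos_geN1 (2 * pi * dotp h t); lra.
  have := integrableMR mw w4 (integrable_kern n0 (y0 k)).
  by under [X in EFin \o X]eq_fun do rewrite mulrC.
have := @cvg_monotone_convergence _ _ _ mu setT measurableT g.
rewrite (_ : (fun x => limn _) = (fun h => (w h / enorm h ^+ n.+1)%:E)); last first.
  by apply/funext => h; apply/cvg_lim => //; exact: gcvg.
move=> mct; have {mct} : (\int[mu]_h g k h)%E @[k --> \oo] --> (\int[mu]_h (w h / enorm h ^+ n.+1)%:E)%E.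
  apply: mct.
  - by move=> k; apply/measurable_EFinP/measurable_funM => //; exact: measurable_kern.
  - by move=> k h _; rewrite lee_fin mulr_ge0// kern_ge0.
  move=> h _ i j ij; rewrite lee_fin ler_wpM2l//.
  rewrite /kern lef_pV2 ?posrE ?exprn_gt0 ?radius_gt0// lerXn2r ?nnegrE ?sqrtr_ge0//.
  rewrite ler_wsqrtr// lerD2r lerXn2r ?nnegrE ?(ltW (y0 _))//.
  by rewrite lef_pV2 ?posrE// ler_nat ltnS.
move=> mct; apply: (cvg_unique _ mct); first exact: ereal_hausdorff.
rewrite (funext gk); apply: cvg_EFin; first exact: nearW.
apply: cvgM; first exact: cvg_cst.
by apply: one_minus_expR_cvg; rewrite !mulr_ge0 ?enorm_ge0// ltW// pi_gt0.
Qed.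

End gagliardo.

Section fractional_seminorm.
Context {R : realType} {n : nat}.
Hypothesis n0 : (0 < n)%N.
Local Notation mu := (lebesgue_rV R n).
Local Notation rV := 'rV[R]_n.
Implicit Types (f : rV -> R).

(* Substitute t2 = t1 + h and exchange the integrals. *)
Lemma fractional_seminorm_FT f g_cos g_sin : is_FT f g_cos g_sin ->
  (\int[mu]_t1 \int[mu]_t2 (`|f t1 - f t2| ^+ 2 / enorm (t1 - t2) ^+ n.+1)%R%:E =
   (2 * @poisson_const R n * (2 * pi))%:E *
     \int[mu]_t (enorm t * (g_cos t ^+ 2 + g_sin t ^+ 2)%R)%:E)%E.
Proof.
move=> FTf; have [fi ri si _] := FTf; have mf := fi.1.
pose H t := g_cos t ^+ 2 + g_sin t ^+ 2.
have H0 t : 0 <= H t by rewrite addr_ge0 ?sqr_ge0.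
have Hi : mu.-integrable setT (EFin \o H) by exact: integrableDR ri.2 si.2.
have mH := integrable_measurable Hi.
pose v (h : rV) : R := enorm h ^- n.+1.
have v0 h : 0 <= v h by rewrite invr_ge0 exprn_ge0// enorm_ge0.
have mv : measurable_fun setT v.
  by apply: measurable_funVR; apply: measurable_funX; exact: measurable_enorm.
pose w (h t : rV) := 2 - 2 * cos (2 * pi * dotp h t).
have w0 h t : 0 <= w h t by rewrite subr_ge0 -[leRHS]mulr1 ler_wpM2l// cos_le1.
have w4 h t : `|w h t| <= 4.
  by rewrite ger0_norm ?w0// /w; have := cos_geN1 (2 * pi * dotp h t); lra.
have mw : measurable_fun setT (fun z : rV * rV => w z.1 z.2).
  by apply: measurable_funB => //; apply: measurable_funM => //; exact: measurable_cos_phase.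
pose q (z : rV * rV) := (f (z.1 + z.2) - f z.1) ^+ 2 * v z.2.
have mq : measurable_fun setT q.
  apply: measurable_funM; last exact: measurableT_comp mv measurable_snd.
  apply: measurable_funX; apply: measurable_funB; last exact: measurableT_comp mf measurable_fst.
  exact: measurableT_comp mf measurable_rV_add.
have q0 z : 0 <= q z by rewrite mulr_ge0 ?sqr_ge0.
transitivity (\int[mu]_x \int[mu]_h (q (x, h))%:E)%E.
  apply: eq_integral => x _.
  pose g (t : rV) := (`|f x - f t| ^+ 2 / enorm (x - t) ^+ n.+1)%:E.
  rewrite -[LHS]/(\int[mu]_t g t)%E -(integral_translate x (g := g)).
  - apply: eq_integral => h _; rewrite /g /q /v /= real_normK ?num_real//; congr EFin.
    rewrite [h + x]addrC -sqrrN opprB; congr (_ / _ ^+ _).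
    by rewrite /enorm opprD addrA subrr add0r dotpNl dotpC dotpNl opprK.
  - apply/measurable_EFinP; apply: measurable_funM.
      apply: measurable_funX; apply: measurableT_comp => //; exact: measurable_funB.
    exact: (measurableT_comp mv (measurable_rVB x)).
  - by move=> t; rewrite lee_fin mulr_ge0 ?sqr_ge0// v0.
rewrite (@fubini_tonelli _ _ _ _ _ mu mu (EFin \o q))//.
2: exact/measurable_EFinP.
(* For each fixed [h], Plancherel trades the [x]-integral of [q] for the frequency integral of [e];
   the singular weight [v h] is then only a constant factor. *)
pose e (z : rV * rV) := w z.1 z.2 * v z.1 * H z.2.
have me : measurable_fun setT e.
  apply: measurable_funM; last exact: measurableT_comp mH measurable_snd.
  apply: measurable_funM => //; exact: measurableT_comp mv measurable_fst.
have e0 z : 0 <= e z by rewrite mulr_ge0// mulr_ge0.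
transitivity (\int[mu]_h \int[mu]_t (e (h, t))%:E)%E.
  apply: eq_integral => h _; rewrite /q /e /=.
  have di := sq_integrable_difference h fi.
  have mw1 : measurable_fun setT (w h) by exact: measurableT_comp mw (pair1_measurable h).
  have wHi : mu.-integrable setT (EFin \o (fun t => w h t * H t)).
    have := integrableMR mw1 (w4 h) Hi.
    by under [X in EFin \o X]eq_fun do rewrite mulrC.
  have i1 := integrableZR (v h) di.2; have i2 := integrableZR (v h) wHi.
  transitivity (\int[mu]_x (v h * (f (x + h) - f x) ^+ 2)%:E)%E.
    by apply: eq_integral => x _; rewrite mulrC.
  rewrite -(EFin_Rintegral i1) RintegralZl//; last exact: di.2.
  rewrite (is_FT_difference h FTf) -RintegralZl// EFin_Rintegral//.
  by apply: eq_integral => t _; congr EFin; rewrite -/(H t) -/(w h t); ring.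
rewrite (@fubini_tonelli _ _ _ _ _ mu mu (EFin \o e))//.
2: exact/measurable_EFinP.
rewrite -ge0_integralZl//; last 3 first.
- by apply/measurable_EFinP; apply: measurable_funM => //; exact: measurable_enorm.
- by move=> t _; rewrite lee_fin; apply: mulr_ge0 (enorm_ge0 t) (H0 t).
- have pc0 : 0 <= @poisson_const R n.
    by rewrite mulr_ge0 ?exprn_ge0 ?sqrtr_ge0// invr_ge0 ltW// pow_gauss_integral_gt0.
  by rewrite lee_fin; apply: mulr_ge0; apply: mulr_ge0 => //; exact: pi_ge0.
apply: eq_integral => t _; rewrite /e/=.
under eq_integral do rewrite mulrC EFinM.
rewrite ge0_integralZl//.
2: apply/measurable_EFinP; apply: measurable_funM => //; exact: (measurableT_comp mw (pair2_measurable t)).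
2: by move=> h _; rewrite lee_fin mulr_ge0.
2: by rewrite lee_fin.
by rewrite (integral_one_minus_cos n0) -EFinM -EFinM; congr EFin; rewrite /H; ring.
Qed.

End fractional_seminorm.

Theorem theorem4p10 (R : realType) (n : nat) (hn : (1 <= n)%N)
    (u : 'rV[R]_n * R -> R) (f : 'rV[R]_n -> R) (fhat : 'rV[R]_n -> R[i])
    (hu : dirichlet_space u) (hf : boundary_function u f)
    (hfhat : is_fourier_L2 f fhat) :
  let F := canonical_monogenic u f in
  [/\ dirichlet_energy u =
        ((2 * pi)%:E *
         \int[lebesgue_rV R n]_t (enorm t * Normc.normc (fhat t) ^+ 2)%:E)%E,
      ((2 * pi)%:E *
         \int[lebesgue_rV R n]_t (enorm t * Normc.normc (fhat t) ^+ 2)%:E)%E =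
        (\int[lebesgue_half]_(p in half_space)
           (cl_norm (cl_Dbar F p) ^+ 2)%:E)%E &
      (\int[lebesgue_half]_(p in half_space)
           (cl_norm (cl_Dbar F p) ^+ 2)%:E)%E =
        ((sphere_area n)^-1%:E *
         \int[lebesgue_rV R n]_t1 \int[lebesgue_rV R n]_t2
           (`|f t1 - f t2| ^+ 2 / enorm (t1 - t2) ^+ n.+1)%:E)%E].
Proof.
move=> F.
have FTf := is_fourier_L2_FT hf.1 hfhat.
have nE t : Normc.normc (fhat t) ^+ 2 = complex.Re (fhat t) ^+ 2 + complex.Im (fhat t) ^+ 2.
  by case: (fhat t) => a b; rewrite /= sqr_sqrtr// addr_ge0 ?sqr_ge0.
have E1 : dirichlet_energy u = ((2 * pi)%:E *
    \int[lebesgue_rV R n]_t (enorm t * Normc.normc (fhat t) ^+ 2)%:E)%E.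
  by rewrite (dirichlet_energy_FT hn hf FTf); under [in RHS]eq_integral do rewrite nE.
have E2 : (\int[lebesgue_half]_(p in half_space) (cl_norm (cl_Dbar F p) ^+ 2)%:E)%E =
    dirichlet_energy u.
  apply: eq_integral => p; rewrite inE => hp.
  by rewrite (cl_norm_Dbar hn hf hp).
split; [exact: E1|by rewrite E2 E1|].
rewrite E2 E1 (fractional_seminorm_FT hn FTf) muleA -EFinM.
(* The 2 of 2 - 2 cos is what completes 1 / omega_n to the constant of the Poisson kernel. *)
have -> : (sphere_area n)^-1 * (2 * @poisson_const R n * (2 * pi)) =
    (@normalization R n * @poisson_const R n) * (2 * pi) by rewrite /normalization; ring.
by rewrite normalizationK mul1r; under eq_integral do rewrite nE.
Qed.
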